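(* Let $F$ be a formal group over $\mathbb{C}$ and let $\phi(x,z)$ be an associate of $F$. Let $W$ be a vector space and let $U$ be a $\phi$-quasi compatible subset of $\mathcal{E}(W)$. Then there exists a $Y_{\mathcal{E}}^{\phi}$-closed $\phi$-quasi compatible subspace of $\mathcal{E}(W)$ which contains $U$ and $1_{W}$. Denote by $\langle U\rangle_{\phi}$ the smallest such $Y_{\mathcal{E}}^{\phi}$-closed $\phi$-quasi compatible subspace. Then $(\langle U\rangle_{\phi},Y_{\mathcal{E}}^{\phi},1_{W})$ carries the structure of a nonlocal vertex $F$-algebra and $W$ is a $\phi$-coordinated quasi $\langle U\rangle_{\phi}$-module with $Y_{W}(a(x),z)=a(z)$ for $a(x)\in \langle U\rangle_{\phi}$.
   Context: All vector spaces are over $\mathbb{C}$. A (one-dimensional) formal group over $\mathbb{C}$ is $F(x,y)\in\mathbb{C}[[x,y]]$ with $F(x,0)=x$, $F(0,y)=y$, $F(x,F(y,z))=F(F(x,y),z)$; it is automatically commutative. An associate of $F$ is $\phi(x,z)\in\mathbb{C}((x))[[z]]$ with $\phi(x,0)=x$ and $\phi(\phi(x,y),z)=\phi(x,F(y,z))$; powers $\phi(x,z)^m$, $m\in\mathbb{Z}$, are taken in $\mathbb{C}((x))[[z]]$. For a vector space $W$, $W((x_1,\dots,x_r))=W[[x_1,\dots,x_r]][x_1^{-1},\dots,x_r^{-1}]$. Set $\mathcal{E}(W)=\mathrm{Hom}(W,W((x)))\subset(\mathrm{End}\,W)[[x,x^{-1}]]$. A finite sequence $a^1(x),\dots,a^r(x)$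 in $\mathcal{E}(W)$ is $\phi$-quasi compatible if there exists a nonzero $p(x,y)\in\mathbb{C}[[x,y]]$ with $p(\phi(x,z),x)\neq0$ and $$\Big(\prod_{1\le i<j\le r}p(x_i,x_j)\Big)a^1(x_1)\cdots a^r(x_r)\in\mathrm{Hom}(W,W((x_1,\dots,x_r))).$$ A subset (or subspace) of $\mathcal{E}(W)$ is $\phi$-quasi compatible if every finite sequence in it is $\phi$-quasi compatible. For a $\phi$-quasi compatible pair $(a(x),b(x))$, choose $p(x,y)\in\mathbb{C}[[x,y]]$ with $p(\phi(x,z),x)\ne0$ and $p(x_1,x_2)a(x_1)b(x_2)\in\mathrm{Hom}(W,W((x_1,x_2)))$, and define $a(x)^{\phi}_nb(x)\in\mathcal{E}(W)$ ($n\in\mathbb{Z}$) by $$Y_{\mathcal{E}}^{\phi}(a(x),z)b(x)=\sum_{n\in\mathbb{Z}}a(x)_n^{\phi}b(x)z^{-n-1}=p(\phi(x,z),x)^{-1}\left(p(x_1,x)a(x_1)b(x)\right)|_{x_1=\phi(x,z)},$$ where $p(\phi(x,z),x)^{-1}$ is the inverse in $\mathbb{C}((x))((z))$ and the substitution is expanded in nonnegative powers of $z$; this is independent of the choice of $p$. A $\phi$-quasi compatible subspace $U$ is $Y_{\mathcal{E}}^{\phi}$-closed if $a(x)_n^{\phi}b(x)\in U$ for all $a(x),b(x)\in U$, $n\in\mathbb{Z}$. A nonlocal vertex $F$-algebra is a vector space $V$ with a linear map $Y(\cdot,x):V\to \mathrm{Hom}(V,V((x)))$ and a vector $\mathbf{1}\in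 V$ such that $Y(\mathbf{1},x)v=v$, $Y(v,x)\mathbf{1}\in V[[x]]$, $\lim_{x\to0}Y(v,x)\mathbf{1}=v$ for $v\in V$, and for $u,v,w\in V$ there exists a nonnegative integer $l$ such that $$F(x_0,x_2)^lY(u,F(x_0,x_2))Y(v,x_2)w=F(x_0,x_2)^lY(Y(u,x_0)v,x_2)w,$$ where in $Y(u,F(x_0,x_2))$ the powers $F(x_0,x_2)^m$, $m\in\mathbb{Z}$, are expanded in $\mathbb{C}((x_0))[[x_2]]$. A $\phi$-coordinated quasi $V$-module is a vector space $W$ with a linear map $Y_W(\cdot,x):V\to\mathrm{Hom}(W,W((x)))$ such that $Y_W(\mathbf{1},x)=1_W$ and for $u,v\in V$ there exists $q(x_1,x_2)\in\mathbb{C}[[x_1,x_2]]$ such that $q(\phi(x_2,x_0),x_2)\neq0$, $q(x_1,x_2)Y_W(u,x_1)Y_W(v,x_2)\in\mathrm{Hom}(W,W((x_1,x_2)))$ and $$\left(q(x_1,x_2)Y_W(u,x_1)Y_W(v,x_2)\right)|_{x_1=\phi(x_2,x_0)}=q(\phi(x_2,x_0),x_2)Y_W(Y(u,x_0)v,x_2).$$ *)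

(* Defs.v *)
From HB Require Import structures.
From mathcomp Require Import all_boot all_order all_algebra.
From mathcomp Require Import boolp classical_sets functions fsbigop.

Set Implicit Arguments.
Unset Strict Implicit.
Unset Printing Implicit Defensive.

Import GRing.Theory.

Local Open Scope classical_set_scope.
Local Open Scope ring_scope.

(* A formal series is its function of coefficients: exponents range over int,
   int * int or {ffun 'I_r -> int} (one, two or r variables); negative exponents
   are allowed, and the various spaces of series are predicates on such
   functions.  The sums \sum_(i \in setT) are finite-support sums: such a sum is
   0 by convention if infinitely many terms are nonzero, but whenever the
   corresponding expression in formal series makes sense, only finitely many
   terms of the sum are nonzero. *)

Section Series.
Variable K : fieldType.

Section Product.
Variables (G : zmodType) (V : lmodType K).

Definition smul (f : G -> K) (g : G -> V) : G -> V :=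
  fun n => \sum_(e \in [set: G]) f e *: g (n - e).

End Product.

Definition mulS (G : zmodType) (f g : G -> K) : G -> K := smul f (g : G -> K^o).

Definition sone (G : zmodType) : G -> K := fun n => (n == 0)%:R.

Definition npow (G : zmodType) (f : G -> K) (n : nat) : G -> K :=
  iter n (mulS f) (@sone G).

(* C[[x, y]] *)
Definition pseries2 (f : int * int -> K) : Prop :=
  forall i j : int, (i < 0) || (j < 0) -> f (i, j) = 0.

Section TwoVariables.
Variable V : lmodType K.
Implicit Type h : int * int -> V.

(* V((x))[[z]]: h (i, j) is the coefficient of x^i z^j *)
Definition laurent_pseries h : Prop :=
  (forall i j : int, j < 0 -> h (i, j) = 0) /\
  (forall j, exists N : int, forall i : int, i < N -> h (i, j) = 0).

(* V((x))((z)) *)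
Definition laurent_laurent h : Prop :=
  (exists M : int, forall i j : int, j < M -> h (i, j) = 0) /\
  (forall j, exists N : int, forall i : int, i < N -> h (i, j) = 0).

(* V((x, y)) *)
Definition laurent2 h : Prop :=
  exists N : int, forall i j : int, (i < N) || (j < N) -> h (i, j) = 0.

End TwoVariables.

(* V((x_1, ..., x_r)) *)
Definition laurentr (V : lmodType K) (r : nat) (h : {ffun 'I_r -> int} -> V) :
    Prop :=
  exists N : int, forall e : {ffun 'I_r -> int},
    (exists i, e i < N) -> h e = 0.

Definition inv_in (A : set (int * int -> K)) (f : int * int -> K) :
    int * int -> K :=
  xget 0 [set g | A g /\ mulS f g = @sone (int * int)%type].

(* f^m, with negative powers taken in C((x))[[z]] *)
Definition zpow (f : int * int -> K) (m : int) : int * int -> K :=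
  match m with
  | Posz n => npow f n
  | Negz n => npow (inv_in (laurent_pseries (V := K^o)) f) n.+1
  end.

(* F(x, F(y, z)) = F(F(x, y), z) is the last clause: it equates the
   coefficients of x^i y^k z^l. *)
Definition formal_group (F : int * int -> K) : Prop :=
  [/\ pseries2 F,
      forall i, F (i, 0) = (i == 1)%:R,
      forall j, F (0, j) = (j == 1)%:R &
      forall i k l : int,
        \sum_(j \in [set: nat]) F (i, j%:Z) * npow F j (k, l) =
        \sum_(j \in [set: nat]) npow F j (i, k) * F (j%:Z, l)].

(* phi(phi(x, y), z) = phi(x, F(y, z)) is the last clause: it equates the
   coefficients of x^i y^k z^l. *)
Definition associate (F phi : int * int -> K) : Prop :=
  [/\ laurent_pseries (V := K^o) phi,
      forall i, phi (i, 0) = (i == 1)%:R &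
      forall i k l : int,
        \sum_(m \in [set: int]) zpow phi m (i, k) * phi (m, l) =
        \sum_(j \in [set: nat]) phi (i, j%:Z) * npow F j (k, l)].

(* h(x1, x) |_{x1 = phi(x, z)}, as a series in (x, z) *)
Definition subst_phi (phi : int * int -> K) (V : lmodType K)
    (h : int * int -> V) : int * int -> V :=
  fun k => \sum_(mn \in [set: int * int])
    zpow phi mn.1 (k - (mn.2, 0)) *: h mn.

(* h(x1, x2) |_{x1 = F(x0, x2)}, as a series in (x0, x2) *)
Definition subst_F (F : int * int -> K) (V : lmodType K)
    (h : int * int -> V) : int * int -> V :=
  fun k => \sum_(mn \in [set: int * int])
    zpow F mn.1 (k - (0, mn.2)) *: h mn.

(* p(phi(x, z), x) *)
Definition subst_phi_scalar (phi p : int * int -> K) : int * int -> K :=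
  subst_phi phi (p : int * int -> K^o).

End Series.

(* E(W) = Hom(W, W((x))): a w n is the coefficient of x^n in a(x)w. *)
Section CalE.
Variables (K : fieldType) (W : lmodType K).

Definition hom_laurent : {pred W -> int -> W} := fun a =>
  `[< linear a /\
      forall w, exists N : int, forall n : int, n < N -> a w n = 0 >].

Lemma hom_laurent_submod : submod_closed hom_laurent.
Proof.
split.
  apply/asboolP; split; last by move=> w; exists 0.
  by move=> c u v; rewrite /= scaler0 addr0.
move=> c a b /asboolP[la ta] /asboolP[lb tb]; apply/asboolP; split.
  move=> d u v; apply/funext => n.
  rewrite !fctE la lb !fctE !scalerDr !scalerA (mulrC c d) -!addrA.
  by congr (_ + _); rewrite addrCA.
move=> w; have [N1 h1] := ta w; have [N2 h2] := tb w.
exists (Order.min N1 N2) => n; rewrite Order.TotalTheory.lt_min => /andP[n1 n2].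
by rewrite !fctE h1 // h2 // scaler0 addr0.
Qed.

HB.instance Definition _ :=
  GRing.isSubmodClosed.Build K (W -> int -> W) hom_laurent hom_laurent_submod.

Record calE := CalE {
  calE_fun :> W -> int -> W;
  _ : calE_fun \in hom_laurent }.

HB.instance Definition _ := [isSub for calE_fun].
HB.instance Definition _ := [Choice of calE by <:].
HB.instance Definition _ := [SubChoice_isSubLmodule of calE by <:].

Definition id_fun : W -> int -> W := fun w n => if n == 0 then w else 0.

Lemma id_fun_hom : id_fun \in hom_laurent.
Proof.
apply/asboolP; split.
  move=> c u v; apply/funext => n; rewrite !fctE /id_fun.
  by case: (n == 0); rewrite // scaler0 addr0.
by move=> w; exists 0 => -[].
Qed.

(* 1_W *)
Definition id_calE : calE := CalE id_fun_hom.

(* a(x1) b(x2) w *)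
Definition comp2 (a b : calE) (w : W) : int * int -> W :=
  fun mn => a (b w mn.2) mn.1.

(* a^1(x_1) ... a^r(x_r) w *)
Definition compr (r : nat) (a : 'I_r -> calE) (w : W) :
    {ffun 'I_r -> int} -> W :=
  fun m => foldr (fun i v => a i v (m i)) w (enum 'I_r).

End CalE.

Section QuasiCompatible.
Variables (K : fieldType) (W : lmodType K) (phi : int * int -> K).

(* p(x_i, x_j) as a series in x_1, ..., x_r *)
Definition at_variables (r : nat) (p : int * int -> K) (i j : 'I_r) :
    {ffun 'I_r -> int} -> K :=
  fun e => if [forall k, (k != i) && (k != j) ==> (e k == 0)]
           then p (e i, e j) else 0.

Definition prod_pairs (r : nat) (p : int * int -> K) :
    {ffun 'I_r -> int} -> K :=
  \big[@mulS K {ffun 'I_r -> int} / @sone K {ffun 'I_r -> int}]_(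
      ij : 'I_r * 'I_r | (ij.1 < ij.2)%N) at_variables p ij.1 ij.2.

Definition quasi_compatible_seq (r : nat) (a : 'I_r -> calE W) : Prop :=
  exists p : int * int -> K,
    [/\ pseries2 p, p <> 0, subst_phi_scalar phi p <> 0 &
        forall w, laurentr (smul (prod_pairs p) (compr a w))].

Definition quasi_compatible (A : set (calE W)) : Prop :=
  forall (r : nat) (a : 'I_r -> calE W),
    (forall i, A (a i)) -> quasi_compatible_seq a.

Definition compatible_with (a b : calE W) (p : int * int -> K) : Prop :=
  [/\ pseries2 p, subst_phi_scalar phi p <> 0 &
      forall w, laurent2 (smul p (comp2 a b w))].

(* (Y_E^phi(a(x), z) b(x)) w as a series in (x, z) *)
Definition YE (a b : calE W) (w : W) : int * int -> W :=
  let p := xget 0 [set p | compatible_with a b p] in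
  smul (inv_in (laurent_laurent (V := K^o)) (subst_phi_scalar phi p))
       (subst_phi phi (smul p (comp2 a b w))).

(* a(x)_n^phi b(x) *)
Definition nth_product (a b : calE W) (n : int) : W -> int -> W :=
  fun w i => YE a b w (i, - n - 1).

Definition YE_closed (S : submodClosed (calE W)) : Prop :=
  forall a b, a \in S -> b \in S ->
    forall n : int, exists2 c : calE W,
      c \in S & c = nth_product a b n :> (W -> int -> W).

Definition closed_subspace_over (U : set (calE W))
    (S : submodClosed (calE W)) : Prop :=
  [/\ YE_closed S, quasi_compatible [set` S], U `<=` [set` S] &
      id_calE W \in S].

(* S = <U>_phi *)
Definition generated_subspace (U : set (calE W))
    (S : submodClosed (calE W)) : Prop :=
  closed_subspace_over U S /\
  forall T : submodClosed (calE W),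
    closed_subspace_over U T -> {subset S <= T}.

End QuasiCompatible.

Section Subspace.
Variables (K : fieldType) (V : lmodType K) (S : submodClosed V).

Record subspace := Subspace { subspace_val :> V; _ : subspace_val \in S }.

HB.instance Definition _ := [isSub for subspace_val].
HB.instance Definition _ := [Choice of subspace by <:].
HB.instance Definition _ := [SubChoice_isSubLmodule of subspace by <:].

End Subspace.

(* Y u v n is the coefficient of x^n in Y(u, x)v.  In weak associativity both
   sides are series in (x0, x2). *)
Definition nonlocal_vertex_algebra (K : fieldType) (F : int * int -> K)
    (V : lmodType K) (Y : V -> calE V) (vac : V) : Prop :=
  [/\ linear Y,
      forall v (n : int), Y vac v n = if n == 0 then v else 0,
      forall v (n : int), n < 0 -> Y v vac n = 0,
      forall v, Y v vac 0 = v &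
      forall u v w, exists l : nat,
        smul (npow F l) (subst_F F (comp2 (Y u) (Y v) w)) =
        smul (npow F l) (fun ij : int * int => Y (Y u v ij.1) w ij.2)].

(* In the last clause both sides are series in (x2, x0). *)
Definition coordinated_quasi_module (K : fieldType) (phi : int * int -> K)
    (V : lmodType K) (Y : V -> calE V) (vac : V)
    (W : lmodType K) (YW : V -> calE W) : Prop :=
  [/\ linear YW,
      YW vac = id_calE W &
      forall u v, exists q : int * int -> K,
        [/\ pseries2 q, subst_phi_scalar phi q <> 0,
            forall w, laurent2 (smul q (comp2 (YW u) (YW v) w)) &
            forall w,
              subst_phi phi (smul q (comp2 (YW u) (YW v) w)) =
              smul (subst_phi_scalar phi q)
                   (fun ij : int * int => YW (Y u v ij.2) w ij.1)]].

(* Main.v *)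
(* The smallest closed subspace is generated inductively from U and 1_W by linear
   combinations and n-th products.  That it is quasi compatible is an induction on
   generators inserted into words: if a, b are adjacent in a quasi compatible word, they
   may be replaced by a_n b.  Substituting x_s = phi(x_t, z) for the variable of a turns
   the remaining factors p(x_i, x_j) into a series R whose value at z = 0 is a
   product rho of such factors in the shorter word.  Since rho - R is divisible by z, a large
   power of rho multiplies each coefficient of Y(a, z)b into the required space, because
   the contribution of (rho - R)^N starts beyond the coefficient in question.

   For weak associativity take p good for the triple a, b, c and consider
   p(x_1, x_2)p(x_1, x_3)p(x_2, x_3) a(x_1)b(x_2)c(x_3)w.  Substituting x_1 = phi(x_2, z) and then x_2 = phi(x_3, y), or first x_2 = phi(x_3, y) and then
   x_1 = phi(x_3, F(z, y)), gives the same series, by the defining identity of the associate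
   (and commutativity of F).  One side is Y(Y(a, z)b, y)c and the other is
   Y(a, F(z, y))Y(b, y)c, both multiplied by the image of the product of the p's, which is
   F(z, y)^k times an invertible series. *)

Require Import Defs.
From HB Require Import structures.
From mathcomp Require Import all_boot all_order all_algebra.
From mathcomp Require Import boolp classical_sets functions cardinality fsbigop reals complex.
From mathcomp Require Import zify ring.

Set Implicit Arguments.
Unset Strict Implicit.
Unset Printing Implicit Defensive.

Import Order.TTheory GRing.Theory Num.Theory.

Local Open Scope classical_set_scope.
Local Open Scope ring_scope.

(** Convolution is a finite-support sum with default value 0, so it is neither associative nor
    distributive on arbitrary series, and each rearrangement must take place where the sums involved
    are finite. The word a(x_1)b(x_2)w, its images under substitution and the two sides of
    associativity lie in different iterated Laurent spaces. A space is therefore given by a family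
    of supports ([sfam]), and the well-ordered supports for a lexicographic order, with a ranking of
    the variables that may vary, serve as ambient spaces.

    The obstacle is sharpest at the end: Y(Y(a, z)b, y)c has z as outer variable, Y(a, F(z, y))Y(b,
    y)c has y. They agree up to the image of the product of the p's, which can be cancelled only as
    far as its inverse lies in both spaces; this excludes F(z, y)^k. As k is the order in z of
    p(phi(x, z), x), it does not depend on the vector of W, as associativity in the generated
    algebra requires. Commutativity of F enters because the associate identity produces F(y, z); in
    characteristic 0 it follows from an invariant differential equation. *)

Notation fsum f := (\sum_(x \in [set: _]) f x).
Notation supp h := [set e | h e <> 0].

(** * Sums of finite support *)

Lemma finite_cover (T : eqType) (A : set T) : finite_set A ->
  exists2 s : seq T, uniq s & forall x, A x -> x \in s.
Proof.
move=> /finite_seqP[s ->]; exists (undup s); first exact: undup_uniq.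
by move=> x /=; rewrite mem_undup.
Qed.

Lemma finite_dep (T T' : choiceType) (A : set T) (B : T -> set T') (C : set (T * T')) :
  finite_set A -> (forall x, A x -> finite_set (B x)) ->
  (forall x, C x -> A x.1 /\ B x.1 x.2) -> finite_set C.
Proof.
move=> fA fB CAB; apply: sub_finite_set (finite_setXR fA fB).
by move=> x /CAB.
Qed.

Lemma finite_via (T T' : Type) (A : set T) (g : T' -> T) (C : set T') (h : T -> T') :
  finite_set A -> (forall x, C x -> A (g x)) -> (forall x, C x -> h (g x) = x) -> finite_set C.
Proof.
move=> fA CA hg; apply: (@sub_finite_set _ _ (h @` A)); last exact: finite_image.
by move=> x Cx; exists (g x); [exact: CA|exact: hg].
Qed.

Section FiniteSums.
Variable V : zmodType.

Lemma fsumE (I : choiceType) (s : seq I) (f : I -> V) : uniq s ->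
  (forall x, f x <> 0 -> x \in s) -> fsum f = \sum_(x <- s) f x.
Proof.
move=> us sf; rewrite (fsbigE s) //; first by apply: eq_bigl => x; rewrite in_setT.
by move=> i _; apply: contraNeq => /eqP; exact: sf.
Qed.

Lemma fsum0 (I : choiceType) (f : I -> V) : (forall x, f x = 0) -> fsum f = 0.
Proof. by move=> f0; apply: fsbig1. Qed.

Lemma eq_fsum (I : choiceType) (f g : I -> V) : f =1 g -> fsum f = fsum g.
Proof. by move=> /funext ->. Qed.

Lemma fsum1 (I : choiceType) (x : I) (f : I -> V) :
  (forall y, y <> x -> f y = 0) -> fsum f = f x.
Proof.
move=> f0; rewrite (@fsumE _ [:: x]) ?big_seq1 // => y.
by rewrite inE; apply: contra_notT => /eqP; exact: f0.
Qed.

Lemma fsum_neq0 (I : choiceType) (f : I -> V) : fsum f <> 0 -> exists x, f x <> 0.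
Proof.
by move=> f0; apply: contrapT => /forallNP nf; apply: f0; apply: fsum0 => x; apply: contrapT.
Qed.

Lemma fsum_pair (I J : choiceType) (f : I -> J -> V) :
  finite_set [set ij : I * J | f ij.1 ij.2 <> 0] ->
  fsum (fun i => fsum (f i)) = fsum (fun ij : I * J => f ij.1 ij.2).
Proof.
move=> /finite_cover[s us sf].
set s1 := undup (map fst s); set s2 := undup (map snd s).
have us1 : uniq s1 by apply: undup_uniq.
have us2 : uniq s2 by apply: undup_uniq.
have in1 i j : f i j <> 0 -> i \in s1.
  by move=> fij; rewrite mem_undup; apply/mapP; exists (i, j) => //; apply: (sf (i, j)).
have in2 i j : f i j <> 0 -> j \in s2.
  by move=> fij; rewrite mem_undup; apply/mapP; exists (i, j) => //; apply: (sf (i, j)).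
rewrite (@fsumE _ s1) //; last by move=> i /fsum_neq0[j /in1].
under eq_bigr => i _ do rewrite (@fsumE _ s2 (f i) us2 (@in2 i)).
rewrite (@fsumE _ [seq (i, j) | i <- s1, j <- s2]).
- by rewrite big_allpairs.
- by apply: allpairs_uniq => // -[? ?] [? ?].
- by move=> [i j] /= fij; apply: allpairs_f; [exact: in1 fij|exact: in2 fij].
Qed.

Lemma fsum_inj (I J : choiceType) (h : I -> J) (f : J -> V) : injective h ->
  (forall j, f j <> 0 -> exists i, j = h i) -> fsum f = fsum (fun i => f (h i)).
Proof.
move=> hi fh; rewrite -(fsbig_widen (range h) setT) //.
  by rewrite fsbig_image // => x y _ _; exact: hi.
move=> x [_ nx] /=; apply: contrapT => /fh[i xi]; apply: nx; exists i => //.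
Qed.

Lemma fsum_bij (I J : choiceType) (h : I -> J) (h' : J -> I) (f : J -> V) :
  cancel h h' -> cancel h' h -> fsum f = fsum (fun i => f (h i)).
Proof. by move=> c c'; apply: fsum_inj; [exact: can_inj c|move=> j _; exists (h' j)]. Qed.

Lemma fsum_swap (I J : choiceType) (f : I -> J -> V) :
  finite_set [set ij : I * J | f ij.1 ij.2 <> 0] ->
  fsum (fun i => fsum (f i)) = fsum (fun j => fsum (fun i => f i j)).
Proof.
move=> fin; rewrite fsum_pair // (fsum_pair (f := fun j i => f i j)).
  by rewrite (@fsum_bij _ _ (fun ji => (ji.2, ji.1)) (fun ij => (ij.2, ij.1))) // => -[].
apply: (finite_via (g := fun ji => (ji.2, ji.1)) (h := fun ij => (ij.2, ij.1))) fin _ _ => //.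
by case.
Qed.

Lemma fsumD (I : choiceType) (f g : I -> V) :
  finite_set (supp f) -> finite_set (supp g) ->
  fsum (fun i => f i + g i) = fsum f + fsum g.
Proof.
move=> ff fg; have /finite_cover[s us sfg] : finite_set (supp f `|` supp g) by rewrite finite_setU.
rewrite !(@fsumE _ s) ?big_split //= => x fx; apply: sfg => /=; [by right|by left|].
by apply: contrapT => /not_orP[/contrapT f0 /contrapT g0]; apply: fx; rewrite f0 g0 addr0.
Qed.

End FiniteSums.

Lemma fsum_morph (V V' : zmodType) (L : V -> V') (I : choiceType) (f : I -> V) :
  L 0 = 0 -> {morph L : x y / x + y} -> finite_set (supp f) ->
  L (fsum f) = fsum (fun i => L (f i)).
Proof.
move=> L0 LD /finite_cover[s us sf].
rewrite (fsumE us sf) (@fsumE _ _ s) ?(big_morph L LD L0) // => x.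
by move=> Lf; apply: sf => f0; apply: Lf; rewrite f0.
Qed.

Arguments fsum_morph {V V'} L {I} f.
Arguments fsum1 {V I} x f.
Arguments fsum_inj {V I J} h f.
Arguments fsum_bij {V I J} h h' f.

(** Negation preserves the support, so if it is infinite both sides are the default value 0; no
    finiteness has to be assumed. *)
Lemma fsumN (V : zmodType) (I : choiceType) (f : I -> V) :
  fsum (fun i => - f i) = - fsum f.
Proof.
have e : supp (fun i => - f i) = supp f.
  by apply/funext => i /=; apply/propext; split => h1 h2; apply: h1; [rewrite h2 oppr0|apply/eqP; rewrite -oppr_eq0 h2].
have [ff|nf] := pselect (finite_set (supp f)).
  by rewrite (fsum_morph -%R) ?oppr0 // => x y; rewrite opprD.
rewrite [in RHS]fsbig_dflt ?oppr0; last by rewrite setTI.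
by rewrite fsbig_dflt // setTI; move: nf; rewrite -e.
Qed.

Lemma fsumZ (K : fieldType) (V : lmodType K) (I : choiceType) (a : K) (f : I -> V) :
  fsum (fun i => a *: f i) = a *: fsum f.
Proof.
(* Scaling by a nonzero a preserves the support, finite or not; a = 0 destroys it and is treated
   apart. *)
have [->|a0] := eqVneq a 0; first by rewrite scale0r; apply: fsum0 => x; rewrite scale0r.
have e : supp (fun i => a *: f i) = supp f.
  apply/funext => i /=; apply/propext; split => h1 h2; apply: h1; first by rewrite h2 scaler0.
  by apply/eqP; move/eqP: h2; rewrite scaler_eq0 (negbTE a0).
have [ff|nf] := pselect (finite_set (supp f)).
  by rewrite (fsum_morph ( *:%R a)) ?scaler0 // => x y; rewrite scalerDr.
rewrite [in RHS]fsbig_dflt ?scaler0; last by rewrite setTI.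
by rewrite fsbig_dflt // setTI; move: nf; rewrite -e.
Qed.

Lemma fsumZl (K : fieldType) (V : lmodType K) (I : choiceType) (v : V) (f : I -> K) :
  finite_set (supp f) -> fsum (fun i => f i *: v) = fsum f *: v.
Proof.
move=> ff; rewrite (fsum_morph (fun a => a *: v)) ?scale0r // => x y.
by rewrite scalerDl.
Qed.

(** * Convolution *)

Lemma addfE (T : Type) (V : zmodType) (f g : T -> V) x : (f + g) x = f x + g x.
Proof. by []. Qed.

Lemma oppfE (T : Type) (V : zmodType) (f : T -> V) x : (- f) x = - f x.
Proof. by []. Qed.

Lemma scalefE (K : fieldType) (T : Type) (V : lmodType K) (c : K) (f : T -> V) x :
  (c *: f) x = c *: f x.
Proof. by []. Qed.

Definition sumset (G : zmodType) (A B : set G) : set G :=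
  [set x | exists a b, [/\ A a, B b & x = a + b]].

(* A family of supports for which convolution is finite, so that the series supported in
   it form a ring; each of the iterated Laurent series spaces below is of this kind. *)
Record sfam (G : zmodType) := SFam {
  sf_in :> set G -> Prop;
  sf_sub : forall A B : set G, A `<=` B -> sf_in B -> sf_in A;
  sf_union : forall A B, sf_in A -> sf_in B -> sf_in (A `|` B);
  sf_sum : forall A B, sf_in A -> sf_in B -> sf_in (sumset A B);
  sf_zero : sf_in [set 0];
  sf_fin : forall A B, sf_in A -> sf_in B -> forall g, finite_set [set a | A a /\ B (g - a)] }.

Section SmulAlgebra.
Variables (K : fieldType) (G : zmodType).
Implicit Types (f g : G -> K) (F : sfam G).

Section Module.
Variable V : lmodType K.
Implicit Types h : G -> V.

Lemma smul_supp f h : supp (smul f h) `<=` sumset (supp f) (supp h).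
Proof.
move=> n /= /fsum_neq0[e fe]; exists e, (n - e); split.
- by move=> f0; apply: fe; rewrite f0 scale0r.
- by move=> f0; apply: fe; rewrite f0 scaler0.
- by rewrite addrC subrK.
Qed.

Lemma smul_finP F f h n : F (supp f) -> F (supp h) ->
  finite_set [set e | f e *: h (n - e) <> 0].
Proof.
move=> Ff Fh; apply: sub_finite_set (sf_fin Ff Fh n) => e /= ne.
by split=> z; apply: ne; rewrite z ?scale0r ?scaler0.
Qed.

Lemma smul_in F f h : F (supp f) -> F (supp h) -> F (supp (smul f h)).
Proof. by move=> Ff Fh; apply: sf_sub (@smul_supp f h) (sf_sum Ff Fh). Qed.

Lemma smul1 h : smul (@sone K G) h = h.
Proof.
apply/funext => n; rewrite /smul (fsum1 0).
  by rewrite /sone eqxx scale1r subr0.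
by move=> y /eqP/negbTE y0; rewrite /sone y0 scale0r.
Qed.

Lemma smul0r f : smul f (0 : G -> V) = 0.
Proof. by apply/funext => n; rewrite /smul fsum0 // => x; rewrite scaler0. Qed.

Lemma smulNl f h : smul (- f) h = - smul f h.
Proof.
apply/funext => n; rewrite oppfE /smul -fsumN.
by apply: eq_fsum => e; rewrite oppfE scaleNr.
Qed.

Lemma smulNr f h : smul f (- h) = - smul f h.
Proof.
apply/funext => n; rewrite oppfE /smul -fsumN.
by apply: eq_fsum => e; rewrite oppfE scalerN.
Qed.

Lemma smulZr c f h : smul f (c *: h) = c *: smul f h.
Proof.
apply/funext => n; rewrite scalefE /smul -fsumZ.
by apply: eq_fsum => e; rewrite scalefE !scalerA mulrC.
Qed.

Lemma smulDr F f h h' : F (supp f) -> F (supp h) -> F (supp h') ->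
  smul f (h + h') = smul f h + smul f h'.
Proof.
move=> Ff Fh Fh'; apply/funext => n; rewrite addfE /smul -fsumD; last 2 first.
- exact: smul_finP Ff Fh.
- exact: smul_finP Ff Fh'.
by apply: eq_fsum => e; rewrite -scalerDr.
Qed.

Lemma smulDl F f g h : F (supp f) -> F (supp g) -> F (supp h) ->
  smul (f + g) h = smul f h + smul g h.
Proof.
move=> Ff Fh Fh'; apply/funext => n; rewrite addfE /smul -fsumD; last 2 first.
- exact: smul_finP Ff Fh'.
- exact: smul_finP Fh Fh'.
by apply: eq_fsum => e; rewrite -scalerDl.
Qed.

(** Fubini for a sum over pairs (e, e'). It is finite: e is confined by [sf_fin] applied to f and a
    sumset, and then e' by [sf_fin] for g and h. The bijection (e, e') -> (e + e', e) passes between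
    the two bracketings. *)
Lemma smulA F f g h : F (supp f) -> F (supp g) -> F (supp h) ->
  smul (mulS f g) h = smul f (smul g h).
Proof.
move=> Ff Fg Fh; apply/funext => n.
have fin : finite_set [set ee : G * G | f ee.1 *: (g ee.2 *: h (n - ee.1 - ee.2)) <> 0].
  apply: (finite_dep (sf_fin Ff (sf_sum Fg Fh) n)
            (B := fun e => [set e' | supp g e' /\ supp h (n - e - e')])).
    by move=> e _; exact: sf_fin Fg Fh _.
  move=> [e e'] /= ne.
  have [fe ge he] : [/\ f e <> 0, g e' <> 0 & h (n - e - e') <> 0].
    by split=> z; apply: ne; rewrite z ?(scale0r, scaler0).
  split=> //; split=> //; exists e', (n - e - e'); split=> //.
  by rewrite [RHS]addrC subrK.
transitivity (fsum (fun e => fsum (fun e' => f e *: (g e' *: h (n - e - e'))))); last first.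
  by apply: eq_fsum => e; rewrite fsumZ.
rewrite fsum_pair //.
rewrite (fsum_bij (fun ee : G * G => (ee.2, ee.1 - ee.2)) (fun ee => (ee.1 + ee.2, ee.1))) /=; last 2 first.
- by move=> [e e'] /=; rewrite addrC subrK.
- by move=> [e e'] /=; rewrite addrC addKr.
rewrite -(fsum_pair (f := fun a b => f b *: (g (a - b) *: h (n - b - (a - b))))); last first.
  apply: (finite_via (g := fun ee : G * G => (ee.2, ee.1 - ee.2))
            (h := fun ee => (ee.1 + ee.2, ee.1))) fin _ _.
    by move=> [a b] /=.
  by move=> [a b] /= _; rewrite addrC subrK.
apply: eq_fsum => a; rewrite /mulS [in LHS]/smul -fsumZl.
  by apply: eq_fsum => b; rewrite scalerA; congr (_ *: h _); rewrite opprB addrA subrK.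
apply: sub_finite_set (sf_fin Ff Fg a) => b /= ne.
by split=> z; apply: ne; rewrite z ?(scale0r, scaler0).
Qed.

Lemma smul_linear F (V' : lmodType K) (L : V -> V') f h n : linear L ->
  F (supp f) -> F (supp h) -> L (smul f h n) = smul f (L \o h) n.
Proof.
move=> lL Ff Fh; have L0 : L 0 = 0 by have := lL (-1) 0 0; rewrite scaler0 addr0 scaleN1r addNr.
rewrite /smul (fsum_morph L) //.
- by apply: eq_fsum => e /=; rewrite -[_ *: _ in LHS]addr0 lL L0 addr0.
- by move=> x y; rewrite -[x in LHS]scale1r lL scale1r.
- exact: smul_finP Ff Fh.
Qed.

End Module.

Lemma mulSE f g n : mulS f g n = fsum (fun e => f e * g (n - e)).
Proof. by []. Qed.

Lemma mulSC f g : mulS f g = mulS g f.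
Proof.
apply/funext => n; rewrite !mulSE (fsum_bij (fun e => n - e) (fun e => n - e)).
- by apply: eq_fsum => e; rewrite subKr mulrC.
- by move=> e; rewrite subKr.
- by move=> e; rewrite subKr.
Qed.

Lemma mulS1 f : mulS (@sone K G) f = f.
Proof. exact: (smul1 (V := K^o)). Qed.

Lemma mulS1r f : mulS f (@sone K G) = f.
Proof. by rewrite mulSC mulS1. Qed.

Lemma mulSA F f g h : F (supp f) -> F (supp g) -> F (supp h) ->
  mulS f (mulS g h) = mulS (mulS f g) h.
Proof. by move=> *; rewrite /mulS -(smulA (V := K^o) (F := F)). Qed.

Lemma mulS_in F f g : F (supp f) -> F (supp g) -> F (supp (mulS f g)).
Proof. exact: (smul_in (V := K^o)). Qed.

Lemma sone_in F : F (supp (@sone K G)).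
Proof. by apply: sf_sub (sf_zero F) => x /=; rewrite /sone; case: eqP. Qed.

Lemma npow_in F f n : F (supp f) -> F (supp (npow f n)).
Proof. by move=> Ff; elim: n => [|n IH] /=; [exact: sone_in|exact: mulS_in]. Qed.

Lemma supp0 (V : zmodType) F : F (supp (0 : G -> V)).
Proof. by apply: sf_sub (sf_zero F) => x /= []. Qed.

Lemma suppN (V : zmodType) F (h : G -> V) : F (supp h) -> F (supp (- h)).
Proof. by apply: sf_sub => x /= nh h0; apply: nh; rewrite oppfE h0 oppr0. Qed.

Lemma suppD (V : zmodType) F (h h' : G -> V) : F (supp h) -> F (supp h') -> F (supp (h + h')).
Proof.
move=> Fh Fh'; apply: sf_sub (sf_union Fh Fh') => x /= nh.
apply: contrapT => /not_orP[/contrapT f0 /contrapT g0]; apply: nh.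
by rewrite addfE f0 g0 addr0.
Qed.

End SmulAlgebra.

Section SeriesRing.
Variables (K : fieldType) (G : zmodType) (F : sfam G).

Definition fser_pred : {pred G -> K} := fun f => `[< F (supp f) >].

(** Bundling turns the series with supports in F into a commutative ring, so that powers, big
    products and [ring] become available. *)
Record fser := FSer { fser_val :> G -> K; _ : fser_val \in fser_pred }.

HB.instance Definition _ := [isSub for fser_val].
HB.instance Definition _ := [Choice of fser by <:].

Lemma fser_in (f : fser) : F (supp f).
Proof. by case: f => f /= /asboolP. Qed.

Definition fser_of (f : G -> K) (Ff : F (supp f)) : fser := FSer (introT (asboolP _) Ff).

Lemma fser_zmod_closed : zmod_closed fser_pred.
Proof.
split; first by apply/asboolP; exact: supp0.
by move=> f g /asboolP Ff /asboolP Fg; apply/asboolP; apply: suppD => //; exact: suppN.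
Qed.

HB.instance Definition _ := GRing.isZmodClosed.Build (G -> K) fser_pred fser_zmod_closed.
HB.instance Definition _ := [SubChoice_isSubZmodule of fser by <:].

Definition fser_one : fser := fser_of (@sone_in K G F).
Definition fser_mul (f g : fser) : fser := fser_of (mulS_in (fser_in f) (fser_in g)).

Lemma fser_mulA : associative fser_mul.
Proof. by move=> f g h; apply: val_inj; apply: (mulSA (F := F)); exact: fser_in. Qed.
Lemma fser_mulC : commutative fser_mul.
Proof. by move=> f g; apply: val_inj; apply: mulSC. Qed.
Lemma fser_mul1 : left_id fser_one fser_mul.
Proof. by move=> f; apply: val_inj; apply: mulS1. Qed.
Lemma fser_mulDl : left_distributive fser_mul +%R.
Proof.
by move=> f g h; apply: val_inj; apply: (smulDl (V := K^o) (F := F)); exact: fser_in.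
Qed.
Lemma fser_one_neq0 : fser_one != 0.
Proof.
apply/eqP => /(congr1 (fun f : fser => fser_val f 0)) /= /eqP.
by rewrite /sone eqxx oner_eq0.
Qed.

HB.instance Definition _ := GRing.Zmodule_isComNzRing.Build fser
  fser_mulA fser_mulC fser_mul1 fser_mulDl fser_one_neq0.

Lemma fser_valM (f g : fser) : fser_val (f * g) = mulS (fser_val f) (fser_val g).
Proof. by []. Qed.
Lemma fser_val1 : fser_val 1 = @sone K G.
Proof. by []. Qed.
Lemma fser_valX (f : fser) n : fser_val (f ^+ n) = npow (fser_val f) n.
Proof. by elim: n => // n IH; rewrite exprS fser_valM IH. Qed.

End SeriesRing.

(** * Substitution of series *)

Section Kernels.
Variables (K : fieldType) (G G' : zmodType).
Implicit Types (T : G -> G' -> K) (A : set G).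

(* T e is the image of the monomial x^e under the substitution h |-> subK T h. *)
Definition subK (V : lmodType K) T (h : G -> V) : G' -> V :=
  fun g => \sum_(e \in [set: G]) T e g *: h e.

Definition subS T (q : G -> K) : G' -> K := subK (V := K^o) T q.

Definition kim T A : set G' := [set g | exists2 e, A e & T e g <> 0].

Definition summable (F : sfam G') T A :=
  F (kim T A) /\ forall g, finite_set [set e | A e /\ T e g <> 0].

(** As T e is the image of x^e, this is multiplicativity on monomials; [subK_mul] extends it to
    series. *)
Definition multiplicative_kernel T := forall e e', T (e + e') = mulS (T e) (T e').

Lemma summable_sub F T A B : A `<=` B -> summable F T B -> summable F T A.
Proof.
move=> AB [FB fB]; split=> [|g].
  by apply: sf_sub FB => g [e /AB Be Te]; exists e.
by apply: sub_finite_set (fB g) => e [/AB].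
Qed.

(** The substitutions used here all send x^e to x^(f e) times a series with exponents in one fixed
    set N, as in phi(x, z)^m x^n = x^(m+n) (1 + O(z)). Then g - f e lies in N, so f e takes finitely
    many values, and f has finite fibers. *)
Lemma summable_shift (F : sfam G') T A (f : G -> G') (N : set G') :
  (forall e g, A e -> T e g <> 0 -> N (g - f e)) -> F N -> F (f @` A) ->
  (forall g, finite_set [set e | A e /\ f e = g]) -> summable F T A.
Proof.
move=> TN FN FA fA; split=> [|g].
  apply: sf_sub (sf_sum FA FN) => g [e Ae Te]; exists (f e), (g - f e); split.
  - by exists e.
  - exact: TN.
  - by rewrite addrC subrK.
apply: (finite_via (T := G' * G) (g := fun e => (f e, e)) (h := snd)
  (A := [set x | [set a | (f @` A) a /\ N (g - a)] x.1 /\ [set e | A e /\ f e = x.1] x.2])).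
- by apply: (finite_dep (sf_fin FA FN g) (B := fun a => [set e | A e /\ f e = a])).
- by move=> e [Ae Te] /=; split=> //; split; [exists e|exact: TN].
- by [].
Qed.

Section Module.
Variable V : lmodType K.
Implicit Types h : G -> V.

Lemma subK_supp T h : supp (subK T h) `<=` kim T (supp h).
Proof.
move=> g /= /fsum_neq0[e ne]; exists e => z; apply: ne; rewrite z ?scaler0 ?scale0r //.
Qed.

Lemma subK_in F T h : summable F T (supp h) -> F (supp (subK T h)).
Proof. by move=> [Fk _]; apply: sf_sub (@subK_supp T h) Fk. Qed.

Lemma subK_finP F T h g : summable F T (supp h) -> finite_set [set e | T e g *: h e <> 0].
Proof.
move=> [_ fk]; apply: sub_finite_set (fk g) => e /= ne.
by split=> z; apply: ne; rewrite z ?scaler0 ?scale0r.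
Qed.

Lemma subK0 T : subK T (0 : G -> V) = 0.
Proof. by apply/funext => g; rewrite /subK fsum0 // => e; rewrite scaler0. Qed.

Lemma subKZ T c h : subK T (c *: h) = c *: subK T h.
Proof.
apply/funext => n; rewrite scalefE /subK -fsumZ.
by apply: eq_fsum => e; rewrite scalefE !scalerA mulrC.
Qed.

Lemma subKD F T h h' : summable F T (supp h) -> summable F T (supp h') ->
  subK T (h + h') = subK T h + subK T h'.
Proof.
move=> sh sh'; apply/funext => g; rewrite addfE /subK -fsumD; last 2 first.
- exact: subK_finP sh.
- exact: subK_finP sh'.
by apply: eq_fsum => e; rewrite addfE scalerDr.
Qed.

Lemma subK_linear F (V' : lmodType K) (L : V -> V') T h g : linear L ->
  summable F T (supp h) -> L (subK T h g) = subK T (L \o h) g.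
Proof.
move=> lL sh; have L0 : L 0 = 0 by have := lL (-1) 0 0; rewrite scaler0 addr0 scaleN1r addNr.
rewrite /subK (fsum_morph L) //.
- by apply: eq_fsum => e /=; rewrite -[_ *: _ in LHS]addr0 lL L0 addr0.
- by move=> x y; rewrite -[x in LHS]scale1r lL scale1r.
- exact: subK_finP sh.
Qed.

(** Both sides are rearrangements of one sum over (e, e', a), where e and e' are exponents of q and
    h and a is the part of g taken from T e. It is finite because [sf_fin] confines a, and
    summability then confines e and e'. *)
Lemma subK_mul F T (q : G -> K) h : multiplicative_kernel T ->
  summable F T (supp q) -> summable F T (supp h) ->
  subK T (smul q h) = smul (subS T q) (subK T h).
Proof.
move=> mT [Fq fq] [Fh fh]; apply/funext => g.
pose t (x : G * G * G') := (T x.1.1 x.2 * T x.1.2 (g - x.2)) *: (q x.1.1 *: h x.1.2).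
have fin : finite_set (supp t).
  apply: (finite_via (T := G' * (G * G)) (g := fun x => (x.2, x.1)) (h := fun y => (y.2, y.1))
    (A := [set y | (kim T (supp q) y.1 /\ kim T (supp h) (g - y.1)) /\
       ((supp q y.2.1 /\ T y.2.1 y.1 <> 0) /\ (supp h y.2.2 /\ T y.2.2 (g - y.1) <> 0))])).
  - apply: (finite_dep (sf_fin Fq Fh g) (B := fun a => [set ee |
      (supp q ee.1 /\ T ee.1 a <> 0) /\ (supp h ee.2 /\ T ee.2 (g - a) <> 0)])) => //.
    move=> a _.
    by apply: (finite_dep (fq a) (B := fun _ => [set e | supp h e /\ T e (g - a) <> 0])).
  - move=> [[e e'] a]; rewrite /t /= => ne.
    have [h1 h2 h3 h4] : [/\ q e <> 0, h e' <> 0, T e a <> 0 & T e' (g - a) <> 0].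
      by split=> z; apply: ne; rewrite z ?(mul0r, mulr0, scale0r, scaler0).
    by do !split=> //; [exists e|exists e'].
  - by move=> [[]].
have fin2 : finite_set [set ee : G * G | T (ee.1 + ee.2) g *: (q ee.1 *: h ee.2) <> 0].
  apply: (sub_finite_set _ (finite_image fst fin)) => -[e e'] /= ne.
  have : T (e + e') g <> 0 by move=> z; apply: ne; rewrite z scale0r.
  rewrite mT mulSE => /fsum_neq0[a na]; exists ((e, e'), a) => //=.
  rewrite /t /= => /eqP; rewrite scaler_eq0 => /orP[/eqP //|/eqP z]; apply: ne; by rewrite z scaler0.
transitivity (fsum (fun e => fsum (fun e' => T e g *: (q e' *: h (e - e'))))).
  by apply: eq_fsum => e; rewrite fsumZ.
rewrite fsum_pair; last first.
  apply: (finite_via (g := fun ee : G * G => (ee.2, ee.1 - ee.2))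
            (h := fun ee => (ee.1 + ee.2, ee.1))) fin2 _ _.
    by move=> [e e'] /=; rewrite [e' + _]addrC subrK.
  by move=> [e e'] /= _; rewrite [e' + _]addrC subrK.
rewrite (fsum_bij (fun ee : G * G => (ee.1 + ee.2, ee.1)) (fun ee => (ee.2, ee.1 - ee.2))) /=; last 2 first.
- by move=> [e e'] /=; rewrite [e + _]addrC addrK.
- by move=> [e e'] /=; rewrite [e' + _]addrC subrK.
transitivity (fsum (fun ee : G * G => fsum (fun a => t (ee, a)))).
  apply: eq_fsum => -[e e'] /=; rewrite mT [_ - e]addrAC subrr add0r /t /=.
  have [->|/eqP q0] := eqVneq (q e) 0.
    by rewrite scale0r scaler0 fsum0 // => a; rewrite scaler0.
  have [->|/eqP h0] := eqVneq (h e') 0.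
    by rewrite !scaler0 fsum0 // => a; rewrite scaler0.
  rewrite -fsumZl //; apply: sub_finite_set (sf_fin Fq Fh g) => a /= ne.
  by split; [exists e|exists e'] => // z; apply: ne; rewrite z ?scale0r ?scaler0.
rewrite (fsum_swap (f := fun ee a => t (ee, a))); last first.
  by apply: sub_finite_set fin => -[].
apply: eq_fsum => a.
transitivity (fsum (fun e => fsum (fun e' => (T e a * q e) *: (T e' (g - a) *: h e')))).
  rewrite (fsum_pair (f := fun e e' => (T e a * q e) *: (T e' (g - a) *: h e'))).
    by apply: eq_fsum => -[e e']; rewrite /t /= !scalerA [_ * _ * q e]mulrAC.
  apply: (finite_dep (fq a) (B := fun _ => [set e | supp h e /\ T e (g - a) <> 0])) => //.
  move=> [e e'] /= ne; split; split=> z; apply: ne; by rewrite z ?(mul0r, mulr0, scale0r, scaler0).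
rewrite /subS /subK -fsumZl; last first.
  apply: sub_finite_set (fq a) => e /= ne.
  by split=> z; apply: ne; rewrite z ?scaler0 ?scale0r.
by apply: eq_fsum => e; rewrite fsumZ.
Qed.

End Module.

Lemma subS_in F T (q : G -> K) : summable F T (supp q) -> F (supp (subS T q)).
Proof. by move=> [Fk _]; apply: sf_sub (@subK_supp K^o T q) Fk. Qed.

Lemma subS_mul F T (q q' : G -> K) : multiplicative_kernel T ->
  summable F T (supp q) -> summable F T (supp q') ->
  subS T (mulS q q') = mulS (subS T q) (subS T q').
Proof. exact: (subK_mul (V := K^o)). Qed.

End Kernels.

Section Composition.
Variables (K : fieldType) (G G' G'' : zmodType) (V : lmodType K).

Lemma subK_comp F' F'' (T' : G' -> G'' -> K) (T : G -> G' -> K) (h : G -> V) :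
  summable F' T (supp h) -> summable F'' T' (kim T (supp h)) ->
  subK T' (subK T h) = subK (fun e => subS T' (T e)) h.
Proof.
move=> [F1 f1] [F2 f2]; apply/funext => g.
have fin : finite_set [set x : G' * G | T' x.1 g *: (T x.2 x.1 *: h x.2) <> 0].
  apply: (finite_dep (f2 g) (B := fun a => [set e | supp h e /\ T e a <> 0])).
    by move=> a _; exact: f1.
  move=> [a e] /= ne.
  have [h1 h2 h3] : [/\ h e <> 0, T e a <> 0 & T' a g <> 0].
    by split=> z; apply: ne; rewrite z ?(scale0r, scaler0).
  by split; split=> //; exists e.
transitivity (fsum (fun a => fsum (fun e => T' a g *: (T e a *: h e)))).
  by apply: eq_fsum => a; rewrite fsumZ.
rewrite fsum_swap //; apply: eq_fsum => e.
have [->|/eqP h0] := eqVneq (h e) 0.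
  by rewrite scaler0 fsum0 // => a; rewrite !scaler0.
rewrite /subS /subK -fsumZl; first by apply: eq_fsum => a; rewrite scalerA.
apply: sub_finite_set (f2 g) => a /= ne.
split; last by move=> z; apply: ne; rewrite z scale0r.
by exists e => // z; apply: ne; rewrite z scaler0.
Qed.

End Composition.

Section Pushforward.
Variables (K : fieldType) (G G' : zmodType).

(** The kernel of a substitution taking monomials to monomials, such as setting two variables equal
    or renaming variables. *)
Definition pushk (f : G -> G') : G -> G' -> K := fun e g => (g == f e)%:R.

Lemma pushk_mul (f : G -> G') : {morph f : a b / a + b} -> multiplicative_kernel (pushk f).
Proof.
move=> fD e e'; apply/funext => g; rewrite mulSE (fsum1 (f e)).
  by rewrite /pushk eqxx mul1r fD [in RHS]subr_eq [f e + _]addrC.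
by move=> a /eqP/negbTE ne; rewrite /pushk ne mul0r.
Qed.

Lemma pushk_neq0 (f : G -> G') e g : pushk f e g <> 0 -> g = f e.
Proof. by rewrite /pushk; case: eqP. Qed.

Lemma summable_push (F : sfam G') (f : G -> G') A : F (f @` A) ->
  (forall g, finite_set [set e | A e /\ f e = g]) -> summable F (pushk f) A.
Proof.
move=> FA fA; apply: (summable_shift (f := f) (N := [set 0])) => //.
  by move=> e g _ /pushk_neq0 -> /=; rewrite subrr.
exact: sf_zero.
Qed.

Lemma push_inj (V : lmodType K) (f : G -> G') (h : G -> V) e : injective f ->
  subK (pushk f) h (f e) = h e.
Proof.
move=> fi; rewrite /subK (fsum1 e) ?/pushk ?eqxx ?scale1r // => y ye.
by case: eqP => [/fi|]; [move/esym|rewrite scale0r].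
Qed.

Lemma push_out (V : lmodType K) (f : G -> G') (h : G -> V) g : (forall e, g <> f e) ->
  subK (pushk f) h g = 0.
Proof. by move=> nf; rewrite /subK fsum0 // => e; rewrite /pushk; case: eqP => [/nf //|]; rewrite scale0r. Qed.

End Pushforward.

(** * Families of supports *)

Lemma int_min (P : int -> Prop) (N : int) : (exists x, P x) -> (forall x, P x -> N <= x) ->
  exists2 m, P m & forall x, P x -> m <= x.
Proof.
move=> [x0 Px0] PN.
have ex : exists n : nat, `[< P (N + n%:Z) >].
  by exists `|x0 - N|%N; apply/asboolP; have := PN _ Px0 => ?; rewrite gez0_abs ?subr_ge0 // [_ + (_ - _)]addrC subrK.
case: (ex_minnP ex) => m /asboolP Pm mm; exists (N + m%:Z) => // x Px.
have Nx := PN _ Px; have := mm `|x - N|%N.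
rewrite gez0_abs ?subr_ge0 // [_ + (_ - _)]addrC subrK => /(_ (introT (asboolP _) Px)); lia.
Qed.

Lemma finite_interval (a b : int) : finite_set [set x : int | a <= x /\ x <= b].
Proof.
apply: (finite_via (T := nat) (A := `I_(`|b - a|.+1)) (g := fun x => `|x - a|%N)
  (h := fun n => a + n%:Z)) (finite_II _) _ _ => x /= [ax xb]; [lia|].
by rewrite gez0_abs ?subr_ge0 // [_ + (_ - _)]addrC subrK.
Qed.

Lemma finite_lb (T : Type) (A : set T) (f : T -> int) : finite_set A ->
  exists N, forall x, A x -> N <= f x.
Proof.
move=> fA; have /finite_cover[s _ sA] := finite_image f fA.
exists (\big[Order.min/0]_(x <- s) x) => x Ax.
have /sA : (f @` A) (f x) by exists x.
elim: s {sA} => // y s IH; rewrite inE big_cons => /orP[/eqP ->|/IH]; rewrite ge_min ?lexx // => ->.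
by rewrite orbT.
Qed.

Section TwoVariableLaurent.

(* Supports of the elements of V((x))((z)). *)
Definition LL_in (A : set (int * int)) :=
  (exists M, forall x, A x -> M <= x.2) /\
  (forall j, exists N, forall i, A (i, j) -> N <= i).

Lemma LL_sub A B : A `<=` B -> LL_in B -> LL_in A.
Proof.
move=> AB [[M hM] hN]; split; first by exists M => x /AB; exact: hM.
by move=> j; have [N hN'] := hN j; exists N => i /AB; exact: hN'.
Qed.

Lemma LL_union A B : LL_in A -> LL_in B -> LL_in (A `|` B).
Proof.
move=> [[M hM] hN] [[M' hM'] hN']; split.
  by exists (Order.min M M') => x [/hM|/hM']; rewrite ge_min => ->; rewrite ?orbT.
move=> j; have [N h] := hN j; have [N' h'] := hN' j.
by exists (Order.min N N') => i [/h|/h']; rewrite ge_min => ->; rewrite ?orbT.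
Qed.

(** In degree j of the outer variable only the splittings j = k + (j - k) with M <= k <= j - M'
    occur. They are finitely many, so the bounds N k + N' (j - k) have a minimum. *)
Lemma LL_sum A B : LL_in A -> LL_in B -> LL_in (sumset A B).
Proof.
move=> [[M hM] /choice[N hN]] [[M' hM'] /choice[N' hN']]; split.
  by exists (M + M') => x [a [b [/hM ? /hM' ? ->]]] /=; lia.
move=> j; have [m hm] := finite_lb (fun k => N k + N' (j - k)) (finite_interval M (j - M')).
exists m => i [[a1 a2] [[b1 b2] [Aa Bb [-> jE]]]].
have := hM _ Aa; have := hM' _ Bb; have := hN _ _ Aa; have := hN' _ _ Bb => /= h1 h2 h3 h4.
have := hm a2; rewrite jE /= (_ : a2 + b2 - a2 = b2); last by rewrite addrC addKr.
by move=> /(_ (conj _ _))-h; have := h ltac:(lia) ltac:(lia); lia.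
Qed.

Lemma LL_zero : LL_in [set 0].
Proof. by split; [exists 0 => x -> //|move=> j; exists 0 => i [->]]. Qed.

Lemma LL_fin A B : LL_in A -> LL_in B -> forall g, finite_set [set a | A a /\ B (g - a)].
Proof.
move=> [[M hM] /choice[N hN]] [[M' hM'] /choice[N' hN']] [i j].
have fd : finite_set [set x : int * int | (M <= x.1 /\ x.1 <= j - M') /\
    (N x.1 <= x.2 /\ x.2 <= i - N' (j - x.1))].
  apply: (finite_dep (finite_interval M (j - M'))
     (B := fun k => [set x | N k <= x /\ x <= i - N' (j - k)])) => // k _.
  exact: finite_interval.
apply: (finite_via (g := fun x => (x.2, x.1)) (h := fun x => (x.2, x.1))) fd _ _ => -[a1 a2] //= [Aa Bb'].
have {Bb'}Bb : B (i - a1, j - a2) := Bb'.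
have := hM _ Aa; have := hM' _ Bb; have := hN _ _ Aa; have := hN' _ _ Bb => /= h1 h2 h3 h4.
by split; split; lia.
Qed.

Definition LL : sfam (int * int)%type := SFam LL_sub LL_union LL_sum LL_zero LL_fin.

End TwoVariableLaurent.

Section WellOrdered.
Variables (G : zmodType) (pos : G -> Prop).
Hypotheses (pos0 : ~ pos 0) (posD : forall x y, pos x -> pos y -> pos (x + y))
  (posT : forall x, [\/ x = 0, pos x | pos (- x)]).

(* Hahn's construction: the well-ordered subsets of a totally ordered group, with positive
   cone pos, form a family of supports. *)
Definition wo (A : set G) := forall C : set G, C `<=` A -> (exists c, C c) ->
  exists2 c, C c & forall c', C c' -> c' = c \/ pos (c' - c).

Lemma wo_asym x y : pos (x - y) -> pos (y - x) -> False.
Proof. by move=> h1 /(posD h1); rewrite addrA subrK subrr. Qed.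

Lemma wo_trans x y z : pos (y - x) -> pos (z - y) -> pos (z - x).
Proof. by move=> h1 h2; have := posD h2 h1; rewrite addrA subrK. Qed.

Lemma wo_total x y : [\/ x = y, pos (x - y) | pos (y - x)].
Proof.
case: (posT (x - y)) => [/eqP|h|]; first by rewrite subr_eq0 => /eqP ->; constructor 1.
  by constructor 2.
by rewrite opprB; constructor 3.
Qed.

Lemma wo_sub A B : A `<=` B -> wo B -> wo A.
Proof. by move=> AB wB C CA; apply: wB => x /CA /AB. Qed.

Lemma wo_zero : wo [set 0].
Proof. by move=> C C0 [c Cc]; exists c => // c' /C0 ->; left; rewrite (C0 _ Cc). Qed.

Lemma wo_union A B : wo A -> wo B -> wo (A `|` B).
Proof.
move=> wA wB C CAB [c0 Cc0].
have [[a0 Ca0 Aa0]|nA] := pselect (exists2 a, C a & A a); last first.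
  apply: wB; last by exists c0.
  by move=> x Cx; case: (CAB _ Cx) => // Ax; case: nA; exists x.
have [[b0 Cb0 Bb0]|nB] := pselect (exists2 b, C b & B b); last first.
  apply: wA; last by exists c0.
  by move=> x Cx; case: (CAB _ Cx) => // Ax; case: nB; exists x.
have [||a [Ca Aa] ha] := wA (C `&` A); [by move=> x []|by exists a0|].
have [||b [Cb Bb] hb] := wB (C `&` B); [by move=> x []|by exists b0|].
have mina c : A c -> C c -> c = a \/ pos (c - a) by move=> Ac Cc; apply: ha.
have minb c : B c -> C c -> c = b \/ pos (c - b) by move=> Ac Cc; apply: hb.
case: (wo_total a b) => [eab|ab|ba].
- exists a => // c Cc; case: (CAB _ Cc) => h; first exact: mina.
  by rewrite eab; exact: minb.
- exists b => // c Cc; case: (CAB _ Cc) => h; last exact: minb.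
  right; case: (mina _ h Cc) => [->//|]; exact: wo_trans.
- exists a => // c Cc; case: (CAB _ Cc) => h; first exact: mina.
  right; case: (minb _ h Cc) => [->//|]; exact: wo_trans.
Qed.

Lemma wo_ind B (P : G -> Prop) : wo B ->
  (forall b, B b -> (forall b', B b' -> pos (b - b') -> P b') -> P b) -> forall b, B b -> P b.
Proof.
move=> wB step b Bb; apply: contrapT => nPb.
have [||c [Bc nPc] minc] := wB [set b | B b /\ ~ P b]; [by move=> x []|by exists b|].
apply: nPc; apply: step => // b' Bb' h; apply: contrapT => nPb'.
case: (minc b') => // [e|h']; first by rewrite e subrr in h; exact: pos0 h.
exact: wo_asym h h'.
Qed.

(** Well-founded induction on b in B, where a0 is the least A-component of an element of C and a0 +
    b is in C. If a0 + b is not least, restrict to the elements of C below it; their least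
    A-component a1 is at least a0, which forces its partner b1 < b. *)
Lemma wo_sum A B : wo A -> wo B -> wo (sumset A B).
Proof.
move=> wA wB.
have key : forall b, B b -> forall C : set G, C `<=` sumset A B -> forall a0, A a0 -> C (a0 + b) ->
    (forall a' b', A a' -> B b' -> C (a' + b') -> a' = a0 \/ pos (a' - a0)) ->
    exists2 c, C c & forall c', C c' -> c' = c \/ pos (c' - c).
  apply: (wo_ind wB) => b Bb IH C CAB a0 Aa0 Cab mina.
  have [minab|/existsNP[c /not_implyP[Cc nc]]] :=
    pselect (forall c, C c -> c = a0 + b \/ pos (c - (a0 + b))); first by exists (a0 + b).
  have ltc : pos (a0 + b - c).
    by case: (wo_total c (a0 + b)) => // [e|h]; case: nc; [left|right].
  pose C' := [set c | C c /\ pos (a0 + b - c)].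
  have C'C : C' `<=` sumset A B by move=> x [/CAB].
  have [a [b' [Aa Bb' cE]]] := CAB _ Cc.
  have [||a1 [Aa1 [b1 Bb1 C'1]] min1] := wA [set a | A a /\ exists2 b', B b' & C' (a + b')].
  - by move=> x [].
  - by exists a; split=> //; exists b'; rewrite // -cE.
  have ltb : pos (b - b1).
    case: C'1 => C1 lt1; case: (mina _ _ Aa1 Bb1 C1) => [e|h].
      by move: lt1; rewrite e opprD addrACA subrr add0r.
    by have := posD lt1 h; rewrite addrC opprD [a0 + b + _]addrACA addrA -(opprB a1 a0) addrN add0r.
  have [|c' [Cc' lt'] minc'] := IH b1 Bb1 ltb C' C'C a1 Aa1 C'1.
    by move=> a' b'' Aa' Bb'' C''; apply: min1; split=> //; exists b''.
  exists c' => // d Cd; case: (wo_total d (a0 + b)) => [->|h|h].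
  - by right.
  - by right; exact: wo_trans lt' h.
  - exact: minc'.
move=> C CAB [c Cc]; have [a [b [Aa Bb cE]]] := CAB _ Cc.
have [||a1 [Aa1 [b1 Bb1 C1]] min1] := wA [set a | A a /\ exists2 b', B b' & C (a + b')].
- by move=> x [].
- by exists a; split=> //; exists b; rewrite // -cE.
apply: (key b1 Bb1 C CAB a1 Aa1 C1) => a' b' Aa' Bb' C'; apply: min1.
by split=> //; exists b'.
Qed.

(** As a increases, g - a decreases, so each nonempty subset of X has a least element by A and a
    greatest one by B. A totally ordered set with this property is finite. *)
Lemma wo_fin A B : wo A -> wo B -> forall g, finite_set [set a | A a /\ B (g - a)].
Proof.
move=> wA wB g; set X := [set a | _].
have minX C : C `<=` X -> (exists c, C c) -> exists2 c, C c & forall c', C c' -> c' = c \/ pos (c' - c).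
  by move=> CX; apply: wA => x /CX [].
have maxX C : C `<=` X -> (exists c, C c) -> exists2 c, C c & forall c', C c' -> c' = c \/ pos (c - c').
  move=> CX [c Cc]; have [|| _ [c' Cc' <-] h] := wB [set g - x | x in C].
  - by move=> _ [x /CX[_ Bx] <-].
  - by exists (g - c); exists c.
  exists c' => // d Cd; case: (h (g - d)); first by exists d.
    by move/addrI/oppr_inj; left.
  by right; move: b; rewrite opprB addrC addrA subrK.
pose L x := [set y | X y /\ (y = x \/ pos (x - y))].
(* Initial segments are finite: for a least counterexample z, the segment of its immediate
   predecessor m together with z is the segment of z. *)
have finL x : X x -> finite_set (L x).
  move=> Xx; apply: contrapT => nf.
  have [||z [Xz nfz] minz] := minX [set x | X x /\ ~ finite_set (L x)]; [by move=> ? []|by exists x|].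
  have [ex|nex] := pselect (exists y, X y /\ pos (z - y)).
    have [||m [Xm mz] maxm] := maxX [set y | X y /\ pos (z - y)]; [by move=> ? []|by []|].
    have fm : finite_set (L m).
      apply: contrapT => nfm; case: (minz m) => // [e|h].
        by move: mz; rewrite e subrr; exact: pos0.
      exact: wo_asym mz h.
    apply: nfz; apply: (@sub_finite_set _ _ (L m `|` [set z])).
      move=> y [Xy [->|h]]; [by right|left; split=> //]; exact: maxm.
    by rewrite finite_setU; split.
  apply: nfz; apply: (@sub_finite_set _ _ [set z]) => // y [Xy [->//|h]].
  by case: nex; exists y.
have [[x Xx]|nX] := pselect (exists x, X x).
  have [||m Xm maxm] := maxX X; [by []|by exists x|].
  by apply: sub_finite_set (finL m Xm) => y Xy; split=> //; exact: maxm.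
by apply: (@sub_finite_set _ _ set0) => // x Xx; case: nX; exists x.
Qed.

Definition wo_sfam : sfam G := SFam wo_sub wo_union wo_sum wo_zero wo_fin.

End WellOrdered.

Section Lex.
Variables (I : finType).
Local Notation Z := {ffun I -> int}.

Lemma addzE (a b : Z) i : (a + b) i = a i + b i. Proof. by rewrite ffunE. Qed.
Lemma subzE (a b : Z) i : (a - b) i = a i - b i. Proof. by rewrite !ffunE. Qed.
Lemma zerozE i : (0 : Z) i = 0. Proof. by rewrite ffunE. Qed.

Lemma finite_box (a b : Z) : finite_set [set e : Z | forall i, a i <= e i /\ e i <= b i].
Proof.
pose n := \max_(i : I) `|b i - a i|%N.
pose h (f : {ffun I -> 'I_n.+1}) : Z := [ffun i => a i + (nat_of_ord (f i))%:Z].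
pose g (e : Z) : {ffun I -> 'I_n.+1} := [ffun i => inord `|e i - a i|%N].
apply: (@finite_via _ _ setT g _ h) => //.
move=> e /= he; apply/ffunP => i; rewrite !ffunE; have [h1 h2] := he i.
rewrite inordK ?gez0_abs ?subr_ge0 // ?[_ + (_ - _)]addrC ?subrK //.
rewrite ltnS; apply: leq_trans (leq_bigmax i); lia.
Qed.

Section Order.
Variable rho : I -> nat.
Hypothesis rho_inj : injective rho.

(** The nonzero exponent of highest rank decides the sign, so in an iterated Laurent series the
    variables of higher rank are the outer ones. *)
Definition lexpos (e : Z) := exists2 i, 0 < e i & forall j, (rho i < rho j)%N -> e j = 0.

Lemma lexpos0 : ~ lexpos 0.
Proof. by case=> i; rewrite ffunE. Qed.

Lemma lexposD x y : lexpos x -> lexpos y -> lexpos (x + y).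
Proof.
move=> [i xi hi] [j yj hj]; case: (ltngtP (rho i) (rho j)) => [ij|ji|/rho_inj ij].
- exists j; first by rewrite ffunE hi // add0r.
  by move=> k jk; rewrite ffunE hj // hi ?addr0 //; exact: ltn_trans jk.
- exists i; first by rewrite ffunE hj // addr0.
  by move=> k ik; rewrite ffunE hi // hj ?addr0 //; exact: ltn_trans ik.
- subst j; exists i; first by rewrite ffunE addr_gt0.
  by move=> k ik; rewrite ffunE hi // hj.
Qed.

Lemma lexposT x : [\/ x = 0, lexpos x | lexpos (- x)].
Proof.
have [[i0 xi0]|nx] := pselect (exists i, x i != 0); last first.
  by constructor 1; apply/ffunP => i; rewrite ffunE; apply/eqP; apply: contra_notT nx => h; exists i.
case: (@arg_maxnP I i0 (fun i => x i != 0) rho xi0) => i xi mi.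
have hi j : (rho i < rho j)%N -> x j = 0.
  by move=> ij; apply/eqP; apply: contraTT ij => /mi; rewrite -leqNgt.
have [h|h] : 0 < x i \/ 0 < - x i by have {}xi : x i != 0 := xi; case: (ltgtP (x i) 0) xi => // h _; [right; rewrite oppr_gt0|left].
  by constructor 2; exists i.
by constructor 3; exists i; [rewrite ffunE|move=> j /hi; rewrite ffunE => ->; rewrite oppr0].
Qed.

Definition lexF : sfam Z := wo_sfam lexpos0 lexposD lexposT.

(* With the higher-ranked exponents fixed, each exponent is bounded below. *)
Definition lexb (A : set Z) := forall (i : I) (g : Z), exists N, forall e, A e ->
  (forall j, (rho i < rho j)%N -> e j = g j) -> N <= e i.

Lemma lexb_lexF A : lexb A -> lexF A.
Proof.
move=> lA; rewrite /lexF /= => C CA [e0 Ce0].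
pose B := (\max_(i : I) rho i).+1.
have rB i : (rho i < B)%N by rewrite ltnS; exact: leq_bigmax.
(* A least element of C is found by minimising exponents rank by rank from the top: after d rounds e
   is least as far as the ranks >= B - d can tell. Ranks carried by no variable are skipped. *)
have H d : exists2 e, C e & forall e', C e' ->
    (forall i, (B - d <= rho i)%N -> e' i = e i) \/
    exists i, [/\ (B - d <= rho i)%N, e i < e' i & forall j, (rho i < rho j)%N -> e' j = e j].
  elim: d => [|d [e Ce IH]].
    by exists e0 => // e' _; left => i; rewrite subn0 leqNgt rB.
  have [[i ri]|ni] := pselect (exists i, rho i = (B - d.+1)%N /\ (d < B)%N); last first.
    exists e => // e' /IH[h|[j [h1 h2 h3]]].
      left => j h1; apply: h; rewrite leqNgt; apply/negP => h2; apply: ni; exists j.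
      by have := rB j; lia.
    by right; exists j; split=> //; lia.
  have [N hN] := lA i e.
  have [||m [e1 [Ce1 h1 m1]] minm] := @int_min (fun m => exists e', [/\ C e',
      forall j, (rho i < rho j)%N -> e' j = e j & e' i = m]) N.
  - by exists (e i), e.
  - by move=> _ [e' [/CA Ae' h <-]]; exact: hN.
  subst m; exists e1 => // e' Ce'; case: (IH _ Ce') => [h|[j [hj1 hj2 hj3]]]; last first.
    right; exists j; have ij : (rho i < rho j)%N by lia.
    split; [lia|by rewrite h1|move=> k jk].
    by rewrite hj3 // h1 //; exact: ltn_trans jk.
  have e'e j : (rho i < rho j)%N -> e' j = e j by move=> ij; apply: h; lia.
  have le : e1 i <= e' i by apply: minm; exists e'.
  case: (ltgtP (e1 i) (e' i)) le => // [lt _|ei _].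
  - right; exists i; split=> //; first by lia.
    by move=> j ij; rewrite e'e // h1.
  - left => j hj; have [->//|ij] := eqVneq j i.
    have rij : rho i != rho j by rewrite (inj_eq rho_inj) eq_sym.
    by rewrite e'e ?h1 //; lia.
have [e Ce he] := H B; exists e => // e' /he; rewrite subnn => -[h|[i [_ h1 h2]]].
  by left; apply/ffunP => i; exact: h.
right; exists i; first by rewrite !ffunE subr_gt0.
by move=> j ij; rewrite !ffunE h2 // subrr.
Qed.

End Order.

(* Supports of the elements of V((x_i : i \notin D))((x_j : j \in D)), where several
   variables are adjoined at once, with a bound common to them. *)
Definition cls (D : {pred I}) (A : set Z) :=
  (exists N, forall e, A e -> forall i, i \in D -> N <= e i) /\
  (forall z : Z, exists N, forall e, A e -> (forall i, i \in D -> e i = z i) ->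
     forall i, i \notin D -> N <= e i).

Lemma cls_sub D A B : A `<=` B -> cls D B -> cls D A.
Proof.
move=> AB [[N hN] h]; split; first by exists N => e /AB; exact: hN.
by move=> z; have [M hM] := h z; exists M => e /AB; exact: hM.
Qed.

Lemma cls_union D A B : cls D A -> cls D B -> cls D (A `|` B).
Proof.
move=> [[N hN] h] [[N' hN'] h']; split.
  by exists (Order.min N N') => e [/hN H|/hN' H] i /H; rewrite ge_min => ->; rewrite ?orbT.
move=> z; have [M hM] := h z; have [M' hM'] := h' z.
exists (Order.min M M') => e [Ae|Be] ez i iD; rewrite ge_min.
  by rewrite (hM _ Ae).
by rewrite (hM' _ Be) ?orbT.
Qed.

Lemma cls_sum D A B : cls D A -> cls D B -> cls D (sumset A B).
Proof.
move=> [[N hN] /choice[M hM]] [[N' hN'] /choice[M' hM']]; split.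
  exists (N + N') => x [a [b [/hN Aa /hN' Bb ->]]] i iD; rewrite addzE.
  by have := Aa _ iD; have := Bb _ iD; lia.
(* The bounds [M] and [M'] depend only on the exponents in D. Setting the others to 0 leaves a
   finite box of possible arguments. *)
move=> z; pose r (e : Z) : Z := [ffun i => if i \in D then e i else 0].
pose lo : Z := [ffun i => if i \in D then N else 0].
pose hi : Z := [ffun i => if i \in D then z i - N' else 0].
have [L hL] := finite_lb (fun e => M e + M' (z - e)) (finite_box lo hi).
exists L => x [a [b [Aa Bb ->]]] xz i iD; rewrite addzE.
have bx : forall j, lo j <= r a j /\ r a j <= hi j.
  move=> j; rewrite !ffunE; case: ifP => // jD.
  by have := xz j jD; rewrite addzE; have := hN _ Aa _ jD; have := hN' _ Bb _ jD; lia.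
have h1 : M (r a) <= a i by apply: (hM (r a)) => // j jD; rewrite ffunE jD.
have h2 : M' (z - r a) <= b i.
  by apply: (hM' (z - r a)) => // j jD; rewrite subzE ffunE jD; have := xz j jD; rewrite addzE; lia.
by have /= h := hL _ bx; apply: le_trans h (lerD h1 h2).
Qed.

Lemma cls_lexb (rho : I -> nat) (D : {pred I}) (A : set Z) : (forall i j, i \in D -> j \notin D -> (rho j < rho i)%N) ->
  cls D A -> lexb rho A.
Proof.
move=> rD [[N hN] h] i g; have [iD|iD] := boolP (i \in D).
  by exists N => e Ae _; exact: hN.
have [M hM] := h g; exists M => e Ae eg; apply: hM => // j jD.
by apply: eg; exact: rD.
Qed.

Lemma cls0P A : cls pred0 A <-> exists N, forall e, A e -> forall i, N <= e i.
Proof.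
split=> [[_ /(_ 0)[N hN]]|[N hN]].
  by exists N => e Ae i; apply: (hN e) => // [j|]; rewrite inE.
by split; [exists 0 => e _ i; rewrite inE|move=> z; exists N => e Ae _ i _; exact: hN].
Qed.

Definition nonneg (A : set Z) := forall e, A e -> forall i, 0 <= e i.

Lemma nonneg_cls0 A : nonneg A -> cls pred0 A.
Proof. by move=> nA; apply/cls0P; exists 0. Qed.

Lemma nonneg_sub A B : A `<=` B -> nonneg B -> nonneg A.
Proof. by move=> AB nB e /AB; exact: nB. Qed.
Lemma nonneg_union A B : nonneg A -> nonneg B -> nonneg (A `|` B).
Proof. by move=> nA nB e [/nA|/nB]. Qed.
Lemma nonneg_sum A B : nonneg A -> nonneg B -> nonneg (sumset A B).
Proof. by move=> nA nB _ [a [b [/nA Aa /nB Bb ->]]] i; rewrite ffunE addr_ge0. Qed.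
Lemma nonneg_zero : nonneg [set 0].
Proof. by move=> e -> i; rewrite ffunE. Qed.
Lemma nonneg_fin A B : nonneg A -> nonneg B -> forall g, finite_set [set a | A a /\ B (g - a)].
Proof.
move=> nA nB g; apply: sub_finite_set (finite_box 0 g) => a [/nA Aa /nB Bb] i.
by split; [rewrite zerozE|have := Bb i; rewrite subzE subr_ge0].
Qed.

Definition nonnegF : sfam Z := SFam nonneg_sub nonneg_union nonneg_sum nonneg_zero nonneg_fin.

End Lex.

(** * Inverses of Laurent series in one and two variables *)

Lemma seq_inverse (R : comNzRingType) (f : nat -> R) (u : R) : f 0 * u = 1 ->
  exists g : nat -> R, forall n, \sum_(i < n.+1) f i * g (n - i)%N = (n == 0%N)%:R.
Proof.
move=> fu.
pose step (s : seq R) : R :=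
  u * ((size s == 0%N)%:R - \sum_(i < size s) f i.+1 * s`_(size s - i.+1)).
(* [l n] lists the first n coefficients of the inverse, since the next one depends on all of
   them. *)
pose l := fix l n := if n is n'.+1 then rcons (l n') (step (l n')) else [::] : seq R.
have szl n : size (l n) = n by elim: n => //= n IH; rewrite size_rcons IH.
pose g n := step (l n).
have nl n i : (i < n)%N -> (l n)`_i = g i.
  elim: n => // n IH; rewrite ltnS leq_eqVlt /= nth_rcons szl => /orP[/eqP->|lt].
    by rewrite ltnn eqxx.
  by rewrite lt; exact: IH.
exists g => n; rewrite big_ord_recl /= subn0 {1}/g /step szl mulrA fu mul1r.
rewrite (eq_bigr (fun i : 'I_n => f i.+1 * g (n - i.+1)%N)) ?subrK // => i _.
by rewrite nl //; have := ltn_ord i; lia.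
Qed.

Section OneVariable.

Definition L1_in (A : set int) := exists N, forall x, A x -> N <= x.

Lemma L1_sub A B : A `<=` B -> L1_in B -> L1_in A.
Proof. by move=> AB [M hM]; exists M => x /AB; exact: hM. Qed.
Lemma L1_union A B : L1_in A -> L1_in B -> L1_in (A `|` B).
Proof.
move=> [M hM] [M' hM'].
by exists (Order.min M M') => x [/hM|/hM']; rewrite ge_min => ->; rewrite ?orbT.
Qed.
Lemma L1_sum A B : L1_in A -> L1_in B -> L1_in (sumset A B).
Proof. by move=> [M hM] [M' hM']; exists (M + M') => x [a [b [/hM ? /hM' ? ->]]]; lia. Qed.
Lemma L1_zero : L1_in [set 0].
Proof. by exists 0 => x ->. Qed.
Lemma L1_fin A B : L1_in A -> L1_in B -> forall g, finite_set [set a | A a /\ B (g - a)].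
Proof.
move=> [M hM] [M' hM'] g; apply: sub_finite_set (finite_interval M (g - M')) => a [/hM ? /hM' ?].
by split; lia.
Qed.

Definition L1 : sfam int := SFam L1_sub L1_union L1_sum L1_zero L1_fin.

Lemma fsum_nat_range (V : zmodType) (f : int -> V) (n : nat) :
  (forall x, f x <> 0 -> 0 <= x /\ x <= n%:Z) -> fsum f = \sum_(i < n.+1) f i%:Z.
Proof.
move=> hf; rewrite (@fsumE _ _ [seq i%:Z | i <- iota 0 n.+1]).
- by rewrite big_map -{1}(subn0 n.+1) -/(index_iota _ _) big_mkord.
- by rewrite map_inj_uniq ?iota_uniq // => x y [].
- move=> x /hf[x0 xn]; apply/mapP; exists `|x|%N; last by lia.
  by rewrite mem_iota; lia.
Qed.

Variable K : fieldType.

Lemma laurent_inverse (f : fser K L1) : f <> 0 -> exists g : fser K L1, f * g = 1.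
Proof.
move=> f0; have [N hN] := fser_in f.
have [||m fm minm] := @int_min (fun x => f x <> 0) N; [|by move=> x; exact: hN|].
  apply: contrapT => nf; apply: f0; apply: val_inj; apply/funext => x.
  by apply: contrapT => fx; apply: nf; exists x.
have fV : f (m + 0%N%:Z) * (f m)^-1 = 1 by rewrite addr0 divff //; exact/eqP.
have [g hg] := @seq_inverse K (fun n => f (m + n%:Z)) (f m)^-1 fV.
pose G (x : int) : K := if 0 <= x + m then g (absz (x + m)) else 0.
have G_in : L1 (supp G).
  by exists (- m) => x /=; rewrite /G; case: ifP => // ? _; lia.
exists (fser_of G_in); apply: val_inj; rewrite /= ; apply/funext => n.
rewrite mulSE (fsum_bij (fun e => m + e) (fun e => e - m)); [|by move=> x; rewrite addrC addKr|by move=> x; rewrite addrC subrK].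
have [n0|n0] := leP 0 n; last first.
  rewrite fsum0 /sone => [|x]; first by case: eqP => // e; lia.
  have [fx|/eqP fx] := eqVneq (f (m + x)) 0; first by rewrite fx mul0r.
  by have := minm _ fx => ?; rewrite /G ifF ?mulr0 //; lia.
rewrite (@fsum_nat_range _ _ `|n|%N); last first.
  move=> x /eqP; rewrite mulf_eq0 => /norP[/eqP fx]; have := minm _ fx => h.
  by rewrite /G; case: ifP; rewrite ?eqxx // => h2 _; split; lia.
have := hg `|n|%N; rewrite /sone (_ : (`|n|%N == 0%N) = (n == 0)); last by lia.
move=> <-; apply: eq_bigr => i _; congr (_ * _); rewrite /G.
have := ltn_ord i => ?; rewrite ifT; last by lia.
by congr g; lia.
Qed.

End OneVariable.

Section TwoVariables.
Variable K : fieldType.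
Implicit Types f g : int * int -> K.

Lemma LL_P (V : lmodType K) (h : int * int -> V) : laurent_laurent h <-> LL (supp h).
Proof.
split=> [[[M hM] hN]|[[M hM] hN]]; split.
- by exists M => -[i j] /= nz; rewrite leNgt; apply: contra_notN nz => /hM.
- move=> j; have [N h2] := hN j; exists N => i /= nz; rewrite leNgt.
  by apply: contra_notN nz => /h2.
- exists M => i j jM; apply: contrapT => nz; have := hM (i, j) nz => /=; lia.
- move=> j; have [N h2] := hN j; exists N => i iN; apply: contrapT => nz.
  by have := h2 i nz; lia.
Qed.

Lemma laurent_pseries_LL (V : lmodType K) (h : int * int -> V) :
  laurent_pseries h -> LL (supp h).
Proof. by move=> [h1 h2]; apply/LL_P; split=> //; exists 0. Qed.

Lemma laurent2_LL (V : lmodType K) (h : int * int -> V) : laurent2 h -> LL (supp h).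
Proof.
move=> [N hN]; apply/LL_P; split.
  by exists N => i j jN; apply: hN; rewrite jN orbT.
by move=> j; exists N => i iN; apply: hN; rewrite iN.
Qed.

Lemma pseries2_laurent2 f : pseries2 f -> laurent2 (V := K^o) f.
Proof. by move=> pf; exists 0. Qed.

Lemma row_in f j : LL (supp f) -> L1 (supp (fun i => f (i, j))).
Proof. by move=> [_ /(_ j)[N hN]]; exists N. Qed.

(** View f as a power series in z over the field K((x)): its constant term is nonzero, hence
    invertible, and [seq_inverse] applies over the ring [fser K L1]. *)
Lemma laurent_pseries_inverse f : laurent_pseries (V := K^o) f ->
  (exists i, f (i, 0) <> 0) ->
  exists2 g, laurent_pseries (V := K^o) g & mulS f g = @sone K _.
Proof.
move=> lf [i0 fi0]; have Lf := laurent_pseries_LL lf.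
pose r (j : nat) : fser K L1 := fser_of (row_in j%:Z Lf).
have [|u ru] := @laurent_inverse K (r 0%N).
  by move=> /(congr1 (fun x : fser K L1 => x i0)) /=; exact: fi0.
have [g hg] := seq_inverse ru.
pose G (x : int * int) : K := if 0 <= x.2 then g `|x.2|%N x.1 else 0.
have lG : laurent_pseries (V := K^o) G.
  split=> [i j j0|j]; first by rewrite /G /= ifF //; lia.
  have [j0|j0] := leP 0 j; last by exists 0 => i _; rewrite /G /= ifF //; lia.
  have [N hN] := fser_in (g `|j|%N); exists N => i iN; rewrite /G /= ifT //.
  by apply: contrapT => nz; have := hN _ nz; lia.
exists G => //; apply/funext => -[i j].
rewrite mulSE (fsum_bij (fun x : int * int => (x.2, x.1)) (fun x => (x.2, x.1))); [|by case|by case].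
rewrite -(fsum_pair (f := fun b a => f (a, b) * G ((i, j) - (a, b)))); last first.
  apply: (finite_via (g := fun x : int * int => (x.2, x.1)) (h := fun x => (x.2, x.1)))
    (sf_fin Lf (laurent_pseries_LL lG) (i, j)) _ _; last by case.
  by move=> [b a] /= nz; split=> z; apply: nz; rewrite z ?mul0r ?mulr0.
have nzrow b : fsum (fun a => f (a, b) * G ((i, j) - (a, b))) <> 0 -> 0 <= b /\ b <= j.
  move=> /fsum_neq0[a /eqP]; rewrite mulf_eq0 => /norP[/eqP fa /eqP Ga].
  case: (ltP b 0) => [/(lf.1 a)//|b0]; case: (ltP (j - b) 0) => [jb|]; last by split; lia.
  by case: Ga; rewrite -(lG.1 (i - a) (j - b) jb).
have [j0|j0] := leP 0 j; last first.
  rewrite fsum0 /sone.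
    by case: eqP => // -[_ jz]; move: j0; rewrite jz.
  by move=> b; apply: contrapT => /nzrow; lia.
rewrite (@fsum_nat_range _ _ `|j|%N); last by move=> b /nzrow; lia.
transitivity ((\sum_(b < `|j|.+1) r b * g (`|j| - b)%N : fser K L1) i).
  rewrite (big_morph (fun x : fser K L1 => x i) (id1 := 0) (op1 := +%R)) //.
  apply: eq_bigr => b _; rewrite fser_valM mulSE; apply: eq_fsum => a /=.
  congr (_ * _); rewrite /G /= ifT; last by have := ltn_ord b; lia.
  by congr (g _ _); have := ltn_ord b; lia.
rewrite hg /sone; have [jz|jz] := eqVneq `|j|%N 0%N.
  have -> : j = 0 by lia.
  rewrite fser_val1 /sone (_ : ((i, 0) == 0 :> (int * int)%type) = (i == 0)) //.
  by apply/eqP/eqP => [[]|->].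
by case: eqP => // -[_ e]; move: jz; rewrite e.
Qed.

(** Factor out the lowest power z^k that occurs: the cofactor u has a nonzero constant term in
    K((x)). Hence K((x))((z)) is a field, and k is the order in z. *)
Lemma LL_decomp f : LL (supp f) -> f <> 0 -> exists k : int, exists u v,
  [/\ laurent_pseries (V := K^o) u, laurent_pseries (V := K^o) v, mulS u v = @sone K _,
   (forall i j, f (i, j) = u (i, j - k)) & exists i, f (i, k) <> 0].
Proof.
move=> Lf f0; have [[M hM] hN] := Lf.
have [||k [i fik] mink] := @int_min (fun j => exists i, f (i, j) <> 0) M.
- apply: contrapT => nf; apply: f0; apply/funext => -[i j].
  by apply: contrapT => nz; apply: nf; exists j, i.
- by move=> j [i /hM].
pose u (x : int * int) := f (x.1, x.2 + k).
have lu : laurent_pseries (V := K^o) u.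
  split=> [a b b0|b]; rewrite /u /=.
    by apply: contrapT => nz; have := mink (b + k) (ex_intro _ a nz); lia.
  have [N h] := hN (b + k); exists N => a aN; apply: contrapT => nz.
  by have := h a nz; lia.
have [|v lv uv] := laurent_pseries_inverse lu; first by exists i; rewrite /u /= add0r.
exists k, u, v; split=> //; last by exists i.
by move=> a b; rewrite /u /= subrK.
Qed.

End TwoVariables.

(** * Powers of series x + O(z) *)

Lemma int_ind_shift (P : int -> Prop) :
  P 0 -> (forall m, P m -> P (m + 1)) -> (forall m, P (m + 1) -> P m) -> forall m, P m.
Proof.
move=> P0 up dn; elim/int_rec => [//|n|n] Pn.
  by rewrite -addn1 PoszD; exact: up.
by apply: dn; rewrite (_ : _ + 1 = - n%:Z) //; lia.
Qed.

Lemma inv_inP (K : fieldType) (A : set (int * int -> K)) f :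
  (exists2 g, A g & mulS f g = @sone K _) ->
  A (inv_in A f) /\ mulS f (inv_in A f) = @sone K _.
Proof.
move=> [g Ag fg]; rewrite /inv_in; apply: (@xgetPex _ _ [set g | A g /\ mulS f g = @sone K _]).
by exists g.
Qed.

Lemma pseries2_mul (K : fieldType) (p q : int * int -> K) : pseries2 p -> pseries2 q -> pseries2 (mulS p q).
Proof.
move=> pp pq i j ij; apply: contrapT => /(smul_supp (V := K^o))[[m n] [[m' n'] [h1 h2 [e1 e2]]]].
have h3 : ~~ ((m < 0) || (n < 0)) by apply: contra_notN h1 => /pp.
have h4 : ~~ ((m' < 0) || (n' < 0)) by apply: contra_notN h2 => /pq.
by move: ij h3 h4; rewrite e1 e2; lia.
Qed.

Lemma pseries2_npow (K : fieldType) (f : int * int -> K) n : pseries2 f -> pseries2 (npow f n).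
Proof.
move=> pf; elim: n => [|n IH]; last exact: pseries2_mul.
by move=> i j ij; rewrite /= /sone; case: eqP ij => // -[-> ->].
Qed.

Section Unipotent.
Variables (K : fieldType) (f : int * int -> K).
Hypotheses (lf : laurent_pseries (V := K^o) f) (f1 : forall i, f (i, 0) = (i == 1)%:R).

Let g : int * int -> K := inv_in (laurent_pseries (V := K^o)) f.

Lemma unipotent_inverse : laurent_pseries (V := K^o) g /\ mulS f g = @sone K _.
Proof.
apply: inv_inP; apply: laurent_pseries_inverse => //.
by exists 1; rewrite f1 eqxx; apply/eqP; rewrite oner_eq0.
Qed.

Lemma zpow_LL m : LL (supp (zpow f m)).
Proof.
case: m => n; apply: npow_in; apply: (laurent_pseries_LL (V := K^o)) => //.
exact: unipotent_inverse.1.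
Qed.

Lemma zpow_0 : zpow f 0 = @sone K _. Proof. by []. Qed.

Lemma zpow_S m : zpow f (m + 1) = mulS f (zpow f m).
Proof.
have Lf : LL (supp f) by exact: (laurent_pseries_LL (V := K^o)).
have Lg : LL (supp g) by apply: (laurent_pseries_LL (V := K^o)); exact: unipotent_inverse.1.
case: m => [n|[|n]].
- by rewrite addrC -intS.
- have -> : Negz 0 + 1 = 0 by [].
  by rewrite /= mulS1r unipotent_inverse.2.
- have -> : Negz n.+1 + 1 = Negz n by rewrite !NegzE; lia.
  rewrite /= -/g -/(npow g n.+1) (mulSA (F := LL) Lf Lg (npow_in n.+1 Lg)).
  by rewrite unipotent_inverse.2 mulS1.
Qed.

Lemma zpowD m n : zpow f (m + n) = mulS (zpow f m) (zpow f n).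
Proof.
have Lf : LL (supp f) by exact: (laurent_pseries_LL (V := K^o)).
have Lg : LL (supp g) by apply: (laurent_pseries_LL (V := K^o)); exact: unipotent_inverse.1.
elim/int_ind_shift: m => [|m IH|m IH].
- by rewrite add0r zpow_0 mulS1.
- by rewrite addrAC zpow_S IH zpow_S (mulSA (F := LL)) //; exact: zpow_LL.
- have gf (h : int * int -> K) : LL (supp h) -> mulS g (mulS f h) = h.
    by move=> Lh; rewrite (mulSA (F := LL) Lg Lf Lh) [mulS g f]mulSC unipotent_inverse.2 mulS1.
  have := congr1 (mulS g) IH; rewrite addrAC !zpow_S.
  rewrite -(mulSA (F := LL) Lf (zpow_LL m) (zpow_LL n)) !gf //.
    by apply: mulS_in; exact: zpow_LL.
  exact: zpow_LL.
Qed.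

Lemma zpow_row0 m i : zpow f m (i, 0) = (i == m)%:R.
Proof.
have key n a : zpow f (n + 1) (a, 0) = zpow f n (a - 1, 0).
  rewrite zpow_S mulSE (fsum1 (1, 0)); first by rewrite f1 eqxx mul1r.
  move=> [b c] bc; have [c0|c0] := ltP c 0; first by rewrite lf.1 // mul0r.
  have [cz|cn] := eqVneq c 0.
    subst c; rewrite f1; case: eqP => [bE|]; last by rewrite mul0r.
    by case: bc; rewrite bE.
  suff -> : zpow f n ((a, 0) - (b, c)) = 0 by rewrite mulr0.
  have npn (h : int * int -> K) k : laurent_pseries (V := K^o) h -> forall x y, y < 0 -> npow h k (x, y) = 0.
    move=> [h1 _]; elim: k => [|k IH] x y y0 /=.
      by rewrite /sone; case: eqP => // -[_ ye]; move: y0; rewrite ye.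
    apply: contrapT => /(smul_supp (V := K^o)) [[u v] [[u' v'] [h2 h3 [_ e2]]]].
    case: (ltP v 0) => [/(h1 u)//|v0]; case: (ltP v' 0) => [/(IH u')//|v0'].
    by move: y0; rewrite e2; lia.
  rewrite (_ : (a, 0) - (b, c) = (a - b, 0 - c)) //.
  by case: n => n; apply: npn; rewrite ?sub0r ?oppr_lt0 //; [lia|exact: unipotent_inverse.1|lia].
elim/int_ind_shift: m i => [|m IH|m IH] i.
- by rewrite zpow_0 /sone; congr (nat_of_bool _)%:R; apply/eqP/eqP => [[]|->].
- by rewrite key IH subr_eq.
- by have := key m (i + 1); rewrite IH addrK => <-; rewrite (inj_eq (addIr 1)).
Qed.

(* Superadditivity makes the condition that z^j occurs only with x-exponents >= m - kappa j
   multiplicative in m, so that it passes from f to all of its powers. *)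
Lemma superadditive_bound (N : int -> int) : exists kappa : int -> int,
  [/\ forall j, 0 <= kappa j, kappa 0 = 0,
      forall j k, 0 <= j -> 0 <= k -> kappa j + kappa k <= kappa (j + k) &
      forall j, 0 < j -> 1 - kappa j <= N j].
Proof.
pose c (k : nat) := absz (Num.max 0 (1 - N k%:Z)).
pose M n := \max_(k < n.+1) c k.
have M_homo m n : (m <= n)%N -> (M m <= M n)%N.
  by move=> mn; apply/bigmax_leqP => i _; apply: leq_trans (leq_bigmax (widen_ord (mn : (m.+1 <= n.+1)%N) i)).
exists (fun j => (`|j| * M `|j|)%N%:Z); split=> // [j k j0 k0|j j0].
  rewrite -PoszD lez_nat (_ : absz (j + k) = (absz j + absz k)%N); last by lia.
  rewrite mulnDl; apply: leq_add; rewrite leq_mul2l M_homo ?orbT //.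
    exact: leq_addr.
  exact: leq_addl.
have cM : (c (absz j) <= M (absz j))%N by exact: (leq_bigmax (Ordinal (ltnSn (absz j)))).
have jM : (M (absz j) <= absz j * M (absz j))%N by rewrite leq_pmull // absz_gt0; lia.
have h : 1 - N j <= (c (absz j))%:Z.
  by rewrite /c !gez0_abs ?(ltW j0) // ?le_max ?lexx ?orbT.
have h2 : (c (absz j))%:Z <= (absz j * M (absz j))%N%:Z by rewrite lez_nat (leq_trans cM jM).
by rewrite lerBlDr -lerBlDl; exact: le_trans h h2.
Qed.

(** The point is that kappa serves all m at once; a substitution involves infinitely many powers of
    f, and this uniformity makes it summable. *)
Lemma zpow_supp : exists kappa : int -> int, forall m i j,
  zpow f m (i, j) <> 0 -> 0 <= j /\ m - kappa j <= i.
Proof.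
have [N hN] := choice lf.2.
have [kappa [k0 kz kD kN]] := superadditive_bound N.
exists kappa.
pose T m (h : int * int -> K) := forall i j, h (i, j) <> 0 -> 0 <= j /\ m - kappa j <= i.
have Tmul m n h h' : T m h -> T n h' -> T (m + n) (mulS h h').
  move=> Th Th' i j /(smul_supp (V := K^o)) [[a b] [[c d] [/Th[b0 ab] /Th'[d0 cd] [-> ->]]]].
  split; first exact: addr_ge0.
  by apply: le_trans (lerD ab cd); rewrite addrACA -opprD lerD2l lerN2 kD.
have T1 : T 1 f.
  move=> i j nz; have [j0|j0] := ltP j 0; first by case: nz; rewrite lf.1.
  split=> //; move: j0; rewrite le_eqVlt => /orP[/eqP j0|/kN h].
    move: nz; rewrite -j0 f1; case: eqP => // -> _; have := k0 0; lia.
  by rewrite leNgt; apply/negP => lt; apply: nz; apply: hN; exact: lt_le_trans lt h.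
have [lg fg] := unipotent_inverse.
(* Induction on the z-degree j: in the coefficient of x^(i+1) z^j of f g = 1, the leading term x of
   f isolates g (i, j). Below the bound the other terms vanish by superadditivity of kappa. *)
have Tg : T (-1) g.
  suff key n : forall j, (`|j| < n)%N -> 0 <= j -> forall i, g (i, j) <> 0 -> -1 - kappa j <= i.
    move=> i j nz; have [j0|j0] := ltP j 0; first by case: nz; rewrite lg.1.
    by split=> //; exact: (key (`|j|.+1)).
  elim: n => // n IH j; rewrite ltnS => jn j0 i nz; rewrite leNgt; apply/negP => lt; apply: nz.
  have := congr1 (fun h => h (i + 1, j)) fg.
  rewrite /= mulSE (fsum1 (1, 0)).
    rewrite f1 eqxx mul1r (_ : (i + 1, j) - (1, 0) = (i + 1 - 1, j - 0)) // addrK subr0.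
    by move=> ->; rewrite /sone; case: eqP => // -[]; have := k0 j; lia.
  move=> [b c] bc; have [c0|c0] := ltP c 0; first by rewrite lf.1 // mul0r.
  have [cz|cn] := eqVneq c 0.
    by subst c; rewrite f1; case: eqP => [bE|]; [case: bc; rewrite bE|rewrite mul0r].
  have [fz|/eqP nz] := eqVneq (f (b, c)) 0; first by rewrite fz mul0r.
  rewrite (_ : (i + 1, j) - (b, c) = (i + 1 - b, j - c)) //.
  have [gz|/eqP gnz] := eqVneq (g (i + 1 - b, j - c)) 0; first by rewrite gz mulr0.
  have jc : 0 <= j - c by rewrite leNgt; apply: contra_notN gnz => /lg.1 ->.
  have [_ h1] := T1 _ _ nz.
  have h2 : -1 - kappa (j - c) <= i + 1 - b by apply: IH => //; lia.
  have := kD _ _ c0 jc; rewrite [c + _]addrC subrK; lia.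
have Tone : T 0 (@sone K _).
  by move=> i j; rewrite /sone; case: eqP => // -[-> ->] _; rewrite kz.
case=> n.
  elim: n => [|n IH]; first exact: Tone.
  by rewrite intS; exact: Tmul T1 IH.
elim: n => [|n IH]; first exact: (Tmul (-1) 0).
by rewrite (_ : Negz n.+1 = -1 + Negz n); [exact: Tmul Tg IH|rewrite !NegzE; lia].
Qed.

End Unipotent.

Lemma fsum_nat_lt (V : zmodType) (f : nat -> V) (n : nat) :
  (forall x, f x <> 0 -> (x < n)%N) -> fsum f = \sum_(i < n) f i.
Proof.
move=> hf; rewrite (@fsumE _ _ (iota 0 n)) ?iota_uniq //.
  by rewrite -{1}(subn0 n) -/(index_iota _ _) big_mkord.
by move=> x /hf; rewrite mem_iota.
Qed.

(** * Commutativity of formal groups *)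

Section FormalGroup.
Variables (K : fieldType) (F : int * int -> K).
Hypotheses (char0 : [pchar K] =i pred0).

Definition swap2 (f : int * int -> K) : int * int -> K := fun x => f (x.2, x.1).

Lemma mulS_swap2 f g : mulS (swap2 f) (swap2 g) = swap2 (mulS f g).
Proof.
apply/funext => -[i j]; rewrite /swap2 !mulSE /=.
rewrite (fsum_bij (fun x : int * int => (x.2, x.1)) (fun x => (x.2, x.1))) /=; [|by case|by case].
by apply: eq_fsum => -[].
Qed.

Lemma npow_swap2 (f : int * int -> K) n : npow (swap2 f) n = swap2 (npow f n).
Proof.
elim: n => [|n IH] /=; last by rewrite IH mulS_swap2.
by apply/funext => -[i j]; rewrite /swap2 /sone; congr (nat_of_bool _)%:R; apply/eqP/eqP => -[-> ->].
Qed.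

Lemma pseries2_swap2 (f : int * int -> K) : pseries2 f -> pseries2 (swap2 f).
Proof. by move=> pf i j ij; apply: pf; rewrite orbC. Qed.

Lemma pseries2_laurent (f : int * int -> K) : pseries2 f -> laurent_pseries (V := K^o) f.
Proof. by move=> pf; split=> [i j j0|j]; [|exists 0 => i i0]; apply: pf; rewrite ?j0 ?i0 ?orbT. Qed.

Lemma mulS_col1 (f g : int * int -> K) k : pseries2 f -> pseries2 g ->
  mulS f g (k, 1) = fsum (fun a => f (a, 0) * g (k - a, 1)) + fsum (fun a => f (a, 1) * g (k - a, 0)).
Proof.
move=> pf pg; rewrite mulSE (fsum_bij (fun x : int * int => (x.2, x.1)) (fun x => (x.2, x.1))); [|by case|by case].
have Lf := laurent_pseries_LL (pseries2_laurent pf).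
have Lg := laurent_pseries_LL (pseries2_laurent pg).
rewrite -(fsum_pair (f := fun b a => f (a, b) * g (k - a, 1 - b))); last first.
  apply: (finite_via (g := fun x : int * int => (x.2, x.1)) (h := fun x => (x.2, x.1)))
    (sf_fin Lf Lg (k, 1)) _ _; last by case.
  move=> [b a] /= nz; split=> z; apply: nz; first by rewrite z mul0r.
  by have {}z : g (k - a, 1 - b) = 0 := z; rewrite z mulr0.
rewrite (@fsum_nat_range _ _ 1).
  rewrite !big_ord_recl big_ord0 [X in _ + X]addr0; congr (_ + _); apply: eq_fsum => a; congr (_ * g (_, _)).

move=> b /fsum_neq0[a nz]; split; rewrite leNgt; apply: contra_notN nz => h.
  by rewrite pf ?h ?orbT // mul0r.
by rewrite pg ?mulr0 //; apply/orP; right; lia.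
Qed.

(** The derivative of f^n in y at y = 0 is n f^(n-1) df/dy, where f = x. *)
Lemma npow_col1 (f : int * int -> K) n k : pseries2 f -> (forall i, f (i, 0) = (i == 1)%:R) ->
  npow f n (k, 1) = n%:R * f (k - n%:Z + 1, 1).
Proof.
move=> pf f0; elim: n k => [|n IH] k.
  by rewrite mul0r /= /sone; case: eqP => // -[].
rewrite /= mulS_col1 //; last exact: pseries2_npow.
rewrite (fsum1 1) => [|a a1]; last by rewrite f0; case: eqP => // _; rewrite mul0r.
rewrite f0 eqxx mul1r IH (fsum1 (k - n%:Z)) => [|a an]; last first.
  rewrite -/(npow f n) (_ : npow f n (k - a, 0) = (k - a == n)%:R).
    by case: eqP => [e|_]; rewrite ?mulr0 //; case: an; rewrite -e; lia.
  exact: (zpow_row0 (pseries2_laurent pf) f0 n).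
rewrite (_ : npow f n _ = 1).
  rewrite mulr1 -addn1 natrD mulrDl mul1r; congr (_ * f (_, _) + f (_, _)); lia.
rewrite (_ : k - (k - n%:Z) = n%:Z); last lia.
by have := zpow_row0 (pseries2_laurent pf) f0 n n%:Z; rewrite eqxx.
Qed.

Hypothesis FF : formal_group F.

Let pF : pseries2 F. Proof. by case: FF. Qed.
Let F0 i : F (i, 0) = (i == 1)%:R. Proof. by case: FF. Qed.
Let F0' j : F (0, j) = (j == 1)%:R. Proof. by case: FF. Qed.

(** As series, h(x) is dF/dy at y = 0, and k(y) is dF/dx at x = 0. *)
Let h (n : int) := F (n, 1).
Let k (n : int) := F (1, n).

Let h_neg n : n < 0 -> h n = 0. Proof. by move=> n0; apply: pF; rewrite n0. Qed.
Let k_neg n : n < 0 -> k n = 0. Proof. by move=> n0; apply: pF; rewrite n0 orbT. Qed.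

Let natK n : n.+1%:R != 0 :> K.
Proof. by rewrite ((pcharf0P K).1 char0). Qed.

Let npow_row1 n l : npow F n (1, l) = n%:R * k (l - n%:Z + 1).
Proof.
have := npow_col1 n l (pseries2_swap2 pF) (fun i => F0' i).
by rewrite npow_swap2.
Qed.

(** The derivative of associativity in the third variable at 0: h(y) dF/dy = h(F(x, y)). *)
Let assoc_col1 i l : fsum (fun j : nat => F (i, j%:Z) * (j%:R * h (l - j%:Z + 1))) =
  fsum (fun j : nat => npow F j (i, l) * h j%:Z).
Proof.
case: FF => _ _ _ /(_ i l 1) <-; apply: eq_fsum => j.
by rewrite (npow_col1 _ _ pF F0).
Qed.

(** The derivative in the first variable at 0: k(F(y, z)) = k(y) dF/dy, where F stands for F(y,
    z). *)
Let assoc_row1 i l : fsum (fun j : nat => k j%:Z * npow F j (i, l)) =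
  fsum (fun j : nat => (j%:R * k (i - j%:Z + 1)) * F (j%:Z, l)).
Proof.
case: FF => _ _ _ /(_ 1 i l) ->; apply: eq_fsum => j.
by rewrite npow_row1.
Qed.

(* The coefficient of x y^n z in associativity determines k (n + 1) up to the factor n + 1. *)
Let k_eq_h n : k n = h n.
Proof.
case: n => n; last by rewrite k_neg ?h_neg.
have [m] := ubnP n; elim: m n => // m IH [_|n]; first by rewrite /k /h F0 F0' !eqxx.
rewrite ltnS => nm.
have IH' j : (j <= n)%N -> k j%:Z = h j%:Z by move=> jn; apply: IH; exact: leq_ltn_trans jn nm.
have := assoc_row1 n%:Z 1.
rewrite (@fsum_nat_lt _ _ n.+2); last first.
  move=> x nz; rewrite ltnNge; apply: contra_notN nz => xn.
  by rewrite (npow_col1 _ _ pF F0) -/(h _) h_neg ?mulr0 //; lia.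
rewrite (@fsum_nat_lt _ _ n.+2); last first.
  move=> x nz; rewrite ltnNge; apply: contra_notN nz => xn.
  by rewrite k_neg ?mulr0 ?mul0r //; lia.
rewrite big_ord_recr [in RHS]big_ord_recr.
rewrite (npow_col1 _ _ pF F0) -/(h _).
rewrite (_ : \sum_(i < n.+1) _ = \sum_(i < n.+1) i%:R * k (n%:Z - i%:Z + 1) * F (i%:Z, 1)).
  move=> /addrI; rewrite (_ : n%:Z - n.+1%:Z + 1 = 0); last by lia.
  rewrite /k /h F0 F0' !eqxx !mulr1 -/(k _) -/(h _) [LHS]mulrC => /mulfI; apply; exact: natK.
apply: eq_bigr => i _; rewrite (npow_col1 _ _ pF F0) -/(h _) -/(h _) /=.
have := ltn_ord i; rewrite ltnS => ile.
(* The term i = 0 carries the factor 0; otherwise n - i + 1 <= n and the induction hypothesis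
   applies to both coefficients. *)
have [->|i0] := posnP i; first by rewrite !(mulr0n, mul0r, mulr0).
rewrite (IH' i) // (_ : n%:Z - i%:Z + 1 = (n - i).+1%:Z); last by lia.
rewrite (IH' (n - i).+1) //; last by lia.
by rewrite mulrC.
Qed.

(* h(y) dF/dy = h(x) dF/dx, a symmetric equation which determines F from F(x, 0). *)
Let pde a b : fsum (fun j : nat => F (a, j%:Z) * (j%:R * h (b - j%:Z + 1))) =
  fsum (fun j : nat => (j%:R * h (a - j%:Z + 1)) * F (j%:Z, b)).
Proof.
rewrite assoc_col1; transitivity (fsum (fun j : nat => k j%:Z * npow F j (a, b))).
  by apply: eq_fsum => j; rewrite k_eq_h mulrC.
by rewrite assoc_row1; apply: eq_fsum => j; rewrite k_eq_h.
Qed.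

(** Compare [pde] with its mirror image. In degree b of the second variable, F (a, b + 1) occurs
    only with the factor (b + 1) h(0) = b + 1, which is nonzero; all other terms involve F (a, j)
    with j <= b and agree by induction. *)
Lemma formal_group_comm a b : F (a, b) = F (b, a).
Proof.
case: b => b; last by rewrite !pF //= ?orbT.
elim/ltn_ind: b a => -[_|b IH] a; first by rewrite F0 F0'.
have e1 := pde a b%:Z; have e2 := pde b%:Z a.
have e : fsum (fun j : nat => F (a, j%:Z) * (j%:R * h (b%:Z - j%:Z + 1))) =
    fsum (fun j : nat => F (j%:Z, a) * (j%:R * h (b%:Z - j%:Z + 1))).
  rewrite e1; transitivity (fsum (fun j : nat => F (b%:Z, j%:Z) * (j%:R * h (a - j%:Z + 1)))).
    by apply: eq_fsum => j; rewrite (IH b) // mulrC.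
  by rewrite e2; apply: eq_fsum => j; rewrite mulrC.
move: e; rewrite (@fsum_nat_lt _ _ b.+2); last first.
  move=> x nz; rewrite ltnNge; apply: contra_notN nz => xn.
  by rewrite h_neg ?mulr0 //; lia.
rewrite (@fsum_nat_lt _ _ b.+2); last first.
  move=> x nz; rewrite ltnNge; apply: contra_notN nz => xn.
  by rewrite h_neg ?mulr0 //; lia.
rewrite big_ord_recr [in RHS]big_ord_recr /=.
rewrite (eq_bigr (fun i : 'I_b.+1 => F (i%:Z, a) * (i%:R * h (b%:Z - i%:Z + 1)))); last first.
  by move=> i _; rewrite (IH i).
move=> /addrI; rewrite (_ : b%:Z - b.+1%:Z + 1 = 0); last by lia.
rewrite /h F0' eqxx mulr1; apply: mulIf; exact: natK.
Qed.

End FormalGroup.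

Section ClsFamily.
Variables (I : finType) (D : {pred I}).

(** All variables of D outrank the others, which embeds [cls D] into a lexicographic family, and
    [cls_fin] is inherited from there. *)
Definition cls_rank (i : I) : nat := enum_rank i + (i \in D) * #|I|.

Lemma cls_rank_inj : injective cls_rank.
Proof.
move=> i j; rewrite /cls_rank => e; apply: enum_rank_inj; apply: val_inj => /=.
have hi : (enum_rank i < #|I|)%N := ltn_ord _; have hj : (enum_rank j < #|I|)%N := ltn_ord _.
move: hi hj e; move: (nat_of_ord (enum_rank i)) (nat_of_ord (enum_rank j)) => a b.
move: #|I| => n.
by case: (i \in D); case: (j \in D); rewrite /= ?mul1n ?mul0n; lia.
Qed.

Lemma cls_rankP i j : i \in D -> j \notin D -> (cls_rank j < cls_rank i)%N.
Proof. by rewrite /cls_rank => -> /negbTE ->; rewrite mul1n mul0n addn0; exact: ltn_addl. Qed.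

Lemma cls_fin (A B : set {ffun I -> int}) : cls D A -> cls D B ->
  forall g, finite_set [set a | A a /\ B (g - a)].
Proof.
move=> cA cB; apply: (sf_fin (s := lexF cls_rank_inj)); apply: lexb_lexF;
  exact: (cls_lexb cls_rankP).
Qed.

Lemma cls_zero : cls D [set 0].
Proof. by split; [exists 0 => e -> i _|move=> z; exists 0 => e -> _ i _]; rewrite ffunE. Qed.

Definition clsF : sfam {ffun I -> int} :=
  SFam (@cls_sub I D) (@cls_union I D) (@cls_sum I D) cls_zero cls_fin.

Lemma clsF_lexF rho (rho_inj : injective rho) (A : set {ffun I -> int}) :
  (forall i j, i \in D -> j \notin D -> (rho j < rho i)%N) -> clsF A -> lexF rho_inj A.
Proof. by move=> hr cA; apply: lexb_lexF; exact: (cls_lexb hr). Qed.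

End ClsFamily.

Lemma summable_mono (K : fieldType) (G G' : zmodType) (F F' : sfam G') (T : G -> G' -> K) A :
  (forall B, F B -> F' B) -> summable F T A -> summable F' T A.
Proof. by move=> FF' [h1 h2]; split=> //; exact: FF'. Qed.

Section TwoVariableKernels.
Variables (K : fieldType) (f : int * int -> K).
Hypotheses (lf : laurent_pseries (V := K^o) f) (f1 : forall i, f (i, 0) = (i == 1)%:R).

(* The images of monomials under x_1 = phi(x, z) and x_1 = F(x_0, x_2). *)
Definition phk (e g : int * int) : K := zpow f e.1 (g - (e.2, 0)).
Definition fgk (e g : int * int) : K := zpow f e.1 (g - (0, e.2)).

Lemma mulS_shift (G : zmodType) (u v : G -> K) a b :
  mulS (fun g => u (g - a)) (fun g => v (g - b)) = (fun g => mulS u v (g - (a + b))).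
Proof.
apply/funext => g; rewrite !mulSE (fsum_bij (fun x => x + a) (fun x => x - a)).
- apply: eq_fsum => x; rewrite addrK; congr (_ * v _).
  by rewrite !opprD !addrA -!addrA; congr (_ + _); rewrite addrC -!addrA.
- by move=> x; rewrite addrK.
- by move=> x; rewrite subrK.
Qed.

Lemma phk_mul : multiplicative_kernel phk.
Proof.
move=> [m n] [m' n']; rewrite /phk /= mulS_shift zpowD //.
Qed.

Lemma fgk_mul : multiplicative_kernel fgk.
Proof.
move=> [m n] [m' n']; rewrite /fgk /= mulS_shift zpowD //.
Qed.

(** The leading exponent of phi(x, z)^m x^n is m + n, and with both m and n bounded below it is
    attained finitely often. This is why a(x_1)b(x) has to be multiplied by p before x_1 = phi(x, z)
    is substituted. *)
Lemma phk_summable (A : set (int * int)) :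
  (exists N, forall x, A x -> N <= x.1 /\ N <= x.2) -> summable LL phk A.
Proof.
move=> [N hN]; have [kappa hk] := zpow_supp lf f1.
apply: (summable_shift (f := fun e => (e.1 + e.2, 0))
  (N := [set x : int * int | 0 <= x.2 /\ - kappa x.2 <= x.1])).
- move=> [m n] [i j] _; rewrite /phk /= (_ : (i, j) - (n, 0) = (i - n, j - 0)) // => /hk.
  by rewrite subr0 => -[h1 h2]; lia.
- split; first by exists 0 => -[i j] [].
  by move=> j; exists (- kappa j) => i [].
- split; first by exists 0 => _ [e _ <-].
  by move=> j; exists (N + N) => i [e /hN[h1 h2] [<- _]]; lia.
move=> [i j]; apply: sub_finite_set (finite_setX (finite_interval N (i - N)) (finite_interval N (i - N))).
by move=> [m n] [/hN /= [h1 h2] [h3 _]]; lia.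
Qed.

(** Here the leading exponent of F(x_0, x_2)^m x_2^n is (m, n) itself, so nothing accumulates and no
    multiplier is required. *)
Lemma fgk_summable (A : set (int * int)) : LL A -> summable LL fgk A.
Proof.
move=> LA; have [kappa hk] := zpow_supp lf f1.
apply: (summable_shift (f := id)
  (N := [set x : int * int | 0 <= x.2 /\ - kappa x.2 <= x.1])).
- move=> [m n] [i j] _; rewrite /fgk /= (_ : (i, j) - (0, n) = (i - 0, j - n)) // => /hk.
  by rewrite subr0 => -[h1 h2]; lia.
- split; first by exists 0 => -[i j] [].
  by move=> j; exists (- kappa j) => i [].
- by rewrite image_id.
by move=> g; apply: sub_finite_set (finite_set1 g) => e [].
Qed.

End TwoVariableKernels.

(** * Substitutions in several variables *)

Section Lift.
Variables (I : finType) (s t : I).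
Hypothesis st : s != t.
Local Notation Z := {ffun I -> int}.

Definition upd (g : Z) (x : int * int) : Z :=
  [ffun i => if i == s then x.1 else if i == t then x.2 else g i].
Definition coords (g : Z) : int * int := (g s, g t).
Definition agree (e g : Z) : bool := [forall i, (i != s) && (i != t) ==> (g i == e i)].

Lemma agreeP (e g : Z) : reflect (forall i, i != s -> i != t -> g i = e i) (agree e g).
Proof.
apply: (iffP forallP) => h i; first by move=> i1 i2; have := h i; rewrite i1 i2 => /eqP.
by apply/implyP => /andP[i1 i2]; rewrite h.
Qed.

Lemma upd_s (g : Z) x : upd g x s = x.1. Proof. by rewrite ffunE eqxx. Qed.
Lemma upd_t (g : Z) x : upd g x t = x.2. Proof. by rewrite ffunE eq_sym (negbTE st) eqxx. Qed.
Lemma upd_off (g : Z) x i : i != s -> i != t -> upd g x i = g i.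
Proof. by rewrite ffunE => /negbTE -> /negbTE ->. Qed.
Lemma coords_upd g x : coords (upd g x) = x.
Proof. by rewrite /coords upd_s upd_t; case: x. Qed.
Lemma upd_agree e g : agree e g -> upd g (coords e) = e.
Proof.
move=> /agreeP h; apply/ffunP => i; rewrite ffunE.
by case: eqP => [->//|/eqP i1]; case: eqP => [->//|/eqP i2]; rewrite h.
Qed.
Lemma agree_upd g x : agree (upd g x) g.
Proof. by apply/agreeP => i i1 i2; rewrite upd_off. Qed.
Lemma upd_inj g : injective (upd g).
Proof. by move=> x y /(congr1 coords); rewrite !coords_upd. Qed.

Lemma coordsD a b : coords (a + b) = coords a + coords b.
Proof. by rewrite /coords !addzE. Qed.
Lemma coordsB a b : coords (a - b) = coords a - coords b.
Proof. by rewrite /coords !subzE. Qed.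

Variable K : fieldType.
Implicit Types T : int * int -> int * int -> K.

(* The substitution T applied to the variables s and t, the others being untouched. *)
Definition lift2 T (e g : Z) : K := if agree e g then T (coords e) (coords g) else 0.

Lemma subK_lift2 (V : lmodType K) T (h : Z -> V) g :
  subK (lift2 T) h g = subK T (fun x => h (upd g x)) (coords g).
Proof.
rewrite /subK (fsum_inj (upd g)); last 2 first.
- exact: upd_inj.
- move=> e nz; exists (coords e); rewrite upd_agree //.
  by apply: contra_notT nz => /negbTE na; rewrite /lift2 na scale0r.
by apply: eq_fsum => x; rewrite /lift2 agree_upd coords_upd.
Qed.

Lemma lift2_mul T : multiplicative_kernel T -> multiplicative_kernel (lift2 T).
Proof.
move=> mT e e'; apply/funext => g; rewrite mulSE.
rewrite (fsum_inj (upd e)); last 2 first.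
- exact: upd_inj.
- move=> a nz; exists (coords a); apply/esym/ffunP => i; rewrite ffunE.
  case: eqP => [->//|/eqP i1]; case: eqP => [->//|/eqP i2].
  case: (boolP (agree e a)) => [/agreeP->//|/negbTE na].
  by case: nz; rewrite /lift2 na mul0r.
rewrite {1}/lift2; case: ifP => [/agreeP ag|nag].
  rewrite coordsD mT mulSE; apply: eq_fsum => x.
  rewrite /lift2 coords_upd coordsB coords_upd ifT; last first.
    by apply/agreeP => i i1 i2; rewrite upd_off.
  rewrite ifT //; apply/agreeP => i i1 i2.
  by rewrite subzE upd_off // ag // addzE addrC addKr.
rewrite fsum0 // => x; rewrite /lift2 [X in _ * X]ifF ?mulr0 //.
apply: contraFF nag => /agreeP ag; apply/agreeP => i i1 i2.
have := ag i i1 i2; rewrite subzE upd_off // addzE => <-; rewrite addrC subrK //.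
Qed.

(* The effect of x_s = x_t = x on exponents: the sum is stored at s, and t is freed for the
   variable z of phi(x, z). *)
Definition fuse (e : Z) : Z := upd e (e s + e t, 0).

Lemma fuseD : {morph fuse : a b / a + b}.
Proof.
move=> a b; apply/ffunP => i; rewrite addzE !ffunE /=.
by case: eqP => // _; [lia|case: eqP].
Qed.

(* Exponents of the correction terms in phi(x, z)^m = x^m + O(z). *)
Definition near_axis (kappa : int -> int) : set Z :=
  [set g | [/\ forall i, i != s -> i != t -> g i = 0, 0 <= g t & - kappa (g t) <= g s]].

Lemma near_axis_cls kappa (D : {pred I}) : t \in D -> s \notin D -> cls D (near_axis kappa).
Proof.
move=> tD sD; split.
  exists 0 => e [h1 h2 _] i iD; have [->//|it] := eqVneq i t.
  by rewrite h1 //; apply: contraNneq sD => <-.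
move=> z; exists (Order.min 0 (- kappa (z t))) => e [h1 h2 h3] ez i iD.
rewrite ge_min; have [->|is_] := eqVneq i s; first by rewrite -(ez t) ?h3 ?orbT.
by rewrite h1 //; apply: contraNneq iD => ->.
Qed.

Lemma near_axis_lexb kappa (rho : I -> nat) : (rho s < rho t)%N -> lexb rho (near_axis kappa).
Proof.
move=> rst i g; exists (Order.min 0 (- kappa (g t))) => e [h1 h2 h3] eg.
rewrite ge_min; have [is_|is_] := eqVneq i s; first by subst i; rewrite -(eg t) ?h3 ?orbT.
by have [->|it] := eqVneq i t; rewrite ?h2 // h1.
Qed.

(** After fusing, t holds the new variable z, with exponent 0; so t can join the variables whose
    exponents are bounded first. *)
Lemma fuse_cls (D : {pred I}) A : s \notin D -> t \notin D -> cls D A ->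
  cls [predU1 t & D] (fuse @` A).
Proof.
move=> sD tD [[N hN] h]; split.
  exists (Order.min 0 N) => _ [e Ae <-] i; rewrite inE ge_min => /orP[/eqP->|iD].
    by rewrite upd_t lexx.
  rewrite upd_off ?hN ?orbT //; first by apply: contraNneq sD => <-.
  by apply: contraNneq tD => <-.
move=> z; have [M hM] := h z; exists (Order.min M (M + M)) => _ [e Ae <-] ez i.
have he j : j \notin D -> M <= e j.
  apply: (hM e Ae) => k kD; rewrite -ez ?inE ?kD ?orbT // upd_off //.
    by apply: contraNneq sD => <-.
  by apply: contraNneq tD => <-.
rewrite inE negb_or => /andP[it iD]; rewrite ge_min.
have [->|is_] := eqVneq i s; first by rewrite upd_s lerD ?he ?orbT.
by rewrite upd_off // he.
Qed.

Lemma fuse_fibers (A : set Z) :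
  (forall g, exists N, forall e, A e -> agree e g -> N <= e s /\ N <= e t) ->
  forall g, finite_set [set e | A e /\ fuse e = g].
Proof.
move=> hA g; have [N hN] := hA g.
apply: sub_finite_set (finite_box (upd g (N, N)) (upd g (g s - N, g s - N))) => e [Ae eg] i.
have ag : agree e g by apply/agreeP => k k1 k2; rewrite -eg upd_off.
have [h1 h2] := hN _ Ae ag; have := upd_s e (e s + e t, 0); rewrite -/(fuse e) eg /= => gs.
rewrite !ffunE /=; case: eqP => [->|/eqP is_]; first by rewrite gs; lia.
case: eqP => [->|/eqP it]; first by rewrite gs; lia.
by rewrite (agreeP _ _ ag).
Qed.

Lemma cls_fuse_fibers (D : {pred I}) A : s \notin D -> t \notin D -> cls D A ->
  forall g, finite_set [set e | A e /\ fuse e = g].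
Proof.
move=> sD tD [_ h]; apply: fuse_fibers => g; have [N hN] := h g.
exists N => e Ae /agreeP ag; split; apply: (hN e) => // i iD; rewrite ag //.
- by apply: contraNneq sD => <-.
- by apply: contraNneq tD => <-.
- by apply: contraNneq sD => <-.
- by apply: contraNneq tD => <-.
Qed.

Section Unip.
Variable f : int * int -> K.
Hypotheses (lf : laurent_pseries (V := K^o) f) (f1 : forall i, f (i, 0) = (i == 1)%:R).

Lemma lift_phk_near : exists kappa, forall e g, lift2 (phk f) e g <> 0 ->
  agree e g /\ near_axis kappa (g - fuse e).
Proof.
have [kappa hk] := zpow_supp lf f1; exists kappa => e g.
rewrite /lift2; case: ifP => // ag; rewrite /phk /coords /=.
rewrite (_ : (g s, g t) - (e t, 0) = (g s - e t, g t - 0)) // => /hk[h1 h2]; split=> //; split.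
- by move=> i i1 i2; rewrite subzE upd_off // (agreeP _ _ ag) // subrr.
- by rewrite subzE upd_t.
- by rewrite !subzE upd_t upd_s lerBrDr addrA [- _ + e s]addrC -lerBrDr; exact: h2.
Qed.

Lemma lift_phk_summable (F : sfam Z) A :
  (forall kappa, F (near_axis kappa)) -> F (fuse @` A) ->
  (forall g, finite_set [set e | A e /\ fuse e = g]) -> summable F (lift2 (phk f)) A.
Proof.
move=> FN FA fA; have [kappa hk] := lift_phk_near.
apply: (summable_shift (f := fuse) (N := near_axis kappa)) => //.
by move=> e g _ /hk[].
Qed.

Lemma lift_phk_cls (D : {pred I}) A : s \notin D -> t \notin D -> cls D A ->
  summable (clsF [predU1 t & D]) (lift2 (phk f)) A.
Proof.
move=> sD tD cA; apply: lift_phk_summable.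
- by move=> kappa; apply: near_axis_cls; rewrite !inE ?eqxx // negb_or st.
- exact: fuse_cls.
- exact: cls_fuse_fibers cA.
Qed.

Lemma lift_fgk_summable (F : sfam Z) A :
  (forall kappa, F (near_axis kappa)) -> F A -> summable F (lift2 (fgk f)) A.
Proof.
move=> FN FA; have [kappa hk] := zpow_supp lf f1.
apply: (summable_shift (f := id) (N := near_axis kappa)) => //; last 2 first.
- by rewrite image_id.
- by move=> g; apply: sub_finite_set (finite_set1 g) => e [].
move=> e g _; rewrite /lift2; case: ifP => // /agreeP ag; rewrite /fgk /coords /=.
rewrite (_ : (g s, g t) - (0, e t) = (g s - 0, g t - e t)) // => /hk[h1 h2]; split.
- by move=> i i1 i2; rewrite subzE ag // subrr.
- by rewrite subzE.
- by rewrite !subzE lerBrDr addrC -[g s]subr0; exact: h2.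
Qed.

End Unip.
End Lift.

Section Push.
Variables (K : fieldType) (I : finType).
Local Notation Z := {ffun I -> int}.
Implicit Types (q : int * int -> K) (i j s t : I).

(** The series q(x_i, x_j), regarded as a series in all variables. *)
Definition push i j q : Z -> K := fun e => if agree i j 0 e then q (coords i j e) else 0.

Lemma agree0P i j (g : Z) : reflect (forall k, k != i -> k != j -> g k = 0) (agree i j 0 g).
Proof. by apply: (iffP (agreeP i j 0 g)) => h k k1 k2; rewrite h // zerozE. Qed.

Lemma agree_sym i j (g : Z) : agree i j 0 g = agree j i 0 g.
Proof. by apply/agree0P/agree0P => h k k1 k2; rewrite h. Qed.

Lemma upd_agree0 i j (e : Z) : agree i j 0 e -> upd i j 0 (coords i j e) = e.
Proof.
move=> /agree0P h; apply/ffunP => k; rewrite !ffunE.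
by case: eqP => [->//|/eqP k1]; case: eqP => [->//|/eqP k2]; rewrite h.
Qed.

Lemma agree_upd0 i j x : agree i j 0 (upd i j 0 x).
Proof. by apply/agree0P => k k1 k2; rewrite upd_off // zerozE. Qed.

Lemma push_swap i j q : push i j q = push j i (swap2 q).
Proof. by apply/funext => e; rewrite /push agree_sym. Qed.

Lemma push_neq0 i j q e : push i j q e <> 0 -> agree i j 0 e /\ q (coords i j e) <> 0.
Proof. by rewrite /push; case: ifP. Qed.

Lemma smul_push (V : lmodType K) i j q (h : Z -> V) g : i != j ->
  smul (push i j q) h g = smul q (fun x => h (upd i j g x)) (coords i j g).
Proof.
move=> ij; rewrite /smul (fsum_inj (upd i j 0)); last 2 first.
- exact: upd_inj.
- move=> e nz; exists (coords i j e); rewrite upd_agree0 //.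
  by apply: contra_notT nz => /negbTE na; rewrite /push na scale0r.
apply: eq_fsum => x; rewrite /push agree_upd0 coords_upd //; congr (_ *: h _).
apply/ffunP => k; rewrite subzE !ffunE.
by case: eqP => [->//|_]; case: eqP => [->//|_]; rewrite subr0.
Qed.

Lemma push_mul i j q q' : i != j -> push i j (mulS q q') = mulS (push i j q) (push i j q').
Proof.
move=> ij; apply/funext => g; rewrite [RHS](smul_push (V := K^o)) // /push.
case: ifP => ag.
  apply: eq_fsum => x; rewrite coords_upd // ifT //.
  by apply/agree0P => k k1 k2; rewrite upd_off // (agree0P _ _ _ ag).
rewrite /smul fsum0 // => x; rewrite ifF ?scaler0 //.
apply: contraFF ag => /agree0P ag; apply/agree0P => k k1 k2.
by rewrite -(ag k) // upd_off.
Qed.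

Lemma push_sone i j : i != j -> push i j (@sone K _) = @sone K _.
Proof.
move=> ij; apply/funext => g; rewrite /push /sone; have [->|/eqP g0] := eqVneq g 0.
  by rewrite ifT ?/coords ?zerozE ?eqxx //; apply/agree0P => k; rewrite zerozE.
case: ifP => // /agree0P ag; case: eqP => // -[c1 c2]; case: g0.
apply/ffunP => k; rewrite zerozE; have [->//|k1] := eqVneq k i.
by have [->//|k2] := eqVneq k j; exact: ag.
Qed.

Lemma push_npow i j q n : i != j -> push i j (npow q n) = npow (push i j q) n.
Proof. by move=> ij; elim: n => [|n IH]; rewrite /= ?push_sone // push_mul // IH. Qed.

Lemma push_nonneg i j q : pseries2 q -> nonneg (supp (push i j q)).
Proof.
move=> pq e /= /push_neq0[/agree0P ag nz] k.
have : ~~ ((e i < 0) || (e j < 0)) by apply: contra_notN nz => /pq.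
rewrite negb_or -!leNgt => /andP[h1 h2].
have [->//|k1] := eqVneq k i; have [->//|k2] := eqVneq k j.
by rewrite ag.
Qed.

Lemma push_cls (D : {pred I}) s t q : s \notin D -> t \in D -> LL (supp q) ->
  cls D (supp (push s t q)).
Proof.
move=> sD tD [[M hM] hN]; split.
  exists (Order.min 0 M) => e /= /push_neq0[/agree0P ag /hM /= Me] k kD; rewrite ge_min.
  have [->|kt] := eqVneq k t; first by rewrite Me orbT.
  by rewrite ag //; apply: contraNneq sD => <-.
move=> z; have [N hN'] := hN (z t); exists (Order.min 0 N) => e /= /push_neq0[/agree0P ag nz] ez k kD.
rewrite ge_min; have [->|ks] := eqVneq k s.
  by rewrite (hN' (e s)) ?orbT //; rewrite -(ez t).
by rewrite ag //; apply: contraNneq kD => ->.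
Qed.

Lemma lift2_push (T : int * int -> int * int -> K) s t q : s != t ->
  subS (lift2 s t T) (push s t q) = push s t (subS T q).
Proof.
move=> st; apply/funext => g; rewrite /subS subK_lift2 // /push.
case: ifP => ag.
  apply: eq_fsum => x; rewrite coords_upd // ifT //.
  by apply/agree0P => k k1 k2; rewrite upd_off // (agree0P _ _ _ ag).
rewrite /subK fsum0 // => x; rewrite ifF ?scaler0 //.
apply: contraFF ag => /agree0P ag; apply/agree0P => k k1 k2.
by rewrite -(ag k) // upd_off.
Qed.

(** The substitution x_s = phi(x_t, z) stores the old x_t at s, so for a series free of x_s it is
    only a renaming. *)
Lemma lift_phk_push_t f s t o q : s != t -> o != s -> o != t ->
  subS (lift2 s t (phk f)) (push t o q) = push s o q.
Proof.
move=> st os ot; apply/funext => g; rewrite /subS subK_lift2 // /subK (fsum1 (0, g s)); last first.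
  move=> [m n] nz; rewrite /phk /=; rewrite (_ : coords s t g - (n, 0) = (g s - n, g t - 0)) //.
  have [m0|m0] := eqVneq m 0; last first.
    rewrite /push ifF ?scaler0 //; apply/negP => /agree0P /(_ s st).
    rewrite eq_sym os => /(_ isT); rewrite upd_s => /eqP; exact/negP.
  subst m; rewrite zpow_0 /sone; case: eqP; rewrite ?scale0r // => -[/eqP e1 _].
  by case: nz; move: e1; rewrite subr_eq0 => /eqP ->.
rewrite /phk /= /sone (_ : coords s t g - (g s, 0) = (g s - g s, g t - 0)) // subrr subr0.
rewrite /push /coords upd_t // upd_off // /=.
case: (boolP (agree s o 0 g)) => [/agree0P ag|nag].
  have gt0 : g t = 0 by apply: ag; rewrite eq_sym.
  rewrite gt0 eqxx scale1r ifT //; apply/agree0P => k k1 k2.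
  have [->|k3] := eqVneq k s; first by rewrite upd_s.
  by rewrite upd_off // ag.
have [gt0|gt0] := eqVneq (g t) 0; last first.
  by rewrite (_ : _ == _ = false) ?scale0r //; apply/eqP => -[/eqP]; exact/negP.
rewrite ifF ?scaler0 //; apply: contraNF nag => /agree0P ag; apply/agree0P => k k1 k2.
have [->//|k3] := eqVneq k t.
by rewrite -(ag k) // upd_off.
Qed.

Lemma lift_phk_push_t' f s t o q : s != t -> o != s -> o != t ->
  subS (lift2 s t (phk f)) (push o t q) = push o s q.
Proof. by move=> st os ot; rewrite push_swap lift_phk_push_t // [RHS]push_swap. Qed.

Definition collapse s t k := if k == t then s else k.

Lemma push_fuse s t i j q : s != t -> i != j -> collapse s t i != collapse s t j ->
  subS (pushk K (fuse s t)) (push i j q) = push (collapse s t i) (collapse s t j) q.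
Proof.
move=> st ij cij; apply/funext => g; rewrite /subS /subK (fsum_inj (upd i j 0)); last 2 first.
- exact: upd_inj.
- move=> e nz; exists (coords i j e); rewrite upd_agree0 //.
  by apply: contra_notT nz => /negbTE na; rewrite /push na scaler0.
(* A finite check of which of the indices i, j, k, s, t coincide. *)
have mE x : fuse s t (upd i j 0 x) = upd (collapse s t i) (collapse s t j) 0 x.
  apply/ffunP => k; rewrite !ffunE /= /collapse.
  move: st ij cij; rewrite /collapse => /eqP ? /eqP ?.
  case: (eqP (x := i) (y := t)) => ?; case: (eqP (x := j) (y := t)) => ? /eqP ?;
    case: (eqP (x := k) (y := s)) => ?; case: (eqP (x := k) (y := t)) => ?;
    case: (eqP (x := s) (y := i)) => ?; case: (eqP (x := s) (y := j)) => ?;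
    case: (eqP (x := t) (y := i)) => ?; case: (eqP (x := t) (y := j)) => ?;
    case: (eqP (x := k) (y := i)) => ?; case: (eqP (x := k) (y := j)) => ?;
    by rewrite ?(addr0, add0r) //; congruence.
transitivity (fsum (fun x => (g == upd (collapse s t i) (collapse s t j) 0 x)%:R * q x)).
  apply: eq_fsum => x; rewrite /pushk mE /push agree_upd0 coords_upd //.
rewrite (fsum1 (coords (collapse s t i) (collapse s t j) g)) /push.
  case: ifP => ag; first by rewrite upd_agree0 // eqxx mul1r.
  case: eqP => e; rewrite ?mul0r //.
  by move: ag; rewrite e agree_upd0.
move=> x nx; case: eqP => [e|]; rewrite ?mul0r //.
by case: nx; rewrite e coords_upd.
Qed.

End Push.

Section PowerSeriesRing.
Variables (K : fieldType) (I : finType).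
Local Notation Z := {ffun I -> int}.

Definition PS := fser K (nonnegF I).

Definition ps_push (i j : I) (p : int * int -> K) (hp : pseries2 p) : PS :=
  fser_of (F := nonnegF I) (push_nonneg (i := i) (j := j) hp).

Variables (s t : I).
Hypothesis st : s != t.

Lemma fuse_nonneg A : nonneg A -> nonneg (fuse s t @` A).
Proof.
move=> nA _ [e Ae <-] i; rewrite ffunE /=; case: eqP => _; first by rewrite addr_ge0 ?nA.
by case: eqP => _ //; exact: nA.
Qed.

Lemma pushk_fuse_summable (A : set Z) : nonneg A -> summable (nonnegF I) (pushk K (fuse s t)) A.
Proof.
move=> nA; apply: summable_push; first exact: fuse_nonneg.
by apply: fuse_fibers => // g; exists 0 => e /nA h _.
Qed.

Definition ps_fuse (x : PS) : PS :=
  fser_of (subS_in (pushk_fuse_summable (fser_in x))).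

Lemma ps_fuseM x y : ps_fuse (x * y) = ps_fuse x * ps_fuse y.
Proof.
apply: val_inj; apply: (subS_mul (F := nonnegF I)).
- by apply: pushk_mul; exact: fuseD.
- exact: pushk_fuse_summable (fser_in x).
- exact: pushk_fuse_summable (fser_in y).
Qed.

Lemma ps_fuse1 : ps_fuse 1 = 1.
Proof.
apply: val_inj; apply/funext => g; rewrite /= /subS /subK (fsum1 0).
  rewrite /sone eqxx [LHS]mulr1 /pushk /=; congr (nat_of_bool (g == _))%:R.
  by apply/ffunP => i; rewrite !ffunE /=; do 2 case: eqP => //.
by move=> e /eqP/negbTE e0; rewrite /sone e0 scaler0.
Qed.

End PowerSeriesRing.

Lemma laurent2_smul (K : fieldType) (V : lmodType K) (f : int * int -> K) (h : int * int -> V) :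
  laurent2 (V := K^o) f -> laurent2 h -> laurent2 (smul f h).
Proof.
move=> [N hN] [M hM]; exists (N + M) => i j ij; apply: contrapT => /smul_supp[[m n] [[m' n'] [h1 h2 [e1 e2]]]].
have h3 : ~~ ((m < N) || (n < N)) by apply: contra_notN h1 => /hN.
have h4 : ~~ ((m' < M) || (n' < M)) by apply: contra_notN h2 => /hM.
by move: ij h3 h4; rewrite e1 e2; lia.
Qed.

(** * Vertex operators *)

Section CalEFacts.
Variables (K : fieldType) (W : lmodType K).
Implicit Types a b : calE W.

Lemma calE_linear a n : linear (fun w => a w n).
Proof. by case: a => a /= /asboolP[la _] c u v; rewrite la. Qed.

Lemma calE_bound a w : exists N : int, forall n, n < N -> a w n = 0.
Proof. by case: a => a /= /asboolP[_]. Qed.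

Lemma calE0 a n : a 0 n = 0.
Proof. by have := calE_linear a n (-1) 0 0; rewrite scaler0 addr0 scaleN1r addNr. Qed.

Lemma calE_supp a w : exists N : int, forall n, a w n <> 0 -> N <= n.
Proof.
have [N hN] := calE_bound a w; exists N => n nz; rewrite leNgt.
by apply: contra_notN nz => /hN.
Qed.

Lemma comp2_linear a b x : linear (fun w => comp2 a b w x).
Proof. by move=> c u v; rewrite /comp2 calE_linear calE_linear. Qed.

Lemma comp2_LL a b w : LL (supp (comp2 a b w)).
Proof.
split.
  have [N hN] := calE_supp b w; exists N => -[m n] /= nz; apply: hN => bz.
  by apply: nz; rewrite /comp2 /= bz calE0.
by move=> n; have [N hN] := calE_supp a (b w n); exists N => m; exact: hN.
Qed.

End CalEFacts.

Section VertexOperator.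
Variables (K : fieldType) (W : lmodType K) (phi : int * int -> K).
Hypotheses (lphi : laurent_pseries (V := K^o) phi) (phi1 : forall i, phi (i, 0) = (i == 1)%:R).
Implicit Types (a b : calE W) (p : int * int -> K).

Lemma subst_phiE (V : lmodType K) (h : int * int -> V) : subst_phi phi h = subK (phk phi) h.
Proof. by []. Qed.

Lemma laurent2_summable (V : lmodType K) (h : int * int -> V) :
  laurent2 h -> summable LL (phk phi) (supp h).
Proof.
move=> [N hN]; apply: phk_summable => //; exists N => -[i j] /= nz.
have : ~~ ((i < N) || (j < N)) by apply: contra_notN nz => /hN.
by rewrite negb_or -!leNgt => /andP.
Qed.

Lemma subst_phi_nonneg (V : lmodType K) (h : int * int -> V) i j :
  j < 0 -> subst_phi phi h (i, j) = 0.
Proof.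
move=> j0; rewrite /subst_phi fsum0 // => -[m n] /=.
have [kappa hk] := zpow_supp lphi phi1.
have [->|/eqP nz] := eqVneq (zpow phi m ((i, j) - (n, 0))) 0; first by rewrite scale0r.
by have [] := hk m (i - n) (j - 0) nz; rewrite subr0; lia.
Qed.

Lemma subst_scalar_LL p : pseries2 p -> LL (supp (subst_phi_scalar phi p)).
Proof.
by move=> pp; apply: (subS_in (q := p)); apply: (laurent2_summable (V := K^o)); exact: pseries2_laurent2.
Qed.

Lemma subst_phi_smul (V : lmodType K) p (h : int * int -> V) :
  laurent2 (V := K^o) p -> laurent2 h ->
  subst_phi phi (smul p h) = smul (subst_phi_scalar phi p) (subst_phi phi h).
Proof.
move=> pp lh; apply: (subK_mul (F := LL)).
- exact: phk_mul.
- exact: (laurent2_summable (V := K^o)).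
- exact: laurent2_summable.
Qed.

Lemma scalar_inverse (f : int * int -> K) : LL (supp f) -> f <> 0 ->
  LL (supp (@inv_in K (laurent_laurent (V := K^o)) f)) /\
  mulS f (@inv_in K (laurent_laurent (V := K^o)) f) = @sone K _.
Proof.
move=> Lf f0; have [k [u [v [lu lv uv fu _]]]] := LL_decomp Lf f0.
pose g (x : int * int) : K := v (x.1, x.2 + k).
have Lv := laurent_pseries_LL lv.
have Lg : LL (supp g).
  case: Lv => [[M hM] hN]; split.
    by exists (M - k) => -[i j] /hM /=; lia.
  by move=> j; have [N h] := hN (j + k); exists N => i /h.
have fg : mulS f g = @sone K _.
  rewrite -uv; have -> : f = (fun x => u (x - (0, k))).
    by apply/funext => -[i j]; rewrite fu -{1}(subr0 i).
  have -> : g = (fun x => v (x - (0, - k))).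
    by apply/funext => -[i j]; rewrite /g /= -{1}(subr0 i) -{1}(opprK k).
  rewrite mulS_shift; apply/funext => x; congr (mulS u v _).
  rewrite (_ : (0, k) + (0, - k) = (0 + 0, k - k)) // addr0 subrr; exact: subr0.
have [] := @inv_inP K (laurent_laurent (V := K^o)) f.
  by exists g => //; apply/LL_P.
by move=> /LL_P.
Qed.

Lemma smul_cancel (V : lmodType K) (f : int * int -> K) (h h' : int * int -> V) :
  LL (supp f) -> f <> 0 -> LL (supp h) -> LL (supp h') -> smul f h = smul f h' -> h = h'.
Proof.
move=> Lf f0 Lh Lh' e; have [Lg fg] := scalar_inverse Lf f0.
have := congr1 (smul (@inv_in K (laurent_laurent (V := K^o)) f)) e.
by rewrite -!(smulA (F := LL)) // [mulS _ f]mulSC fg !smul1.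
Qed.

Lemma subst_scalar_mul p q : pseries2 p -> pseries2 q ->
  subst_phi_scalar phi p <> 0 -> subst_phi_scalar phi q <> 0 -> subst_phi_scalar phi (mulS p q) <> 0.
Proof.
move=> pp pq p0 q0; rewrite /subst_phi_scalar (subst_phi_smul (V := K^o)) //; last 2 first.
- exact: pseries2_laurent2.
- exact: pseries2_laurent2.
move=> e; apply: q0; apply: (smul_cancel (V := K^o) (subst_scalar_LL pp) p0).
- exact: subst_scalar_LL.
- exact: supp0.
- by rewrite [RHS](@smul0r _ _ K^o); exact: e.
Qed.

Lemma compatible_mul a b p q : compatible_with phi a b p -> pseries2 q ->
  subst_phi_scalar phi q <> 0 -> compatible_with phi a b (mulS q p).
Proof.
move=> [pp p0 hp] pq q0; split; [exact: pseries2_mul|exact: subst_scalar_mul|move=> w].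
have Lp : LL (supp (p : int * int -> K)) by exact: laurent2_LL (pseries2_laurent2 pp).
have Lq : LL (supp (q : int * int -> K)) by exact: laurent2_LL (pseries2_laurent2 pq).
rewrite (smulA (F := LL) Lq Lp (comp2_LL a b w)).
by apply: laurent2_smul => //; exact: pseries2_laurent2.
Qed.

Section OnePair.
Variables (a b : calE W) (p : int * int -> K).
Hypothesis cp : compatible_with phi a b p.

Let p0 := xget 0 [set p | compatible_with phi a b p].
Let cp0 : compatible_with phi a b p0.
Proof. by apply: (@xgetPex _ _ [set p | compatible_with phi a b p]); exists p. Qed.

Let YEeq w : YE phi a b w = smul (@inv_in K (laurent_laurent (V := K^o)) (subst_phi_scalar phi p0))
       (subst_phi phi (smul p0 (comp2 a b w))).
Proof. by []. Qed.

Let inv0 : int * int -> K := @inv_in K (laurent_laurent (V := K^o)) (subst_phi_scalar phi p0).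

Let L0 : LL (supp (subst_phi_scalar phi p0)).
Proof. by apply: subst_scalar_LL; case: cp0. Qed.

Let Linv : LL (supp inv0) /\ mulS (subst_phi_scalar phi p0) inv0 = @sone K _.
Proof. by apply: scalar_inverse => //; case: cp0. Qed.

Lemma YE_LL w : LL (supp (YE phi a b w)).
Proof.
rewrite YEeq; apply: smul_in; first exact: Linv.1.
by apply: subK_in; apply: laurent2_summable; case: cp0.
Qed.

(** The pole in z comes only from the inverse of p(phi(x, z), x), so its order is bounded uniformly
    in w. Both the truncation of Y and the choice of exponents in [qcl_step] rest on this
    uniformity. *)
Lemma YE_bound : exists M : int, forall w i j, j < M -> YE phi a b w (i, j) = 0.
Proof.
have [[M hM] _] := Linv.1; exists M => w i j jM; rewrite YEeq; apply: contrapT.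
move=> /smul_supp[[m n] [[m' n'] [/hM /= h1 h2 [_ e2]]]].
case: (ltP n' 0) => [/(subst_phi_nonneg (smul p0 (comp2 a b w)) m')|h3] //.
by move: jM; rewrite e2; lia.
Qed.

(** [YE] is defined with the multiplier [p0] picked by [xget]. Any other p is compared with it
    through the product p p0, which gives the independence of the choice. *)
Lemma YE_E w : smul (subst_phi_scalar phi p) (YE phi a b w) = subst_phi phi (smul p (comp2 a b w)).
Proof.
have [pp pn hp] := cp; have [pp0 pn0 hp0] := cp0.
have Lp := laurent2_LL (pseries2_laurent2 pp); have Lp0 := laurent2_LL (pseries2_laurent2 pp0).
have Lc := comp2_LL a b w; have LS := subst_scalar_LL pp.
have S1 : LL (supp (subst_phi phi (smul p (comp2 a b w)))).
  by apply: subK_in; exact: laurent2_summable.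
have S2 : LL (supp (subst_phi phi (smul p0 (comp2 a b w)))).
  by apply: subK_in; exact: laurent2_summable.
have [LI I0] := Linv.
rewrite YEeq -/inv0 -(smulA (F := LL)) // [mulS _ inv0]mulSC (smulA (F := LL)) //.
rewrite -subst_phi_smul; [|exact: pseries2_laurent2|exact: hp0].
rewrite -(smulA (F := LL)) // [mulS p p0]mulSC (smulA (F := LL)) //.
rewrite (@subst_phi_smul _ p0); [|exact: pseries2_laurent2|exact: hp].
by rewrite -(smulA (F := LL)) // [mulS inv0 _]mulSC I0 smul1.
Qed.

Lemma YE_linear x : linear (fun w => YE phi a b w x).
Proof.
move=> c u v; rewrite !YEeq -/inv0.
have Zs (h : int * int -> W) : supp (c *: h) `<=` supp h.
  by move=> y /= nz z; apply: nz; rewrite scalefE z scaler0.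
have lin : smul p0 (comp2 a b (c *: u + v)) = c *: smul p0 (comp2 a b u) + smul p0 (comp2 a b v).
  rewrite (_ : comp2 a b _ = c *: comp2 a b u + comp2 a b v).
    by rewrite (smulDr (F := LL)) ?smulZr //; [apply: (laurent2_LL (V := K^o)); apply: pseries2_laurent2; case: cp0
      |apply: sf_sub (Zs _) _; exact: comp2_LL|exact: comp2_LL].
  by apply/funext => y; rewrite comp2_linear.
have [_ _ hp0] := cp0.
rewrite lin !subst_phiE (subKD (F := LL)) ?subKZ; last 2 first.
- by apply: summable_sub (Zs _) _; exact: laurent2_summable.
- exact: laurent2_summable.
rewrite (smulDr (F := LL)) ?smulZr //; first exact: Linv.1.
  by apply: sf_sub (Zs _) _; apply: subK_in; exact: laurent2_summable.
by apply: subK_in; exact: laurent2_summable.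
Qed.

Lemma nth_product_hom n : nth_product phi a b n \in @hom_laurent K W.
Proof.
apply/asboolP; split.
  by move=> c u v; apply/funext => i; rewrite /nth_product YE_linear.
move=> w; have [_ hN] := YE_LL w; have [N h] := hN (- n - 1); exists N => i iN.
by apply: contrapT => nz; have := h i nz; lia.
Qed.

Definition nthE n : calE W := CalE (nth_product_hom n).

End OnePair.
End VertexOperator.

(** * Words of vertex operators *)

Section Words.
Variables (K : fieldType) (W : lmodType K).
Implicit Types (l : seq (calE W)) (w : W) (m : nat -> int).

(** Exponents are functions on [nat], so that dropping a letter is a shift; [ext] passes from
    exponent tuples to such functions. *)
Fixpoint compL l w m : W :=
  if l is a :: l' then a (compL l' w (fun k => m k.+1)) (m 0%N) else w.

Lemma compL_cat l1 l2 w m :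
  compL (l1 ++ l2) w m = compL l1 (compL l2 w (fun k => m (size l1 + k)%N)) m.
Proof. by elim: l1 m => //= a l1 IH m; rewrite IH. Qed.

Lemma compL_linear l m : linear (fun w => compL l w m).
Proof.
elim: l m => [//|a l IH] m c u v /=.
by rewrite (IH (fun k => m k.+1) c u v) calE_linear.
Qed.

Lemma compL0 l m : compL l 0 m = 0.
Proof. by elim: l m => //= a l IH m; rewrite IH calE0. Qed.

Lemma compL_ext l w m m' : (forall k, (k < size l)%N -> m k = m' k) -> compL l w m = compL l w m'.
Proof.
elim: l m m' => //= a l IH m m' h; rewrite (IH _ (fun k => m' k.+1)) ?h // => k kl.
by rewrite h.
Qed.

(** The vector on which letter k acts depends only on the exponents of the letters to its right, and
    the letters to its left send 0 to 0. *)
Lemma compL_bound l w k m0 : (k < size l)%N -> exists N, forall m, compL l w m <> 0 ->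
  (forall j, (k < j < size l)%N -> m j = m0 j) -> N <= m k.
Proof.
elim: l k m0 => //= a l IH [|k] m0 kl.
  have [N hN] := calE_supp a (compL l w (fun j => m0 j.+1)); exists N => m nz em.
  by apply: hN; rewrite -(@compL_ext _ _ (fun j => m j.+1)) // => j jl; apply: em.
have [N hN] := IH k (fun j => m0 j.+1) kl; exists N => m nz em.
apply: (hN (fun j => m j.+1)); last by move=> j kj; apply: em.
by move=> z; apply: nz; rewrite z calE0.
Qed.

Definition ext n (e : {ffun 'I_n -> int}) : nat -> int := fun k => oapp e 0 (insub k).

Lemma ext_ord n (e : {ffun 'I_n -> int}) (i : 'I_n) : ext e i = e i.
Proof. by rewrite /ext valK. Qed.

Lemma ext_eq n (e g : {ffun 'I_n -> int}) k :
  (forall i : 'I_n, nat_of_ord i = k -> e i = g i) -> ext e k = ext g k.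
Proof. by rewrite /ext; case: insubP => //= i _ ik ->. Qed.

Lemma compr_compL r (a : 'I_r -> calE W) l w (e : {ffun 'I_r -> int}) : size l = r ->
  (forall i : 'I_r, a i = nth 0 l i) -> compr a w e = compL l w (ext e).
Proof.
move=> sl al; rewrite /compr.
have : forall i : 'I_r, e i = ext e i by move=> i; rewrite ext_ord.
move: (ext e) => m; move: (e : 'I_r -> int) => {}e.
elim: r l a e m sl al => [|r IH] [|b l] // a e m.
  by move=> _ _ _; rewrite enum_ord0.
move=> [sl] al em; rewrite enum_ordSl /= foldr_map.
rewrite (IH l (fun i => a (lift ord0 i)) (fun i => e (lift ord0 i)) (fun k => m k.+1)) //.
by rewrite al em.
Qed.

End Words.

Section Sandwich.
Variables (K : fieldType) (W : lmodType K) (n : nat) (s t : 'I_n).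
Variables (l1 l2 : seq (calE W)) (w : W).
Hypotheses (hs : nat_of_ord s = size l1) (ht : nat_of_ord t = (size l1).+1)
  (hn : (n = size l1 + (size l2).+2)%N).
Local Notation Z := {ffun 'I_n -> int}.

Let st : s != t.
Proof. by rewrite -(inj_eq val_inj) /= hs ht neq_ltn ltnSn. Qed.

Let gt_neq (i : 'I_n) : (t < i)%N -> (i != s) && (i != t).
Proof. by rewrite -!(inj_eq val_inj) /= ht hs; lia. Qed.

Let lt_neq (i : 'I_n) : (i < s)%N -> (i != s) && (i != t).
Proof. by rewrite -!(inj_eq val_inj) /= ht hs; lia. Qed.

Definition tail_vec (g : Z) : W := compL l2 w (fun k => ext g ((size l1).+2 + k)%N).

(* The word l1, a, b, l2 applied to w, with a(x_s) b(x_t) replaced by Y. *)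
Definition sandwich (Y : W -> int * int -> W) (g : Z) : W :=
  compL l1 (Y (tail_vec g) (coords s t g)) (ext g).

Lemma tail_vec_eq (e g : Z) : (forall i : 'I_n, (t < i)%N -> e i = g i) -> tail_vec e = tail_vec g.
Proof.
move=> eg; apply: compL_ext => k kl; apply: ext_eq => i ik; apply: eg.
by rewrite ht ik; lia.
Qed.

Lemma tail_vec_upd g x : tail_vec (upd s t g x) = tail_vec g.
Proof.
by apply: tail_vec_eq => i /gt_neq/andP[? ?]; rewrite upd_off.
Qed.

Lemma head_eq u (e g : Z) : (forall i : 'I_n, (i < s)%N -> e i = g i) ->
  compL l1 u (ext e) = compL l1 u (ext g).
Proof. by move=> eg; apply: compL_ext => k kl; apply: ext_eq => i ik; apply: eg; rewrite ik hs. Qed.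

Lemma head_upd u g x : compL l1 u (ext (upd s t g x)) = compL l1 u (ext g).
Proof.
by apply: head_eq => i /lt_neq/andP[? ?]; rewrite upd_off.
Qed.

Lemma sandwich_upd Y g x : sandwich Y (upd s t g x) = compL l1 (Y (tail_vec g) x) (ext g).
Proof. by rewrite /sandwich tail_vec_upd coords_upd // head_upd. Qed.

Lemma sandwich_compL a b (g : Z) :
  compL (l1 ++ a :: b :: l2) w (ext g) = sandwich (comp2 a b) g.
Proof.
rewrite compL_cat /sandwich /comp2 /= addn0 addn1 -ht ext_ord -hs ext_ord.
rewrite (_ : compL l2 w _ = tail_vec g) //.
by apply: compL_ext => k _; congr (ext g); rewrite hs !addnS addSn.
Qed.

Lemma sandwich_push q Y : LL (supp q) -> (forall v, LL (supp (Y v))) ->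
  smul (push s t q) (sandwich Y) = sandwich (fun v => smul q (Y v)).
Proof.
move=> Lq LY; apply/funext => g; rewrite smul_push // [RHS]/sandwich.
rewrite (smul_linear (L := fun u => compL l1 u (ext g)) (F := LL)) //; last exact: compL_linear.
suff -> : (fun x => sandwich Y (upd s t g x)) = (fun u => compL l1 u (ext g)) \o Y (tail_vec g) by [].
by apply/funext => x; rewrite sandwich_upd.
Qed.

Lemma sandwich_lift T Y : (forall v, summable LL T (supp (Y v))) ->
  subK (lift2 s t T) (sandwich Y) = sandwich (fun v => subK T (Y v)).
Proof.
move=> LY; apply/funext => g; rewrite subK_lift2 // [RHS]/sandwich.
rewrite (subK_linear (L := fun u => compL l1 u (ext g)) (F := LL)) //; last exact: compL_linear.
suff -> : (fun x => sandwich Y (upd s t g x)) = (fun u => compL l1 u (ext g)) \o Y (tail_vec g) by [].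
by apply/funext => x; rewrite sandwich_upd.
Qed.

Local Notation rho := (@nat_of_ord n).

Lemma tail_bound (i : 'I_n) (g : Z) : (t < i)%N -> exists N, forall e, tail_vec e <> 0 ->
  (forall j : 'I_n, (i < j)%N -> e j = g j) -> N <= e i.
Proof.
move=> ti.
have il : (i - (size l1).+2 < size l2)%N by have := ltn_ord i; rewrite -ht; lia.
have ie : ((size l1).+2 + (i - (size l1).+2))%N = i by move: ti; rewrite ht; lia.
have [N hN] := compL_bound w (fun k => ext g ((size l1).+2 + k)%N) il.
exists N => e /hN h eg; rewrite -ext_ord -ie; apply: h => j jl.
by apply: ext_eq => k kj; apply: eg; rewrite kj -ie; lia.
Qed.

Lemma sandwich_nz Y e : (forall x, Y 0 x = 0) -> sandwich Y e <> 0 ->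
  tail_vec e <> 0 /\ Y (tail_vec e) (coords s t e) <> 0.
Proof.
move=> Y0 nz; split=> z; apply: nz; first by rewrite /sandwich z Y0 compL0.
by rewrite /sandwich z compL0.
Qed.

Lemma head_bound u (i : 'I_n) (g : Z) : (i < s)%N -> exists N, forall e,
  compL l1 u (ext e) <> 0 -> (forall j : 'I_n, (i < j)%N -> (j < s)%N -> e j = g j) -> N <= e i.
Proof.
rewrite hs => is_; have [N hN] := compL_bound u (ext g) is_; exists N => e /hN h eg.
rewrite -ext_ord; apply: h => j /andP[ij jl]; apply: ext_eq => k kj; apply: eg; rewrite kj ?hs //.
Qed.

Lemma ord_cases (i : 'I_n) : [\/ (t < i)%N, i = t, i = s | (i < s)%N].
Proof.
case: (ltngtP i t) => [it|ti|it]; [|by constructor 1|by constructor 2; exact: val_inj].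
case: (ltngtP i s) => [si|si|si]; [by constructor 4| |by constructor 3; exact: val_inj].
by move: it si; rewrite hs ht; lia.
Qed.

Lemma s_lt_t : (s < t)%N. Proof. by rewrite hs ht. Qed.

Lemma sandwich_lexb Y : (forall x, Y 0 x = 0) -> (forall v, LL (supp (Y v))) ->
  lexb rho (supp (sandwich Y)).
Proof.
move=> Y0 LY i g; have ltst := s_lt_t; case: (ord_cases i) => [ti|->|->|is_].
- have [N hN] := tail_bound g ti; exists N => e /(sandwich_nz Y0)[tz _]; exact: hN.
- have [[M hM] _] := LY (tail_vec g); exists M => e /(sandwich_nz Y0)[_ yz] eg.
  by have := hM (coords s t e); rewrite -(tail_vec_eq eg); exact.
- have [_ /(_ (g t))[N hN]] := LY (tail_vec g); exists N => e /(sandwich_nz Y0)[_ yz] eg.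
  apply: hN => /=; rewrite -(eg t) // -(@tail_vec_eq e) // => j tj; apply: eg; exact: ltn_trans tj.
have [N hN] := head_bound (Y (tail_vec g) (coords s t g)) g is_; exists N => e nz eg.
apply: hN; last by move=> j ij _; exact: eg.
move: nz; rewrite /= /sandwich /coords (eg s) // (eg t); last exact: ltn_trans ltst.
rewrite (@tail_vec_eq e g) // => j tj; apply: eg; apply: ltn_trans tj; exact: ltn_trans ltst.
Qed.

Lemma sandwich_fuse_fibers Y : (forall x, Y 0 x = 0) -> (forall v, laurent2 (Y v)) ->
  forall g, finite_set [set e | supp (sandwich Y) e /\ fuse s t e = g].
Proof.
move=> Y0 LY; apply: fuse_fibers => // g; have [N hN] := LY (tail_vec g).
exists N => e /(sandwich_nz Y0)[_ yz] /agreeP ag.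
have : tail_vec e = tail_vec g.
  by apply: tail_vec_eq => i /gt_neq/andP[? ?]; rewrite ag.
move=> te; move: yz; rewrite te => yz.
have : ~~ ((e s < N) || (e t < N)) by apply: contra_notN yz => /hN.
by rewrite negb_or -!leNgt => /andP.
Qed.

Lemma sandwich_fuse_lexb Y : (forall x, Y 0 x = 0) -> (forall v, laurent2 (Y v)) ->
  lexb rho (fuse s t @` supp (sandwich Y)).
Proof.
move=> Y0 LY i g; have ltst := s_lt_t.
have off (e : Z) (j : 'I_n) : (t < j)%N -> fuse s t e j = e j.
  by move=> /gt_neq/andP[? ?]; rewrite upd_off.
have lo (e : Z) (j : 'I_n) : (j < s)%N -> fuse s t e j = e j.
  by move=> /lt_neq/andP[? ?]; rewrite upd_off.
have [N hN] := LY (tail_vec g).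
have bd (e : Z) : supp (sandwich Y) e -> (forall j : 'I_n, (t < j)%N -> fuse s t e j = g j) ->
    [/\ tail_vec e = tail_vec g, N <= e s & N <= e t].
  move=> /(sandwich_nz Y0)[_ yz] eg.
  have te : tail_vec e = tail_vec g by apply: tail_vec_eq => j tj; rewrite -eg // off.
  move: yz; rewrite te => yz.
  have : ~~ ((e s < N) || (e t < N)) by apply: contra_notN yz => /hN.
  by rewrite negb_or -!leNgt => /andP[].
case: (ord_cases i) => [ti|->|->|is_].
- have [M hM] := tail_bound g ti; exists M => _ [e /(sandwich_nz Y0)[tz _] <-] eg.
  rewrite off //; apply: hM => // j ij; rewrite -eg // off //; exact: ltn_trans ij.
- by exists 0 => _ [e _ <-] _; rewrite upd_t.
- exists (N + N) => _ [e nz <-] eg; rewrite upd_s /=.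
  have [|_ h1 h2] := bd _ nz; last exact: lerD.
  by move=> j tj; apply: eg; exact: ltn_trans tj.
(* To the left of s only the sum of the exponents at s and t is fixed. As both are at least N,
   finitely many pairs remain, and the bounds are minimised over them. *)
have [M hM] := choice (fun x => head_bound (Y (tail_vec g) x) g is_).
have [L hL] := finite_lb M (finite_setX (finite_interval N (g s - N)) (finite_interval N (g s - N))).
exists L => _ [e nz <-] eg; rewrite lo //.
have [|te h1 h2] := bd _ nz.
  by move=> j tj; apply: eg; apply: ltn_trans tj; exact: ltn_trans ltst.
have es : e s + e t = g s by rewrite -(eg s) // upd_s.
apply: (@le_trans _ _ (M (coords s t e))); first by apply: hL; split; rewrite /= -es; lia.
apply: hM; first by move: nz; rewrite /= /sandwich te.
by move=> j ij js; rewrite -eg // lo.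
Qed.

Section Phi.
Variable phi : int * int -> K.
Hypotheses (lphi : laurent_pseries (V := K^o) phi) (phi1 : forall i, phi (i, 0) = (i == 1)%:R).

Definition ordF : sfam Z := lexF (@ord_inj n).

Lemma near_axis_ordF kappa : ordF (near_axis s t kappa).
Proof. by apply: lexb_lexF; apply: near_axis_lexb => //; exact: s_lt_t. Qed.

Lemma sandwich_summable Y : (forall x, Y 0 x = 0) -> (forall v, laurent2 (Y v)) ->
  summable ordF (lift2 s t (phk phi)) (supp (sandwich Y)).
Proof.
move=> Y0 LY; apply: lift_phk_summable => //.
- exact: near_axis_ordF.
- by apply: lexb_lexF; exact: sandwich_fuse_lexb.
- exact: sandwich_fuse_fibers.
Qed.

Lemma nonneg_ordF (A : set Z) : nonneg A -> ordF A.
Proof. by move=> nA; apply: (clsF_lexF (D := pred0)) => //; exact: nonneg_cls0. Qed.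

Lemma nonneg_summable (A : set Z) : nonneg A -> summable ordF (lift2 s t (phk phi)) A.
Proof.
move=> nA; apply: lift_phk_summable => //.
- exact: near_axis_ordF.
- by apply: nonneg_ordF; exact: fuse_nonneg.
- by apply: fuse_fibers => // g; exists 0 => e /nA h _.
Qed.

Variables (a b : calE W) (p : int * int -> K).
Hypothesis cp : compatible_with phi a b p.

Let pp : pseries2 p. Proof. by case: cp. Qed.
Let Lp : LL (supp p). Proof. exact: (laurent2_LL (V := K^o) (pseries2_laurent2 pp)). Qed.
Let pi := subst_phi_scalar phi p.
Let Lpi : LL (supp pi). Proof. exact: subst_scalar_LL. Qed.

Local Notation S := (lift2 s t (phk phi)).

Let comp20 x : comp2 a b 0 x = 0. Proof. by rewrite /comp2 !calE0. Qed.
Let YE0 x : YE phi a b 0 x = 0.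
Proof. by have := YE_linear lphi phi1 cp x (-1) 0 0; rewrite scaler0 addr0 scaleN1r addNr. Qed.

Lemma sandwich_comp_ordF : ordF (supp (sandwich (comp2 a b))).
Proof. by apply: lexb_lexF; apply: sandwich_lexb => // v; exact: comp2_LL. Qed.

Lemma sandwich_YE_ordF : ordF (supp (sandwich (YE phi a b))).
Proof. by apply: lexb_lexF; apply: sandwich_lexb => // v; exact: (YE_LL lphi phi1 cp). Qed.

(** The factor p(x_s, x_t) is moved inside the word, next to a(x_s)b(x_t); there the product admits
    the substitution, which turns it into p(phi(x, z), x) Y(a, z)b. *)
Lemma subst_word (Q : PS K 'I_n) :
  subK S (smul (mulS Q (push s t p)) (sandwich (comp2 a b))) =
  smul (subS S Q) (smul (push s t pi) (sandwich (YE phi a b))).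
Proof.
have nQ : nonneg (supp Q) := fser_in Q.
rewrite (smulA (F := ordF)); last 3 first.
- exact: nonneg_ordF.
- by apply: nonneg_ordF; exact: push_nonneg.
- exact: sandwich_comp_ordF.
rewrite (sandwich_push Lp); last by move=> v; exact: comp2_LL.
have lv v : laurent2 (smul p (comp2 a b v)) by case: cp.
rewrite (subK_mul (F := ordF)); last 3 first.
- by apply: lift2_mul => //; exact: phk_mul.
- exact: nonneg_summable.
- apply: sandwich_summable => // x.
  by rewrite /smul fsum0 // => e; rewrite comp20 scaler0.
rewrite sandwich_lift; last by move=> v; exact: laurent2_summable.
congr (smul _ _); rewrite (sandwich_push Lpi); last by move=> v; exact: (YE_LL lphi phi1 cp).
by congr sandwich; apply/funext => v; rewrite -/pi (YE_E lphi phi1 cp).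
Qed.

Lemma subst_word' (Q : PS K 'I_n) :
  subK S (smul (mulS Q (push s t p)) (sandwich (comp2 a b))) =
  smul (subS S (mulS Q (push s t p))) (sandwich (YE phi a b)).
Proof.
have nQ : nonneg (supp Q) := fser_in Q.
have np : nonneg (supp (push s t p)) by exact: push_nonneg.
rewrite subst_word (subS_mul (F := ordF)); last 3 first.
- by apply: lift2_mul => //; exact: phk_mul.
- exact: nonneg_summable.
- exact: nonneg_summable.
have -> : subS S (push s t p) = push s t pi by rewrite lift2_push.
apply: esym; apply: (smulA (F := ordF)).
- by apply: subS_in; exact: nonneg_summable.
- have <- : subS S (push s t p) = push s t pi by rewrite lift2_push.
  by apply: subS_in; exact: nonneg_summable.
- exact: sandwich_YE_ordF.
Qed.

End Phi.
End Sandwich.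

(** * Products over pairs of variables, and insertion of a variable *)

Section PairProducts.
Variables (K : fieldType) (r : nat).

Definition ps_pairs (p : int * int -> K) (hp : pseries2 p) : PS K 'I_r :=
  \prod_(ij : 'I_r * 'I_r | (ij.1 < ij.2)%N) ps_push ij.1 ij.2 hp.

Lemma at_variablesE (p : int * int -> K) (i j : 'I_r) : at_variables p i j = push i j p.
Proof.
apply/funext => e; rewrite /at_variables /push; congr (if _ then _ else _).
by apply: eq_forallb => k; rewrite zerozE.
Qed.

Lemma prod_pairsE (p : int * int -> K) (hp : pseries2 p) : prod_pairs p = ps_pairs hp :> (_ -> _).
Proof.
rewrite /ps_pairs (big_morph (@fser_val _ _ _) (@fser_valM _ _ _) (fser_val1 _ _)).
by apply: eq_bigr => ij _; rewrite at_variablesE.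
Qed.

Lemma ps_pairsM (p q : int * int -> K) (hp : pseries2 p) (hq : pseries2 q) :
  ps_pairs (pseries2_mul hp hq) = ps_pairs hp * ps_pairs hq.
Proof.
rewrite /ps_pairs -big_split; apply: eq_bigr => -[i j] /= ij.
by apply: val_inj; rewrite /= push_mul // -(inj_eq val_inj) neq_ltn ij.
Qed.

Lemma ps_pairsX (p : int * int -> K) (hp : pseries2 p) n :
  ps_pairs (pseries2_npow n hp) = ps_pairs hp ^+ n.
Proof.
rewrite /ps_pairs -prodrXl; apply: eq_bigr => -[i j] /= ij.
apply: val_inj; apply: etrans (esym (fser_valX _ _)).
by rewrite /= push_npow // -(inj_eq val_inj) neq_ltn ij.
Qed.

Lemma laurentr_cls (V : lmodType K) (h : {ffun 'I_r -> int} -> V) :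
  laurentr h <-> cls pred0 (supp h).
Proof.
rewrite cls0P; split=> -[N hN]; exists N.
  move=> e /= nz i; rewrite leNgt; apply: contra_notN nz => ei.
  by apply: hN; exists i.
move=> e [i ei]; apply: contrapT => /hN /(_ i); by rewrite leNgt ei.
Qed.

End PairProducts.

Section Misc.
Variables (I : finType).
Local Notation Z := {ffun I -> int}.

Lemma nonneg_cls (D : {pred I}) (A : set Z) : nonneg A -> cls D A.
Proof. by move=> nA; split; [exists 0 => e /nA h i _|move=> z; exists 0 => e /nA h _ i _]. Qed.

Lemma push_lexb (K : fieldType) (rho : I -> nat) (s t : I) (q : int * int -> K) :
  (rho s < rho t)%N -> LL (supp q) -> lexb rho (supp (push s t q)).
Proof.
move=> st [[M hM] hN] i g; have [N hN'] := hN (g t).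
exists (Order.min 0 (Order.min M N)) => e /= /push_neq0[/agree0P ag nz] eg; rewrite !ge_min.
have [it|it] := eqVneq i t.
  by have /= := hM _ nz; rewrite it => ->; rewrite ?orbT.
have [is_|is_] := eqVneq i s; last by rewrite ag.
by subst i; move: nz; rewrite /coords (eg t) // => /hN' ->; rewrite !orbT.
Qed.

End Misc.

Section Iota.
Variables (K : fieldType) (r : nat) (t : 'I_r.+1).

(** Inserts the exponent z at index t. Series for the shorter word thus become slices of series for
    the longer one, where t holds the variable of the vertex operator. *)
Definition iota_at (z : int) (e : {ffun 'I_r -> int}) : {ffun 'I_r.+1 -> int} :=
  [ffun i => if unlift t i is Some i' then e i' else z].

Lemma iota_t z e : iota_at z e t = z.
Proof. by rewrite ffunE unlift_none. Qed.
Lemma iota_lift z e i : iota_at z e (lift t i) = e i.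
Proof. by rewrite ffunE liftK. Qed.
Lemma iota_inj z : injective (iota_at z).
Proof. by move=> e g eg; apply/ffunP => i; rewrite -(iota_lift z) eg iota_lift. Qed.
Lemma iota_eq z (e : {ffun 'I_r -> int}) (g : {ffun 'I_r.+1 -> int}) :
  g t = z -> (forall i, g (lift t i) = e i) -> g = iota_at z e.
Proof.
move=> gt gl; apply/ffunP => i; case: (unliftP t i) => [j ->|->]; last by rewrite iota_t.
by rewrite gl iota_lift.
Qed.
Lemma iotaD : {morph iota_at 0 : a b / a + b}.
Proof.
move=> a b; apply/esym/iota_eq; first by rewrite addzE !iota_t.
by move=> i; rewrite !addzE !iota_lift.
Qed.
Lemma iotaB z e a : iota_at z e - iota_at 0 a = iota_at z (e - a).
Proof.
apply: iota_eq; first by rewrite subzE !iota_t subr0.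
by move=> i; rewrite !subzE !iota_lift.
Qed.

Lemma ext_iota_lt z (e : {ffun 'I_r -> int}) k : (k < t)%N -> ext (iota_at z e) k = ext e k.
Proof.
move=> kt; have kr : (k < r)%N by have := ltn_ord t; lia.
rewrite -[k]/(nat_of_ord (Ordinal kr)) ext_ord -(iota_lift z) -ext_ord; congr (ext _ _).
by rewrite /= /bump leqNgt kt.
Qed.

Lemma ext_iota_gt z (e : {ffun 'I_r -> int}) k : (t < k)%N -> ext (iota_at z e) k = ext e k.-1.
Proof.
move=> tk; have [kr|kr] := ltnP k r.+1; last first.
  by rewrite /ext !insubF //=; apply/negP; lia.
have kr' : (k.-1 < r)%N by lia.
rewrite -[k.-1]/(nat_of_ord (Ordinal kr')) ext_ord -(iota_lift z) -ext_ord; congr (ext _ _).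
by rewrite /= /bump; lia.
Qed.

Lemma iota_nonneg A : nonneg A -> nonneg (iota_at 0 @` A).
Proof.
move=> nA _ [e Ae <-] i; case: (unliftP t i) => [j ->|->]; last by rewrite iota_t.
by rewrite iota_lift; exact: nA.
Qed.

Lemma pushk_iota_summable (A : set {ffun 'I_r -> int}) : nonneg A ->
  summable (nonnegF _) (pushk K (iota_at 0)) A.
Proof.
move=> nA; apply: summable_push; first exact: iota_nonneg.
move=> g; have [[e0 e0g]|ne] := pselect (exists e, iota_at 0 e = g).
  by apply: (sub_finite_set _ (finite_set1 e0)) => e [_]; rewrite -e0g => /iota_inj.
by apply: (sub_finite_set _ (@finite_set0 _)) => e [_ eg]; apply: ne; exists e.
Qed.

Definition ps_iota (x : PS K 'I_r) : PS K 'I_r.+1 :=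
  fser_of (subS_in (pushk_iota_summable (fser_in x))).

Lemma ps_iotaM x y : ps_iota (x * y) = ps_iota x * ps_iota y.
Proof.
apply: val_inj; apply: (subS_mul (F := nonnegF _)).
- by apply: pushk_mul; exact: iotaD.
- exact: pushk_iota_summable (fser_in x).
- exact: pushk_iota_summable (fser_in y).
Qed.

Lemma ps_iotaE (x : PS K 'I_r) e : ps_iota x (iota_at 0 e) = x e.
Proof. exact: (push_inj (V := K^o) _ _ (@iota_inj 0)). Qed.

Lemma ps_iota_t (x : PS K 'I_r) g : ps_iota x g <> 0 -> exists e, g = iota_at 0 e.
Proof.
move=> nz; apply: contrapT => ne; apply: nz; apply: (push_out (V := K^o)) => e ge.
by apply: ne; exists e.
Qed.

Lemma ps_iota1 : ps_iota 1 = 1.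
Proof.
apply: val_inj; apply/funext => g.
have [[e ->]|ne] := pselect (exists e, g = iota_at 0 e).
  rewrite [LHS]ps_iotaE /= /sone; congr (nat_of_bool _)%:R.
  apply/eqP/eqP => [->|e0]; first by apply/esym/iota_eq => [|i]; rewrite !zerozE.
  by apply/ffunP => i; rewrite -(iota_lift 0) e0 !zerozE.
transitivity (0 : K).
  by apply: contrapT => /ps_iota_t.
rewrite /= /sone; case: eqP => // g0; case: ne; exists 0.
by rewrite g0; apply: iota_eq => [|i]; rewrite !zerozE.
Qed.

Lemma ps_iotaX x n : ps_iota (x ^+ n) = ps_iota x ^+ n.
Proof. by elim: n => [|n IH]; rewrite ?expr0 ?ps_iota1 // !exprS ps_iotaM IH. Qed.

Lemma ps_iota_push (i j : 'I_r) (p : int * int -> K) (hp : pseries2 p) :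
  ps_iota (ps_push i j hp) = ps_push (lift t i) (lift t j) hp.
Proof.
apply: val_inj; apply/funext => g.
have lE (k a : 'I_r) : (lift t k != lift t a) = (k != a) by rewrite (inj_eq lift_inj).
have [[e ->]|ne] := pselect (exists e, g = iota_at 0 e).
  rewrite [LHS]ps_iotaE /= /push /coords !iota_lift; congr (if _ then _ else _).
  apply/agree0P/agree0P => h k.
    move=> k1 k2; case: (unliftP t k) k1 k2 => [k' ->|->]; last by rewrite iota_t.
    by rewrite !lE iota_lift => k1 k2; apply: h.
  by move=> k1 k2; rewrite -(iota_lift 0) h ?lE.
transitivity (0 : K); first by apply: contrapT => /ps_iota_t.
rewrite /= /push; case: ifP => // /agree0P ag; case: ne.
exists [ffun k => g (lift t k)]; apply: iota_eq => [|k]; last by rewrite ffunE.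
by apply: ag; rewrite neq_lift.
Qed.

Lemma smul_iota (V : lmodType K) (x : PS K 'I_r) (h : {ffun 'I_r.+1 -> int} -> V) z e :
  smul (ps_iota x) h (iota_at z e) = smul x (fun e => h (iota_at z e)) e.
Proof.
rewrite /smul (fsum_inj (iota_at 0)); last 2 first.
- exact: iota_inj.
- move=> g nz; apply: (@ps_iota_t x) => z0; by apply: nz; rewrite z0 scale0r.
by apply: eq_fsum => a; rewrite ps_iotaE iotaB.
Qed.

End Iota.

Definition ps_dvd (R : comNzRingType) (x y : R) := exists z, y = z * x.

Lemma ps_dvd_prod (R : comNzRingType) (J : finType) (P : pred J) (f : J -> R) (y : R) :
  (forall j, P j -> ps_dvd (f j) y) -> ps_dvd (\prod_(j | P j) f j) (y ^+ #|P|).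
Proof.
move=> h; rewrite -prodr_const; elim/big_rec2: _ => [|j a b Pj [z ->]]; first by exists 1; rewrite mulr1.
by have [z' ->] := h j Pj; exists (z' * z); rewrite mulrACA.
Qed.

Lemma ps_dvdX (R : comNzRingType) (x y : R) n : ps_dvd x y -> ps_dvd (x ^+ n) (y ^+ n).
Proof. by move=> [z ->]; exists (z ^+ n); rewrite exprMn. Qed.

Lemma ps_nonneg (K : fieldType) (I : finType) (x : PS K I) : nonneg (supp x).
Proof. exact: (fser_in x). Qed.

(** * Quasi compatibility of the generated subspace *)

Section Replacement.
Variables (K : fieldType) (W : lmodType K) (phi : int * int -> K).
Hypotheses (lphi : laurent_pseries (V := K^o) phi) (phi1 : forall i, phi (i, 0) = (i == 1)%:R).

(* Quasi compatibility of a word given as a list; the exponent of the k-th letter is ext e k. *)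
Definition qcl r (l : seq (calE W)) : Prop := exists p : int * int -> K,
  [/\ pseries2 p, p <> 0, subst_phi_scalar phi p <> 0 &
      forall w, laurentr (smul (prod_pairs p) (fun e : {ffun 'I_r -> int} => compL l w (ext e)))].

Lemma qc_seq_qcl r (a : 'I_r -> calE W) l : size l = r -> (forall i : 'I_r, a i = nth 0 l i) ->
  quasi_compatible_seq phi a <-> qcl r l.
Proof.
move=> sl al; have e w : compr a w = (fun e : {ffun 'I_r -> int} => compL l w (ext e)).
  by apply/funext => e; exact: compr_compL.
by split=> -[p [h1 h2 h3 h4]]; exists p; split=> // w; rewrite ?e // -e.
Qed.

Lemma subst_scalar_neq0 p : subst_phi_scalar phi p <> 0 -> p <> 0.
Proof. by move=> nz p0; apply: nz; rewrite p0; exact: (subK0 K^o (phk phi)). Qed.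

Lemma subst_scalar_npow p n : pseries2 p ->
  subst_phi_scalar phi p <> 0 -> subst_phi_scalar phi (npow p n) <> 0.
Proof.
move=> pp p0; elim: n => [|n IH]; last by apply: (subst_scalar_mul lphi phi1) => //; exact: pseries2_npow.
move=> /(congr1 (fun f => f (0, 0))) /=; rewrite /subst_phi_scalar /subst_phi (fsum1 (0, 0)).
  rewrite /= /sone (_ : (0, 0) - (0, 0) = (0 - 0, 0 - 0)) // subr0 eqxx /=.
  by move/eqP; rewrite scale1r oner_eq0.
by move=> [m n'] nz; rewrite /= /sone; case: eqP => [[e1 e2]|]; rewrite ?scaler0 //; case: nz; rewrite e1 e2.
Qed.

Section Step.
Variables (l1 l2 : seq (calE W)) (a b : calE W) (r : nat) (s t : 'I_r.+1).
Hypotheses (hs : nat_of_ord s = size l1) (ht : nat_of_ord t = (size l1).+1)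
  (hn : (r.+1 = size l1 + (size l2).+2)%N).
Variable p : int * int -> K.
Hypotheses (cp : compatible_with phi a b p).
Let pp : pseries2 p. Proof. by case: cp. Qed.
Hypothesis hl : forall w, laurentr (smul (prod_pairs p)
  (fun e : {ffun 'I_r.+1 -> int} => compL (l1 ++ a :: b :: l2) w (ext e))).

Let st : s != t.
Proof. by rewrite -(inj_eq val_inj) /= hs ht neq_ltn ltnSn. Qed.
Let slt : (s < t)%N. Proof. by rewrite hs ht. Qed.

Local Notation Z := {ffun 'I_r.+1 -> int}.
Local Notation F := (ordF r.+1).
Local Notation D := ([predU1 t & pred0] : {pred 'I_r.+1}).

Let Q : PS K 'I_r.+1 := \prod_(ij : 'I_r.+1 * 'I_r.+1 | (ij.1 < ij.2)%N && (ij != (s, t)))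
  ps_push ij.1 ij.2 pp.

Let PQ : ps_pairs r.+1 pp = Q * ps_push s t pp.
Proof. by rewrite /ps_pairs (bigD1 (s, t)) //= mulrC. Qed.

Let R : Z -> K := subS (lift2 s t (phk phi)) Q.
Let rho : PS K 'I_r.+1 := ps_fuse st Q.

Let FR : F (supp R).
Proof. by apply: subS_in; apply: nonneg_summable => //; [exact: hs|exact: ht|exact: ps_nonneg]. Qed.

Let Frho : F (supp rho).
Proof. by apply: nonneg_ordF; exact: ps_nonneg. Qed.

Let tD : t \in D. Proof. by rewrite !inE eqxx. Qed.
Let sD : s \notin D. Proof. by rewrite !inE ?orbF. Qed.

Let clsR : cls D (supp R).
Proof.
apply: (subS_in (F := clsF D)); apply: lift_phk_cls => //.
by apply: nonneg_cls0; exact: ps_nonneg.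
Qed.

Let clsrho : cls D (supp rho).
Proof. by apply: nonneg_cls; exact: ps_nonneg. Qed.

(* phi(x, z) = x at z = 0, so R and rho agree in degrees <= 0 in z. *)
Let R_rho (g : Z) : g t <= 0 -> R g = rho g.
Proof.
rewrite le_eqVlt => /orP[/eqP gt0|gt_neg]; last first.
  transitivity (0 : K); last first.
    by apply/esym; apply: contrapT => nz; have := ps_nonneg nz t; rewrite leNgt gt_neg.
  apply: contrapT => /(subK_supp (V := K^o)) [e nQ].
  have [kappa hk] := lift_phk_near st lphi phi1; move=> /hk[_ [_]].
  by rewrite subzE upd_t // subr0 leNgt gt_neg.
rewrite /R /= /subS subK_lift2 // /subK.
rewrite [RHS](fsum_inj (upd s t g)); last 2 first.
- exact: upd_inj.
- move=> e nz; exists (coords s t e).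
  have ge : g = fuse s t e.
    by apply: contrapT => ne; apply: nz; rewrite /pushk; case: eqP => // _; rewrite scale0r.
  apply/ffunP => i; rewrite ge !ffunE /=.
  by case: eqP => [->//|_]; case: eqP => [->//|].
apply: eq_fsum => -[m k].
suff -> : phk phi (m, k) (coords s t g) = pushk K (fuse s t) (upd s t g (m, k)) g by [].
rewrite /phk /pushk /= (_ : coords s t g - (k, 0) = (g s - k, g t - 0)) // gt0 subr0 zpow_row0 //.
congr (nat_of_bool _)%:R; apply/eqP/eqP => [e|->]; last by rewrite upd_s // upd_s // upd_t //= addrK.
apply/ffunP => i; rewrite !ffunE /=; case: (eqVneq i s) => [->|_].
  by rewrite eqxx eq_sym (negbTE st) eqxx -e subrK.
by case: (eqVneq i t) => [->|].
Qed.

Section Vector.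
Variable w : W.
Let B : Z -> W := sandwich s t l1 l2 w (YE phi a b).

Let FB : F (supp B).
Proof. exact: (sandwich_YE_ordF hs ht hn lphi phi1 cp). Qed.

Let pi := subst_phi_scalar phi p.
Let Lpi : LL (supp pi). Proof. exact: subst_scalar_LL. Qed.
Let ipi := @inv_in K (laurent_laurent (V := K^o)) pi.
Let Lipi : LL (supp ipi) /\ mulS pi ipi = @sone K _.
Proof. by apply: scalar_inverse => //; case: cp. Qed.

Let pushF (q : int * int -> K) : LL (supp q) -> F (supp (push s t q)).
Proof. by move=> Lq; apply: lexb_lexF; exact: push_lexb. Qed.

(** The image of the full product is R p(phi(x, z), x) B by [subst_word], and it lies in [cls D];
    dividing by the invertible factor p(phi(x, z), x) preserves this. *)
Let cls_RB : cls D (supp (smul R B)).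
Proof.
have T := subst_word w hs ht hn lphi phi1 cp Q.
have lT : cls pred0 (supp (smul (mulS Q (push s t p)) (sandwich s t l1 l2 w (comp2 a b)))).
  have := hl w; rewrite laurentr_cls (prod_pairsE _ pp) PQ.
  suff -> : (fun e : Z => compL (l1 ++ a :: b :: l2) w (ext e)) = sandwich s t l1 l2 w (comp2 a b) by [].
  by apply/funext => e; exact: sandwich_compL.
have clsS : cls D (supp (subK (lift2 s t (phk phi))
    (smul (mulS Q (push s t p)) (sandwich s t l1 l2 w (comp2 a b))))).
  by apply: (subK_in (F := clsF D)); exact: lift_phk_cls.
have -> : smul R B = smul (push s t ipi) (subK (lift2 s t (phk phi))
    (smul (mulS Q (push s t p)) (sandwich s t l1 l2 w (comp2 a b)))).
  rewrite T -/R -/pi -/B; have Fpi := pushF Lpi; have Fipi := pushF Lipi.1.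
  rewrite -(smulA (F := F) Fipi FR (smul_in Fpi FB)) [mulS _ R]mulSC (smulA (F := F) FR Fipi (smul_in Fpi FB)).
  congr (smul R _); rewrite -(smulA (F := F) Fipi Fpi FB) -push_mul // [mulS ipi pi]mulSC Lipi.2.
  by rewrite push_sone // smul1.
by apply: (smul_in (F := clsF D)) => //; apply: push_cls => //; exact: Lipi.1.
Qed.

Let d : Z -> K := (fser_val rho : Z -> K) - R.
Let Fd : F (supp d).
Proof. by apply: suppD => //; exact: suppN. Qed.
Let clsd : cls D (supp d).
Proof. by apply: (@suppD _ _ (clsF D)) => //; exact: (@suppN _ _ (clsF D)). Qed.

Let Xn N := smul (npow rho N) B.
Let Zn N := smul (npow d N) B.
Let FX N : F (supp (Xn N)). Proof. by apply: smul_in => //; exact: npow_in. Qed.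
Let FZ N : F (supp (Zn N)). Proof. by apply: smul_in => //; exact: npow_in. Qed.

(* rho^N B - (rho - R)^N B is a multiple of R B, which is well behaved. *)
Let cls_diff N : cls D (supp (Xn N - Zn N)).
Proof.
elim: N => [|N IH].
  by rewrite /Xn /Zn /= subrr; exact: (@supp0 _ W (clsF D)).
have XS : Xn N.+1 = smul rho (Xn N) by rewrite /Xn /= (smulA (F := F)) //; exact: npow_in.
have ZS : Zn N.+1 = smul d (Zn N) by rewrite /Zn /= (smulA (F := F)) //; exact: npow_in.
have -> : Xn N.+1 - Zn N.+1 = smul rho (Xn N - Zn N) + smul (npow d N) (smul R B).
  rewrite XS ZS (smulDr (F := F)) ?smulNr //; last exact: suppN.
  rewrite -(smulA (F := F) (npow_in N Fd) FR FB) [mulS _ R]mulSC.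
  rewrite (smulA (F := F) FR (npow_in N Fd) FB).
  rewrite -/(Zn N) {1}/d (smulDl (F := F)) // ?smulNl; last exact: suppN.
  by rewrite opprB -!addrA; congr (_ + _); rewrite addrC.
apply: (@suppD _ _ (clsF D)).
  exact: (smul_in (F := clsF D)).
by apply: (smul_in (F := clsF D)) => //; exact: (npow_in (F := clsF D)).
Qed.

Lemma rho_power_slice (M : int) N (z : int) (x : PS K 'I_r.+1) :
  (forall g : Z, B g <> 0 -> M <= g t) -> z < M + N%:Z ->
  exists L, forall e : Z, e t = z -> smul (fser_val (x * rho ^+ N)) B e <> 0 -> forall i, i != t -> L <= e i.
Proof.
move=> hM zN.
have ZnN N' (g : Z) : Zn N' g <> 0 -> M + N'%:Z <= g t.
  elim: N' g => [|N' IH] g; first by rewrite /Zn /= smul1 addr0; exact: hM.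
  have -> : Zn N'.+1 = smul d (Zn N') by rewrite /Zn /= (smulA (F := F)) //; exact: npow_in.
  move=> /smul_supp[g1 [g2 [d1 /IH h2 ->]]]; rewrite addzE.
  have h1 : 1 <= g1 t.
    rewrite leNgt; apply/negP => lt; apply: d1; rewrite /d addfE oppfE R_rho ?subrr // -ltzD1 add0r.
  by apply: le_trans (lerD h1 h2); rewrite addrCA -intS.
have cx : cls D (sumset (supp x) (supp (Xn N - Zn N))).
  by apply: cls_sum => //; apply: nonneg_cls; exact: ps_nonneg.
have [_ h] := cx; have [L hL] := h [ffun => z]; exists L => e ez nz i it.
apply: hL; last 2 first.
- by move=> j; rewrite !inE ?orbF => /eqP ->; rewrite ffunE.
- by rewrite !inE ?orbF.
move: nz; rewrite fser_valM fser_valX (smulA (F := F)) //; last 2 first.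
- by apply: nonneg_ordF; exact: ps_nonneg.
- exact: npow_in.
move=> /smul_supp[g1 [g2 [x1 x2 eE]]]; exists g1, g2; split=> // z0; apply: x2.
(* The cofactor x can only raise the exponent at t, so g2 t <= z < M + N, below the first degree of
   (rho - R)^N B. *)
have Z0 : Zn N g2 = 0.
  apply: contrapT => /ZnN; have := ps_nonneg x1 t; move: ez; rewrite eE addzE.
  by move: (g1 t) (g2 t) => u v; lia.
by move: z0; rewrite addfE oppfE Z0 subr0.
Qed.

End Vector.

Lemma B_bound : exists M : int, forall w (g : Z), sandwich s t l1 l2 w (YE phi a b) g <> 0 -> M <= g t.
Proof.
have [M hM] := YE_bound lphi phi1 cp; exists M => w' g nz; rewrite leNgt; apply/negP => lt.
by apply: nz; rewrite /sandwich /coords hM // compL0.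
Qed.

(* Every factor of rho is a factor p(x_i, x_j) of the shorter word. *)
Lemma rho_dvd : exists k, ps_dvd rho (ps_iota t (ps_pairs r pp) ^+ k).
Proof.
pose P (ij : 'I_r.+1 * 'I_r.+1) := (ij.1 < ij.2)%N && (ij != (s, t)).
have cE (i j : 'I_r.+1) : P (i, j) ->
    [/\ (collapse s t i < collapse s t j)%N, collapse s t i != t & collapse s t j != t].
  rewrite /P /collapse xpair_eqE -!(inj_eq val_inj) /= hs ht => h.
  by case: ifP; case: ifP; rewrite -?(inj_eq val_inj) /= ?hs ?ht; split; lia.
exists #|P|; have -> : rho = \prod_(ij | P ij) ps_fuse st (ps_push ij.1 ij.2 pp).
  by rewrite /rho /Q (big_morph _ (ps_fuseM st) (ps_fuse1 _ st)).
apply: ps_dvd_prod => -[i j] Pij; have [cij ci cj] := cE _ _ Pij.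
have -> : ps_fuse st (ps_push i j pp) = ps_push (collapse s t i) (collapse s t j) pp.
  apply: val_inj; apply: push_fuse => //; rewrite -(inj_eq val_inj) neq_ltn ?cij //.
  by case/andP: Pij => /= ->.
move: cij ci cj; case: (unliftP t (collapse s t i)) => [i' ->|->]; last by rewrite eqxx.
case: (unliftP t (collapse s t j)) => [j' ->|->] ij _; last by rewrite eqxx.
have {}ij : (i' < j')%N by move: ij; rewrite /= /bump; case: leqP; case: leqP; lia.
rewrite -ps_iota_push /ps_pairs (bigD1 (i', j')) //= ps_iotaM => _.
by eexists; rewrite mulrC.
Qed.

Lemma sandwich_iota w (c : calE W) j (e : {ffun 'I_r -> int}) : c = nth_product phi a b j :> (W -> int -> W) ->
  sandwich s t l1 l2 w (YE phi a b) (iota_at t (- j - 1) e) = compL (l1 ++ c :: l2) w (ext e).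
Proof.
move=> cE; rewrite compL_cat /= cE /nth_product /sandwich /coords iota_t addn0.
rewrite -(ext_ord _ s) ext_iota_lt ?hs ?ht //.
rewrite (@compL_ext _ _ l1 _ _ (ext e)) => [|k kl]; last by rewrite ext_iota_lt ?ht //; lia.
rewrite (_ : tail_vec l1 l2 w _ = compL l2 w (fun k => ext e (size l1 + k.+1)%N)) //.
by apply: compL_ext => k _; rewrite ext_iota_gt ?ht; [congr (ext e _); lia|lia].
Qed.

Lemma qcl_step (c : calE W) j : c = nth_product phi a b j :> (W -> int -> W) -> qcl r (l1 ++ c :: l2).
Proof.
move=> cE; have [k dk] := rho_dvd; have [M hM] := B_bound.
(* The j-th product is the coefficient of z^(-j-1), and this N gives -j-1 < M + N. Since M does not
   depend on w, neither does the multiplier p^(k N). *)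
pose N := absz (- j - M).
have [x xE] := ps_dvdX N dk; rewrite -exprM in xE.
have np : subst_phi_scalar phi (npow p (k * N)) <> 0 by apply: subst_scalar_npow => //; case: cp.
exists (npow p (k * N)); split=> //.
- exact: pseries2_npow.
- exact: subst_scalar_neq0.
move=> w; rewrite laurentr_cls (prod_pairsE _ (pseries2_npow (k * N) pp)) ps_pairsX cls0P.
have [||L hL] := @rho_power_slice w M N (- j - 1) x; [by move=> g; exact: hM|by rewrite /N; lia|].
exists L => e /= nz i; rewrite -(iota_lift t (- j - 1)).
apply: hL; [exact: iota_t| |by rewrite eq_sym neq_lift].
rewrite -xE -ps_iotaX smul_iota.
by rewrite (_ : (fun e : {ffun 'I_r -> int} => _) = (fun e => compL (l1 ++ c :: l2) w (ext e))) //;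
  apply/funext => e'; exact: sandwich_iota.
Qed.

End Step.

Lemma laurentr_ps_smul r (x : PS K 'I_r) (h : {ffun 'I_r -> int} -> W) :
  laurentr h -> laurentr (smul x h).
Proof.
rewrite !laurentr_cls => lh; apply: (smul_in (F := clsF pred0)) => //.
by apply: nonneg_cls0; exact: ps_nonneg.
Qed.

Lemma compL_ordF r (l : seq (calE W)) w : size l = r ->
  ordF r (supp (fun e : {ffun 'I_r -> int} => compL l w (ext e))).
Proof.
move=> sl; apply: lexb_lexF => i g; have il : (i < size l)%N by rewrite sl.
have [N hN] := compL_bound w (ext g) il; exists N => e /hN h eg.
by rewrite -ext_ord; apply: h => k /andP[ik _]; apply: ext_eq => k' kk'; apply: eg; rewrite kk'.
Qed.

Lemma qcl_mul r (l : seq (calE W)) p q : size l = r -> pseries2 q -> pseries2 p ->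
  (forall w, laurentr (smul (prod_pairs p) (fun e : {ffun 'I_r -> int} => compL l w (ext e)))) ->
  forall w, laurentr (smul (prod_pairs (mulS q p)) (fun e : {ffun 'I_r -> int} => compL l w (ext e))).
Proof.
move=> sl pq pp hp w; have := hp w.
rewrite (prod_pairsE _ pp) (prod_pairsE _ (pseries2_mul pq pp)) ps_pairsM => h.
rewrite fser_valM (smulA (F := ordF r)); first exact: laurentr_ps_smul.
- by apply: nonneg_ordF; exact: ps_nonneg.
- by apply: nonneg_ordF; exact: ps_nonneg.
- exact: compL_ordF.
Qed.

(** [qcl_step] wants one multiplier for both the pair and the long word; the product of the two
    given ones serves. *)
Lemma qcl_replace l1 l2 a b (c : calE W) p j : compatible_with phi a b p ->
  c = nth_product phi a b j :> (W -> int -> W) ->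
  qcl (size (l1 ++ a :: b :: l2)) (l1 ++ a :: b :: l2) -> qcl (size (l1 ++ c :: l2)) (l1 ++ c :: l2).
Proof.
move=> cp cE [q [pq q0 sq hq]]; have [pp sp _] := cp.
set r := size (l1 ++ c :: l2).
have rE : r.+1 = (size l1 + (size l2).+2)%N by rewrite /r size_cat /= !addnS.
have rE' : size (l1 ++ a :: b :: l2) = r.+1 by rewrite size_cat /= rE.
have sr : (size l1 < r.+1)%N by rewrite rE; lia.
have tr : ((size l1).+1 < r.+1)%N by rewrite rE; lia.
rewrite rE' in hq.
apply: (@qcl_step l1 l2 a b r (Ordinal sr) (Ordinal tr) erefl erefl rE (mulS q p) _ _ c j cE).
  exact: compatible_mul.
by rewrite mulSC; apply: qcl_mul.
Qed.

Lemma qcl_combine r (l1 : seq (calE W)) a b l2 k p q : (size (l1 ++ a :: l2) = r) ->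
  pseries2 p -> pseries2 q ->
  (forall w, laurentr (smul (prod_pairs p) (fun e : {ffun 'I_r -> int} => compL (l1 ++ a :: l2) w (ext e)))) ->
  (forall w, laurentr (smul (prod_pairs q) (fun e : {ffun 'I_r -> int} => compL (l1 ++ b :: l2) w (ext e)))) ->
  forall w, laurentr (smul (prod_pairs (mulS q p))
    (fun e : {ffun 'I_r -> int} => compL (l1 ++ (k *: a + b) :: l2) w (ext e))).
Proof.
move=> sa pp pq hp hq w; have sb : size (l1 ++ b :: l2) = r by rewrite -sa !size_cat.
have := qcl_mul sa pq pp hp w; have := qcl_mul sb pp pq hq w; rewrite mulSC.
have -> : (fun e : {ffun 'I_r -> int} => compL (l1 ++ (k *: a + b) :: l2) w (ext e)) =
    k *: (fun e : {ffun 'I_r -> int} => compL (l1 ++ a :: l2) w (ext e)) +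
    (fun e : {ffun 'I_r -> int} => compL (l1 ++ b :: l2) w (ext e)).
  by apply/funext => e; rewrite addfE scalefE !compL_cat /= -compL_linear.
set A := (fun e : {ffun 'I_r -> int} => compL (l1 ++ a :: l2) w (ext e)).
set B := (fun e : {ffun 'I_r -> int} => compL (l1 ++ b :: l2) w (ext e)).
have FA : ordF r (supp A) by exact: compL_ordF.
have FB : ordF r (supp B) by exact: compL_ordF.
have Zs (h : {ffun 'I_r -> int} -> W) : supp (k *: h) `<=` supp h.
  by move=> y /= nz z; apply: nz; rewrite scalefE z scaler0.
rewrite (prod_pairsE _ (pseries2_mul pq pp)) (smulDr (F := ordF r)) ?smulZr //; last 2 first.
- by apply: nonneg_ordF; exact: ps_nonneg.
- exact: sf_sub (Zs _) FA.
rewrite !laurentr_cls => hB hA; apply: (@suppD _ _ (clsF pred0)) => //.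
exact: cls_sub (Zs _) hA.
Qed.

Lemma qcl_add l1 a b l2 k : qcl (size (l1 ++ a :: l2)) (l1 ++ a :: l2) ->
  qcl (size (l1 ++ b :: l2)) (l1 ++ b :: l2) ->
  qcl (size (l1 ++ (k *: a + b) :: l2)) (l1 ++ (k *: a + b) :: l2).
Proof.
have sE c : size (l1 ++ c :: l2) = (size l1 + (size l2).+1)%N by rewrite size_cat.
rewrite !sE => -[p [pp p0 sp hp]] [q [pq q0 sq hq]].
have sqp : subst_phi_scalar phi (mulS q p) <> 0 by exact: subst_scalar_mul.
exists (mulS q p); split=> //; first exact: pseries2_mul.
  exact: subst_scalar_neq0.
exact: qcl_combine.
Qed.

End Replacement.

Section Closure.
Variables (K : fieldType) (W : lmodType K) (phi : int * int -> K).
Hypotheses (lphi : laurent_pseries (V := K^o) phi) (phi1 : forall i, phi (i, 0) = (i == 1)%:R).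

Lemma compL_id l1 l2 w r (s : 'I_r.+1) (g : {ffun 'I_r.+1 -> int}) : nat_of_ord s = size l1 ->
  compL (l1 ++ id_calE W :: l2) w (ext g) =
  if g s == 0 then compL (l1 ++ l2) w (ext [ffun i => g (lift s i)]) else 0.
Proof.
move=> hs; have gE : g = iota_at s (g s) [ffun i => g (lift s i)].
  by apply: iota_eq => // i; rewrite ffunE.
rewrite !compL_cat /= /id_fun addn0 -hs ext_ord; case: eqP => _; last exact: compL0.
set h := [ffun i => _] in gE *.
rewrite (@compL_ext _ _ l1 _ _ (ext h)) => [|k kl]; last by rewrite gE ext_iota_lt ?hs.
congr (compL l1 _ _); apply: compL_ext => k _; rewrite [in LHS]gE ext_iota_gt //.
  by rewrite addnS.
by rewrite addnS ltnS leq_addr.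
Qed.

(** The letter 1_W contributes only the exponent 0, so the longer word is the slice 0 of the shorter
    one. The old multiplier, with the new variable inserted, divides a power of the new one. *)
Lemma qcl_id l1 l2 : qcl phi (size (l1 ++ l2)) (l1 ++ l2) ->
  qcl phi (size (l1 ++ id_calE W :: l2)) (l1 ++ id_calE W :: l2).
Proof.
have -> : size (l1 ++ id_calE W :: l2) = (size (l1 ++ l2)).+1 by rewrite !size_cat /= addnS.
set r := size (l1 ++ l2) => -[p [pp p0 sp hp]].
have sr : (size l1 < r.+1)%N by rewrite ltnS /r size_cat leq_addr.
pose s := Ordinal sr.
have [k [x xE]] : exists k, ps_dvd (ps_iota s (ps_pairs r pp)) (ps_pairs r.+1 pp ^+ k).
  pose P (ij : 'I_r * 'I_r) := (ij.1 < ij.2)%N; exists #|P|.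
  rewrite /ps_pairs (big_morph _ (ps_iotaM s) (ps_iota1 _ s)).
  apply: ps_dvd_prod => -[i j]; rewrite /P /= => ij; rewrite ps_iota_push.
  rewrite (bigD1 (lift s i, lift s j)) /=; first by eexists; rewrite mulrC.
  by rewrite /bump; case: leqP; case: leqP; lia.
exists (npow p k); split.
- exact: pseries2_npow.
- by apply: (@subst_scalar_neq0 _ phi); exact: subst_scalar_npow.
- exact: subst_scalar_npow.
move=> w; rewrite (prod_pairsE _ (pseries2_npow k pp)) ps_pairsX xE fser_valM.
set h := (fun e : {ffun 'I_r.+1 -> int} => _).
have Fh : ordF r.+1 (supp h).
  by apply: compL_ordF; rewrite !size_cat /= addnS -size_cat.
rewrite (smulA (F := ordF r.+1)) //; last 2 first.
- by apply: nonneg_ordF; exact: ps_nonneg.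
- by apply: nonneg_ordF; exact: ps_nonneg.
apply: laurentr_ps_smul; rewrite laurentr_cls cls0P.
have := hp w; rewrite laurentr_cls (prod_pairsE _ pp) cls0P => -[L hL].
have hE z e : h (iota_at s z e) = if z == 0 then compL (l1 ++ l2) w (ext e) else 0.
  rewrite /h (compL_id _ _ _ (s := s)) // iota_t; case: ifP => // _; congr (compL _ _ (ext _)).
  by apply/ffunP => i; rewrite ffunE iota_lift.
exists (Order.min 0 L) => e /= nz i.
have eE : e = iota_at s (e s) [ffun i => e (lift s i)].
  by apply: iota_eq => // j; rewrite ffunE.
move: nz; rewrite eE smul_iota.
have [es0|es0] := eqVneq (e s) 0; last first.
  by case; rewrite /smul fsum0 // => a; rewrite hE (negbTE es0) scaler0.
rewrite es0; under [X in smul _ X]funext do rewrite hE eqxx.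
move=> /hL hL'; rewrite ge_min; case: (unliftP s i) => [j ->|->]; last by rewrite iota_t lexx.
by rewrite iota_lift hL' orbT.
Qed.

Lemma qcl_compatible (a b : calE W) : qcl phi 2 [:: a; b] -> exists p, compatible_with phi a b p.
Proof.
move=> [p [pp p0 sp hp]]; exists p; split=> // w.
have st : ord0 != ord_max :> 'I_2 by [].
have PE : ps_pairs 2 pp = ps_push ord0 ord_max pp.
  rewrite /ps_pairs (big_pred1 (ord0, ord_max)) // => -[i j] /=.
  by rewrite xpair_eqE -!(inj_eq val_inj) /=; case: i j => [[|[|?]] ?] [[|[|?]] ?].
have [N hN] := hp w; exists N => i j ij.
pose g := upd ord0 (@ord_max 1) 0 (i, j).
have := hN g; rewrite (prod_pairsE _ pp) PE /= smul_push // coords_upd // => <-.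
  suff -> : (fun x => a (b w (ext (upd ord0 ord_max g x) 1%N)) (ext (upd ord0 ord_max g x) 0%N)) =
    comp2 a b w by [].
  apply/funext => -[m n]; rewrite /comp2 /=.
  set G := upd _ _ _ _.
  have -> : ext G 0 = m.
    by rewrite -[0%N]/(nat_of_ord (@ord0 1)) ext_ord upd_s.
  by rewrite -[1%N]/(nat_of_ord (@ord_max 1)) ext_ord upd_t.
by case/orP: ij => h; [exists ord0; rewrite upd_s|exists ord_max; rewrite upd_t].
Qed.

Variable U : set (calE W).

(** [nth_product a b n] is a bare function, known to lie in E(W) only once a and b are compatible;
    hence [gen_nth] takes an element c equal to it. *)
Inductive gen : calE W -> Prop :=
| gen_base a : U a -> gen a
| gen_id : gen (id_calE W)
| gen_lin k a b : gen a -> gen b -> gen (k *: a + b)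
| gen_nth a b n (c : calE W) : gen a -> gen b ->
    c = nth_product phi a b n :> (W -> int -> W) -> gen c.

Definition gen_pred : {pred calE W} := fun a => `[< gen a >].

Lemma gen_submod : submod_closed gen_pred.
Proof.
split.
  apply/asboolP; have := gen_lin (-1) gen_id gen_id; by rewrite scaleN1r addNr.
by move=> k a b /asboolP ga /asboolP gb; apply/asboolP; exact: gen_lin.
Qed.

HB.instance Definition _ := GRing.isSubmodClosed.Build K (calE W) gen_pred gen_submod.

(* The words of elements of U stay good after appending d; a letter is added to the front of d
   by induction on its generation. *)
Definition good (d : seq (calE W)) : Prop :=
  forall c, (forall x, x \in c -> U x) -> qcl phi (size (c ++ d)) (c ++ d).

Hypothesis qcU : quasi_compatible phi U.

Lemma good_nil : good [::].
Proof.
move=> c cU; rewrite cats0; have := qcU (a := fun i : 'I_(size c) => nth 0 c i).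
by move=> h; apply/(qc_seq_qcl phi (erefl (size c)) (fun _ => erefl)); apply: h => i; apply: cU; exact: mem_nth.
Qed.

(** The induction keeps d arbitrary: for a_n b, the hypothesis on b makes [b :: d] good and that on
    a makes [a :: b :: d] good, after which a, b are replaced by a_n b. The pair itself is
    compatible by the case of an empty d. *)
Lemma gen_good a : gen a -> forall d, good d -> good (a :: d).
Proof.
elim=> {a} [a Ua|||] .
- move=> d gd c cU; rewrite -cat_rcons; apply: gd => x; rewrite mem_rcons inE.
  by case/orP => [/eqP ->//|]; exact: cU.
- by move=> d gd c cU; apply: qcl_id; exact: gd.
- by move=> k a b _ ga _ gb d gd c cU; apply: qcl_add => //; [exact: ga|exact: gb].
- move=> a b n c _ ga _ gb cE d gd e eU.
  have [p cp] : exists p, compatible_with phi a b p.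
    by apply: qcl_compatible; apply: (ga [:: b] (gb _ good_nil) [::]).
  by apply: (qcl_replace lphi phi1 cp cE); apply: ga => //; exact: gb.
Qed.

Lemma gen_qcl l : (forall x, x \in l -> gen x) -> qcl phi (size l) l.
Proof.
move=> gl; suff : good l by move=> /(_ [::]); exact.
elim: l gl => [_|a l IH gl]; first exact: good_nil.
apply: gen_good; first by apply: gl; rewrite mem_head.
by apply: IH => x xl; apply: gl; rewrite inE xl orbT.
Qed.

Lemma quasi_compatible_qcl (A : set (calE W)) l : quasi_compatible phi A ->
  (forall x, x \in l -> A x) -> qcl phi (size l) l.
Proof.
move=> qA lA; apply/(qc_seq_qcl phi (erefl (size l)) (fun _ => erefl)).
by apply: qA => i; apply: lA; exact: mem_nth.
Qed.

Lemma quasi_compatible_pair (A : set (calE W)) a b : quasi_compatible phi A -> A a -> A b ->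
  exists p, compatible_with phi a b p.
Proof.
move=> qA Aa Ab; apply: qcl_compatible; apply: (quasi_compatible_qcl (l := [:: a; b]) qA).
by move=> x; rewrite !inE => /orP[] /eqP ->.
Qed.

Lemma gen_closed : closed_subspace_over phi U gen_pred.
Proof.
have qG : quasi_compatible phi [set` gen_pred].
  move=> r a ga.
  pose l := [seq a i | i <- enum 'I_r].
  have sz : size l = r by rewrite size_map size_enum_ord.
  apply/(qc_seq_qcl phi sz) => [i|]; first by rewrite (nth_map i) ?size_enum_ord // nth_ord_enum.
  rewrite -[in X in qcl _ X]sz; apply: gen_qcl => x /mapP[i _ ->].
  by have := ga i => /asboolP.
split=> //.
- move=> a b aG bG n; have [p cp] := quasi_compatible_pair qG aG bG.
  exists (nthE lphi phi1 cp n) => //; apply/asboolP.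
  by apply: (gen_nth (n := n)) => //; exact/asboolP.
- by move=> a Ua; apply/asboolP; exact: gen_base.
- by apply/asboolP; exact: gen_id.
Qed.

Lemma gen_minimal (T : submodClosed (calE W)) : closed_subspace_over phi U T ->
  forall a, gen a -> a \in T.
Proof.
move=> [cT qT UT idT] a; elim=> {a} [a /UT //|//|k a b _ aT _ bT|a b n c _ aT _ bT cE].
  by rewrite rpredD // rpredZ.
have [c' c'T c'E] := cT a b aT bT n.
by rewrite (_ : c = c') //; apply: val_inj; rewrite /= cE c'E.
Qed.

Lemma gen_generated : generated_subspace phi U gen_pred.
Proof.
split; first exact: gen_closed.
by move=> T cT a /asboolP; exact: gen_minimal.
Qed.

End Closure.

Section SumLemmas.
Variables (K : fieldType) (G : zmodType) (V : lmodType K).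

Lemma supp_sum (F : sfam G) (J : Type) (r : seq J) (h : J -> G -> V) :
  (forall k, F (supp (h k))) -> F (supp (\sum_(k <- r) h k)).
Proof.
move=> Fh; elim: r => [|k r IH]; first by rewrite big_nil; exact: supp0.
by rewrite big_cons; exact: suppD.
Qed.

Lemma smul_sumr (F : sfam G) (J : Type) (r : seq J) f (h : J -> G -> V) : F (supp f) ->
  (forall k, F (supp (h k))) -> smul f (\sum_(k <- r) h k) = \sum_(k <- r) smul f (h k).
Proof.
move=> Ff Fh; elim: r => [|k r IH]; first by rewrite !big_nil smul0r.
by rewrite !big_cons (smulDr (F := F)) ?IH //; exact: supp_sum.
Qed.

Lemma summable_supp_sum (G' : zmodType) (F' : sfam G') (T : G -> G' -> K) (J : Type) (r : seq J) (h : J -> G -> V) :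
  (forall k, summable F' T (supp (h k))) -> summable F' T (supp (\sum_(k <- r) h k)).
Proof.
move=> sh; elim: r => [|k r [IH1 IH2]].
  rewrite big_nil; split=> [|g].
    by apply: sf_sub (sf_zero F') => g [e []].
  by apply: sub_finite_set (@finite_set0 _) => e [] [].
have [h1 h2] := sh k; rewrite big_cons.
have sub : supp (h k + \sum_(j <- r) h j) `<=` supp (h k) `|` supp (\sum_(j <- r) h j).
  move=> x /= nz; apply: contrapT => /not_orP[/contrapT f0 /contrapT g0]; apply: nz.
  by rewrite addfE f0 g0 addr0.
split=> [|g].
  apply: sf_sub (sf_union h1 IH1) => g [e /sub[he|he] Te]; [left|right]; by exists e.
have : finite_set ([set e | supp (h k) e /\ T e g <> 0] `|`
    [set e | supp (\sum_(j <- r) h j) e /\ T e g <> 0]) by rewrite finite_setU.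
by apply: sub_finite_set => e [/sub[he|he] Te]; [left|right].
Qed.

Lemma subK_sum (G' : zmodType) (F' : sfam G') (T : G -> G' -> K) (J : Type) (r : seq J) (h : J -> G -> V) :
  (forall k, summable F' T (supp (h k))) ->
  subK T (\sum_(k <- r) h k) = \sum_(k <- r) subK T (h k).
Proof.
move=> sh; elim: r => [|k r IH]; first by rewrite !big_nil subK0.
by rewrite !big_cons (subKD (F := F')) ?IH //; exact: summable_supp_sum.
Qed.

End SumLemmas.

Lemma sum_fctE (T J : Type) (V : zmodType) (r : seq J) (h : J -> T -> V) x :
  (\sum_(k <- r) h k) x = \sum_(k <- r) h k x.
Proof. by elim: r => [|k r IH]; rewrite ?big_nil // !big_cons addfE IH. Qed.

(** * Weak associativity *)

Section PhaseTwo.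
Variables (K : fieldType) (I : finType) (s t o : I).
Hypotheses (st : s != t) (so : s != o) (to : t != o) (cover : forall i, [|| i == s, i == t | i == o]).
Local Notation Z := {ffun I -> int}.

(* Three variables, the exponent of o being frozen at k. *)
Definition slab (k : int) (x : int * int) : Z := upd s t [ffun => k] x.

Lemma slab_o k x : slab k x o = k.
Proof. by rewrite /slab upd_off ?ffunE // eq_sym. Qed.
Lemma slab_coords k x : coords s t (slab k x) = x.
Proof. exact: coords_upd. Qed.
Lemma slabE (g : Z) : slab (g o) (coords s t g) = g.
Proof.
apply/ffunP => i; case/or3P: (cover i) => /eqP ->; rewrite ?slab_o //.
  exact: upd_s.
exact: upd_t.
Qed.
Lemma upd_slab (g : Z) x : upd s t g x = slab (g o) x.
Proof. by rewrite -[LHS]slabE upd_off 1?eq_sym // coords_upd. Qed.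
Lemma slabB k x k' x' : slab k x - slab k' x' = slab (k - k') (x - x').
Proof. by rewrite -[LHS]slabE subzE !slab_o coordsB !slab_coords. Qed.

(** The exponent j at o splits as (N + i) + (j - N - i), with j - M - N + 1 choices of i. If that
    number is negative, [absz] creates spurious terms, which vanish. *)
Lemma smul_slab (V : lmodType K) (f : Z -> K) (h : Z -> V) (N M j : int) x :
  (forall k, LL (supp (fun x => f (slab k x)))) -> (forall k, LL (supp (fun x => h (slab k x)))) ->
  (forall g, f g <> 0 -> N <= g o) -> (forall g, h g <> 0 -> M <= g o) ->
  smul f h (slab j x) = \sum_(i < absz (j - M - N + 1))
    smul (fun x => f (slab (N + i%:Z) x)) (fun x => h (slab (j - (N + i%:Z)) x)) x.
Proof.
move=> Lf Lh fN hM; pose n := absz (j - M - N + 1).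
have fin : finite_set [set y : int * (int * int) | f (slab y.1 y.2) *: h (slab (j - y.1) (x - y.2)) <> 0].
  apply: (finite_dep (finite_interval N (j - M))
    (B := fun k => [set y | f (slab k y) <> 0 /\ h (slab (j - k) (x - y)) <> 0])).
    by move=> k _; exact: sf_fin (Lf k) (Lh (j - k)) x.
  move=> [k y] /= nz.
  have [h1 h2] : f (slab k y) <> 0 /\ h (slab (j - k) (x - y)) <> 0.
    by split=> z; apply: nz; rewrite z ?scale0r ?scaler0.
  split=> //; have := fN _ h1; have := hM _ h2; rewrite !slab_o => ? ?; split; lia.
rewrite /smul (fsum_bij (fun y : int * (int * int) => slab y.1 y.2) (fun g => (g o, coords s t g))); last 2 first.
- by move=> [k y] /=; rewrite slab_o slab_coords.
- by move=> g; exact: slabE.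
transitivity (fsum (fun k => fsum (fun y => f (slab k y) *: h (slab (j - k) (x - y))))).
  rewrite fsum_pair //; apply: eq_fsum => -[k y] /=; by rewrite slabB.
rewrite (fsum_bij (fun k => N + k) (fun k => k - N)); [|by move=> k; rewrite addrC addKr|by move=> k; rewrite addrC subrK].
have rng k : fsum (fun y => f (slab (N + k) y) *: h (slab (j - (N + k)) (x - y))) <> 0 ->
    0 <= k /\ k <= j - M - N.
  move=> /fsum_neq0[y nz].
  have [h1 h2] : f (slab (N + k) y) <> 0 /\ h (slab (j - (N + k)) (x - y)) <> 0.
    by split=> z; apply: nz; rewrite z ?scale0r ?scaler0.
  by have := fN _ h1; have := hM _ h2; rewrite !slab_o => ? ?; split; lia.
have [neg|pos] := ltP (j - M - N) 0.
  rewrite fsum0 => [|k]; last by apply: contrapT => /rng; lia.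
  apply/esym; apply: big1 => i _; apply: (@contrapT) => nz.
  by have := rng i%:Z nz; lia.
rewrite (@fsum_nat_range _ _ (absz (j - M - N)%R)) => [|k /rng]; last by lia.
by have -> : (absz (j - M - N)%R).+1 = absz (j - M - N + 1)%R by lia.
Qed.

Section Vertex.
Variables (W : lmodType K) (phi : int * int -> K).
Hypotheses (lphi : laurent_pseries (V := K^o) phi) (phi1 : forall i, phi (i, 0) = (i == 1)%:R).

Lemma common_multiplier (A B : int -> calE W) (ks : seq int) :
  (forall k, exists p, compatible_with phi (A k) (B k) p) ->
  exists q, [/\ pseries2 q, subst_phi_scalar phi q <> 0 &
    forall k, k \in ks -> compatible_with phi (A k) (B k) q].
Proof.
move=> h; elim: ks => [|k ks [q [pq sq hq]]].
  have [q [pq sq _]] := h 0; by exists q.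
have [p cp] := h k; have [pp sp _] := cp; exists (mulS q p).
split; [exact: pseries2_mul|exact: subst_scalar_mul|].
move=> k'; rewrite inE => /orP[/eqP ->|/hq h']; first exact: compatible_mul.
by rewrite mulSC; exact: compatible_mul.
Qed.

Variables (A B : int -> calE W) (w : W) (mu : Z -> K) (M N : int).
Hypotheses (cAB : forall k, exists p, compatible_with phi (A k) (B k) p)
  (comp0 : forall k x, comp2 (A k) (B k) w x <> 0 -> M <= k)
  (YE0 : forall k x, YE phi (A k) (B k) w x <> 0 -> M <= k)
  (muN : forall g, mu g <> 0 -> N <= g o)
  (mu_slab : forall k, laurent2 (V := K^o) (fun x => mu (slab k x))).

Definition comp_family (g : Z) : W := comp2 (A (g o)) (B (g o)) w (coords s t g).
Definition YE_family (g : Z) : W := YE phi (A (g o)) (B (g o)) w (coords s t g).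

Hypothesis prod_slab : forall k, laurent2 (fun x => smul mu comp_family (slab k x)).

(* A and B depend on the exponent at o, so a multiplier is available only for finitely many of
   them at a time; on each slice only finitely many contribute. *)
Lemma phase_two : subK (lift2 s t (phk phi)) (smul mu comp_family) =
  smul (subS (lift2 s t (phk phi)) mu) YE_family.
Proof.
apply/funext => g; rewrite subK_lift2 //.
set j := g o; set n := absz (j - M - N + 1).
pose m (i : nat) := fun x => mu (slab (N + i%:Z) x).
pose c (i : nat) := comp2 (A (j - (N + i%:Z))) (B (j - (N + i%:Z))) w.
pose y (i : nat) := YE phi (A (j - (N + i%:Z))) (B (j - (N + i%:Z))) w.
have compE k : (fun x => comp_family (slab k x)) = comp2 (A k) (B k) w.
  by apply/funext => x; rewrite /comp_family slab_o slab_coords.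
have YEE k : (fun x => YE_family (slab k x)) = YE phi (A k) (B k) w.
  by apply/funext => x; rewrite /YE_family slab_o slab_coords.
have Lm k : LL (supp (fun x => mu (slab k x))) by exact: (laurent2_LL (V := K^o)).
have Ly k : LL (supp (YE phi (A k) (B k) w)) by have [p cp] := cAB k; exact: (YE_LL lphi phi1 cp).
have Lc k : LL (supp (comp2 (A k) (B k) w)) by exact: comp2_LL.
have sumE : (fun x => smul mu comp_family (upd s t g x)) = \sum_(i < n) smul (m i) (c i).
  apply/funext => x; rewrite upd_slab sum_fctE (@smul_slab _ mu comp_family N M).
  - by apply: eq_bigr => i _; rewrite compE.
  - exact: Lm.
  - by move=> k; move: (Lc k); rewrite -compE.
  - exact: muN.
  - by move=> g' /comp0.
have SmuE k : (fun x => subS (lift2 s t (phk phi)) mu (slab k x)) = subst_phi_scalar phi (fun x => mu (slab k x)).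
  apply/funext => x; rewrite /subS subK_lift2 // slab_coords.
  suff -> : (fun x' => mu (upd s t (slab k x) x')) = (fun x' => mu (slab k x')) by [].
  by apply/funext => x'; rewrite upd_slab slab_o.
have LS k : LL (supp (subst_phi_scalar phi (fun x => mu (slab k x)))).
  by apply: (subS_in (F := LL)); apply: (laurent2_summable lphi phi1 (V := K^o)).
have -> : smul (subS (lift2 s t (phk phi)) mu) YE_family g =
    (\sum_(i < n) smul (subst_phi_scalar phi (m i)) (y i)) (coords s t g).
  rewrite -[in LHS](slabE g) sum_fctE.
  rewrite (@smul_slab _ (subS (lift2 s t (phk phi)) mu) YE_family N M).
  - by apply: eq_bigr => i _; rewrite SmuE YEE.
  - by move=> k; move: (LS k); rewrite -SmuE.
  - by move=> k; move: (Ly k); rewrite -YEE.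
  - move=> g' nz; have := congr1 (fun h => h (coords s t g')) (SmuE (g' o)).
    rewrite /= slabE => e; move: nz; rewrite e => nz.
    have [x {}nz _] := @subK_supp K _ _ K^o (phk phi) _ _ nz.
    by have := muN (nz : mu (slab (g' o) x) <> 0); rewrite slab_o.
  - by move=> g' /YE0.
rewrite sumE -subst_phiE; congr (_ (coords s t g)).
have [q [pq sq hq]] := common_multiplier [seq j - (N + i%:Z) | i <- iota 0 n] cAB.
have cq (i : 'I_n) : compatible_with phi (A (j - (N + i%:Z))) (B (j - (N + i%:Z))) q.
  by apply: hq; apply/mapP; exists (nat_of_ord i) => //; rewrite mem_iota /=.
have L2q := pseries2_laurent2 pq; have Lq : LL (supp q) by exact: (laurent2_LL (V := K^o)).
have Lpq := subst_scalar_LL lphi phi1 pq.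
have lT : laurent2 (\sum_(i < n) smul (m i) (c i)).
  by rewrite -sumE; have := prod_slab j; under eq_fun do rewrite -upd_slab.
(* The summands mu_i A_i B_i need not admit the substitution one by one, only their sum does.
   Multiplied by q each of them does, and q(phi(x, z), x) is cancelled afterwards. *)
apply: (smul_cancel Lpq sq).
- by apply: subK_in; exact: laurent2_summable.
- by apply: supp_sum => i; apply: smul_in; [exact: LS|exact: Ly].
rewrite -subst_phi_smul //.
rewrite (smul_sumr (F := LL)) //; last by move=> i; apply: smul_in; [exact: Lm|exact: Lc].
have Lmi (i : 'I_n) : LL (supp (m i)) by exact: Lm.
have Lci (i : 'I_n) : LL (supp (c i)) by exact: Lc.
have Lyi (i : 'I_n) : LL (supp (y i)) by exact: Ly.
have LSi (i : 'I_n) : LL (supp (subst_phi_scalar phi (m i))) by exact: LS.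
have qe (i : 'I_n) : smul q (smul (m i) (c i)) = smul (m i) (smul q (c i)).
  rewrite -(smulA (F := LL) Lq (Lmi i) (Lci i)) [mulS q _]mulSC.
  by rewrite (smulA (F := LL) (Lmi i) Lq (Lci i)).
under eq_bigr => i _ do rewrite qe.
have l2 (i : 'I_n) : laurent2 (smul q (c i)) by have [_ _ h] := cq i; exact: h.
rewrite subst_phiE (subK_sum (F' := LL)); last first.
  by move=> i; apply: laurent2_summable => //; apply: laurent2_smul; [exact: mu_slab|exact: l2].
rewrite (smul_sumr (F := LL)) //; last by move=> i; apply: smul_in; [exact: LS|exact: Ly].
apply: eq_bigr => i _; rewrite -subst_phiE subst_phi_smul //; last exact: mu_slab.
rewrite -(YE_E lphi phi1 (cq i)).
rewrite -(smulA (F := LL) (LSi i) Lpq (Lyi i)) [mulS _ (subst_phi_scalar phi q)]mulSC.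
by rewrite (smulA (F := LL) Lpq (LSi i) (Lyi i)).
Qed.

End Vertex.
End PhaseTwo.

Section KernelCalculus.
Variable K : fieldType.

Definition mono (G : zmodType) (v : G) : G -> K := fun g => (g == v)%:R.

Lemma subS_mono (G G' : zmodType) (T : G -> G' -> K) v : subS T (mono v) = T v.
Proof.
apply/funext => g; rewrite /subS /subK (fsum1 v); first by rewrite /mono eqxx; exact: mulr1.
by move=> e /eqP/negbTE ev; rewrite /mono ev scaler0.
Qed.

Lemma supp_kim (G G' : zmodType) (T : G -> G' -> K) e : supp (T e) `<=` kim T [set e].
Proof. by move=> g nz; exists e. Qed.

Lemma summable_comp (G G' G'' : zmodType) (F' : sfam G') (F'' : sfam G'') (T : G -> G' -> K)
  (T' : G' -> G'' -> K) A : summable F' T A -> summable F'' T' (kim T A) ->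
  summable F'' (fun e => subS T' (T e)) A /\ kim (fun e => subS T' (T e)) A `<=` kim T' (kim T A).
Proof.
move=> [F1 f1] [F2 f2].
have key e g : A e -> subS T' (T e) g <> 0 -> exists a, [/\ kim T A a, T' a g <> 0 & T e a <> 0].
  move=> Ae /(@subK_supp K _ _ K^o _ _ _)[a Ta T'a]; exists a; split=> //; by exists e.
have sub : kim (fun e => subS T' (T e)) A `<=` kim T' (kim T A).
  by move=> g [e Ae /(key _ _ Ae)[a [ka Ta _]]]; exists a.
split=> //; split=> [|g]; first exact: sf_sub sub F2.
have fin : finite_set [set x : G' * G | (kim T A x.1 /\ T' x.1 g <> 0) /\ (A x.2 /\ T x.2 x.1 <> 0)].
  by apply: (finite_dep (f2 g) (B := fun a => [set e | A e /\ T e a <> 0])).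
apply: sub_finite_set (finite_image snd fin) => e [Ae /(key _ _ Ae)[a [ka Ta Tea]]].
by exists (a, e).
Qed.

Lemma mult_comp (G G' G'' : zmodType) (F'' : sfam G'') (T : G -> G' -> K) (T' : G' -> G'' -> K) :
  multiplicative_kernel T -> multiplicative_kernel T' ->
  (forall e, summable F'' T' (supp (T e))) -> multiplicative_kernel (fun e => subS T' (T e)).
Proof. by move=> mT mT' sT e e'; rewrite mT (subS_mul (F := F'')). Qed.

End KernelCalculus.

Section LiftKernels.
Variables (K : fieldType) (I : finType).
Local Notation Z := {ffun I -> int}.

Definition axis (i : I) (m : int) : Z := [ffun j => if j == i then m else 0].

Variables (s t : I).
Hypothesis st : s != t.

Section Phi.
Variable f : int * int -> K.

Lemma lift_phk_axis_s m : lift2 s t (phk f) (axis s m) = push s t (zpow f m).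
Proof.
apply/funext => g; rewrite /lift2 /push (_ : agree s t (axis s m) g = agree s t 0 g).
  case: ifP => // _; rewrite /phk /coords /axis !ffunE eqxx eq_sym (negbTE st).
  by rewrite (_ : (g s, g t) - (0, 0) = (g s - 0, g t - 0)) // !subr0.
by apply/agreeP/agree0P => h k k1 k2; rewrite h // ffunE (negbTE k1).
Qed.

Lemma lift_phk_mono (e : Z) : e s = 0 -> lift2 s t (phk f) e = mono K (fuse s t e).
Proof.
move=> es; apply/funext => g; rewrite /lift2 /mono.
case: (boolP (agree s t e g)) => [/agreeP ag|nag].
  rewrite /phk /coords es zpow_0 /sone (_ : (g s, g t) - (e t, 0) = (g s - e t, g t - 0)) //.
  congr (nat_of_bool _)%:R; apply/eqP/eqP => [[/eqP e1 e2]|->].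
    apply/ffunP => i; rewrite ffunE /= es add0r.
    case: eqP => [->|/eqP i1]; first by move: e1; rewrite subr_eq0 => /eqP.
    by case: eqP => [->|/eqP i2]; [rewrite -[LHS]subr0|exact: ag].
  by rewrite upd_s // upd_t //= es add0r subrr.
rewrite (_ : (g == _) = false) //; apply: contraNF nag => /eqP ->.
by apply/agreeP => i i1 i2; rewrite upd_off.
Qed.

Lemma fuse_axis_t m : fuse s t (axis t m) = axis s m.
Proof.
apply/ffunP => i; rewrite !ffunE /= eqxx (negbTE st) add0r; case: eqP => // _.
by case: (i =P t).
Qed.

Lemma fuse_axis_off o m : o != s -> o != t -> fuse s t (axis o m) = axis o m.
Proof.
move=> os ot; apply/ffunP => i; rewrite !ffunE /=.
case: (i =P s) => [->|_]; first by rewrite [s == o]eq_sym [t == o]eq_sym (negbTE os) (negbTE ot) addr0.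
by case: (i =P t) => // ->; rewrite eq_sym (negbTE ot).
Qed.

Lemma lift_fgk_mono (e : Z) : e s = 0 -> lift2 s t (fgk f) e = mono K e.
Proof.
move=> es; apply/funext => g; rewrite /lift2 /mono.
case: (boolP (agree s t e g)) => [/agreeP ag|nag].
  rewrite /fgk /coords es zpow_0 /sone (_ : (g s, g t) - (0, e t) = (g s - 0, g t - e t)) //.
  congr (nat_of_bool _)%:R; apply/eqP/eqP => [[e1 /eqP e2]|->]; last by rewrite es !subrr.
  apply/ffunP => i; case: (i =P s) => [->|/eqP i1]; first by rewrite es -[LHS]subr0.
  by case: (i =P t) => [->|/eqP i2]; [move: e2; rewrite subr_eq0 => /eqP|exact: ag].
rewrite (_ : (g == _) = false) //; apply: contraNF nag => /eqP ->.
by apply/agreeP.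
Qed.

Lemma lift_fgk_push_t o q : o != s -> o != t ->
  subS (lift2 s t (fgk f)) (push o t q) = push o t q.
Proof.
move=> os ot; apply/funext => g; rewrite /subS /subK (fsum1 g).
  have [gs|gs] := eqVneq (g s) 0; first by rewrite lift_fgk_mono // /mono eqxx; exact: mul1r.
  rewrite /push ifF ?scaler0 //; apply/negP => /agree0P /(_ s).
  by rewrite eq_sym os st => /(_ isT isT) /eqP; exact/negP.
move=> e eg; have [es|es] := eqVneq (e s) 0.
  by rewrite lift_fgk_mono // /mono (_ : (g == e) = false) ?scale0r //; apply/eqP => ge; apply: eg.
rewrite /push ifF ?scaler0 //; apply/negP => /agree0P /(_ s).
by rewrite eq_sym os st => /(_ isT isT) /eqP; exact/negP.
Qed.

Lemma subS_phk_sone : subS (lift2 s t (phk f)) (@sone K _) = @sone K _.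
Proof.
have sE : @sone K Z = mono K 0 by [].
rewrite [in LHS]sE subS_mono lift_phk_mono ?zerozE // sE; congr (mono K _).
by apply/ffunP => i; rewrite !ffunE /=; do 2 case: eqP => //.
Qed.

Lemma subS_fgk_sone : subS (lift2 s t (fgk f)) (@sone K _) = @sone K _.
Proof.
have sE : @sone K Z = mono K 0 by [].
by rewrite [in LHS]sE subS_mono lift_fgk_mono ?zerozE.
Qed.

End Phi.
End LiftKernels.

(** * Agreement of the two orders of substitution *)

Section Associate.
Variables (K : fieldType) (F phi : int * int -> K).
Hypotheses (char0 : [pchar K] =i pred0) (FF : formal_group F) (Fphi : associate F phi).

Lemma associate_laurent : laurent_pseries (V := K^o) phi. Proof. by case: Fphi. Qed.
Lemma associate_unip i : phi (i, 0) = (i == 1)%:R. Proof. by case: Fphi. Qed.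
Lemma formal_group_pseries : pseries2 F. Proof. by case: FF. Qed.
Lemma formal_group_unip i : F (i, 0) = (i == 1)%:R. Proof. by case: FF. Qed.
Lemma formal_group_laurent : laurent_pseries (V := K^o) F.
Proof. by apply: pseries2_laurent; exact: formal_group_pseries. Qed.

Lemma formal_group_npow_comm n i j : npow F n (i, j) = npow F n (j, i).
Proof.
have sF : swap2 F = F.
  by apply/funext => -[a b]; rewrite /swap2 /= (formal_group_comm char0 FF).
by rewrite -[in RHS]sF npow_swap2.
Qed.

Local Notation Z := {ffun 'I_3 -> int}.
Definition i0 : 'I_3 := Ordinal (isT : (0 < 3)%N).
Definition i1 : 'I_3 := Ordinal (isT : (1 < 3)%N).
Definition i2 : 'I_3 := Ordinal (isT : (2 < 3)%N).

(** One route applies [subst01] and then [subst02]; the other applies [subst12], [subst01] and then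
    [substF]. In the end x is stored at i0, z at i1 and y at i2. *)
Definition subst01 : Z -> Z -> K := lift2 i0 i1 (phk phi).
Definition subst02 : Z -> Z -> K := lift2 i0 i2 (phk phi).
Definition subst12 : Z -> Z -> K := lift2 i1 i2 (phk phi).
Definition substF : Z -> Z -> K := lift2 i1 i2 (fgk F).

Let lphi := associate_laurent.
Let phi1 := associate_unip.
Let lF := formal_group_laurent.
Let F1 := formal_group_unip.

Let m01 : multiplicative_kernel subst01.
Proof. by apply: lift2_mul => //; exact: phk_mul. Qed.
Let m02 : multiplicative_kernel subst02.
Proof. by apply: lift2_mul => //; exact: phk_mul. Qed.
Let m12 : multiplicative_kernel subst12.
Proof. by apply: lift2_mul => //; exact: phk_mul. Qed.
Let mF : multiplicative_kernel substF.
Proof. by apply: lift2_mul => //; exact: fgk_mul. Qed.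

(** The variables z and y, adjoined together: [cls zvars] lies in the iterated spaces for both
    orders of z and y. *)
Definition zvars : {pred 'I_3} := [pred i | (i == i1) || (i == i2)].

Lemma cls_eq (D D' : {pred 'I_3}) (A : set Z) : D =i D' -> cls D A -> cls D' A.
Proof.
move=> DD [[N hN] h]; split; first by exists N => e Ae i; rewrite -DD; exact: hN.
move=> z; have [M hM] := h z; exists M => e Ae ez i; rewrite -DD; apply: hM => // j.
by rewrite DD; exact: ez.
Qed.

Lemma zvars_lexF rho (rho_inj : injective rho) (A : set Z) : (rho i0 < rho i1)%N ->
  (rho i0 < rho i2)%N -> cls zvars A -> lexF rho_inj A.
Proof.
move=> h1 h2; apply: (@clsF_lexF _ zvars) => i j.
rewrite !inE => /orP[] /eqP -> ; rewrite negb_or -!(inj_eq val_inj) /=;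
  by case: j => -[|[|[|]]] //= lt _; rewrite (_ : Ordinal lt = i0) //; apply: val_inj.
Qed.

Lemma zvars_ordF (A : set Z) : cls zvars A -> ordF 3 A.
Proof. exact: zvars_lexF. Qed.

Lemma subst02_summable A : cls (pred1 i1) A -> summable (clsF zvars) subst02 A.
Proof.
move=> cA; apply: summable_mono (lift_phk_cls (s := i0) (t := i2) _ lphi phi1 _ _ cA) => // B.
by apply: cls_eq => i; rewrite !inE orbC.
Qed.

Lemma subst01_summable A : cls (pred1 i2) A -> summable (clsF zvars) subst01 A.
Proof.
move=> cA; apply: summable_mono (lift_phk_cls (s := i0) (t := i1) _ lphi phi1 _ _ cA) => //.
Qed.

Lemma subst01_summable0 A : cls pred0 A -> summable (clsF (pred1 i1)) subst01 A.
Proof.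
move=> cA; apply: summable_mono (lift_phk_cls (s := i0) (t := i1) _ lphi phi1 _ _ cA) => // B.
by apply: cls_eq => i; rewrite !inE ?orbF.
Qed.

Lemma subst12_summable0 A : cls pred0 A -> summable (clsF (pred1 i2)) subst12 A.
Proof.
move=> cA; apply: summable_mono (lift_phk_cls (s := i1) (t := i2) _ lphi phi1 _ _ cA) => // B.
by apply: cls_eq => i; rewrite !inE ?orbF.
Qed.

Lemma substF_summable A : ordF 3 A -> summable (ordF 3) substF A.
Proof.
move=> oA; apply: lift_fgk_summable => // kappa.
by apply: lexb_lexF; apply: near_axis_lexb.
Qed.

Lemma push01_cls q : LL (supp q) -> cls (pred1 i1) (supp (push i0 i1 q : Z -> K)).
Proof. by move=> Lq; apply: push_cls. Qed.

Lemma push01_ordF q : LL (supp q) -> ordF 3 (supp (push i0 i1 q : Z -> K)).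
Proof. by move=> Lq; apply: lexb_lexF; apply: push_lexb. Qed.

Lemma subst02_push01 q g : subS subst02 (push i0 i1 q) g =
  fsum (fun m : int => zpow phi m (g i0, g i2) * q (m, g i1)).
Proof.
rewrite /subS subK_lift2 // /subK (fsum_inj (fun m : int => (m, 0 : int))); last 2 first.
- by move=> x y [].
- move=> [m n] nz; exists m; congr (_, _); apply: contrapT => n0; apply: nz.
  rewrite /push ifF ?scaler0 //; apply/negP => /agree0P /(_ i2 isT isT).
  by rewrite upd_t.
apply: eq_fsum => m; rewrite /push ifT.
  rewrite /coords upd_s // upd_off // /phk /= (_ : (g i0, g i2) - (0, 0) = (g i0 - 0, g i2 - 0)) //.
  by rewrite !subr0.
apply/agree0P => -[[|[|[|]]] // lt] k1 k2.
by rewrite (_ : Ordinal lt = i2) ?upd_t //; apply: val_inj.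
Qed.

Lemma substF_push01 q g : subS substF (push i0 i1 q) g =
  fsum (fun m : int => q (g i0, m) * zpow F m (g i1, g i2)).
Proof.
rewrite /subS subK_lift2 // /subK (fsum_inj (fun m : int => (m, 0 : int))); last 2 first.
- by move=> x y [].
- move=> [m n] nz; exists m; congr (_, _); apply: contrapT => n0; apply: nz.
  rewrite /push ifF ?scaler0 //; apply/negP => /agree0P /(_ i2 isT isT).
  by rewrite upd_t.
apply: eq_fsum => m; rewrite /push ifT.
  rewrite /coords upd_s // upd_off // /fgk /= (_ : (g i1, g i2) - (0, 0) = (g i1 - 0, g i2 - 0)) //.
  by rewrite !subr0 [RHS]mulrC.
apply/agree0P => -[[|[|[|]]] // lt] k1 k2.
by rewrite (_ : Ordinal lt = i2) ?upd_t //; apply: val_inj.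
Qed.

(** With y at i2 and z at i1 this is the associate identity. That identity yields F(y, z) where
    [substF] has F(z, y), and commutativity bridges the gap. *)
Lemma associate_push : subS subst02 (push i0 i1 phi) = subS substF (push i0 i1 phi).
Proof.
have [lph _ ax] := Fphi; apply/funext => g; rewrite subst02_push01 substF_push01 ax.
rewrite [RHS](fsum_inj Posz); last 2 first.
- by move=> x y [].
- move=> [m|m] nz; first by exists m.
  by case: nz; rewrite lph.1 ?mul0r.
by apply: eq_fsum => j /=; rewrite formal_group_npow_comm.
Qed.

Let X1 m : fser K (ordF 3) := fser_of (zvars_ordF
  (subS_in (subst02_summable (push01_cls (zpow_LL lphi phi1 m))))).
Let X2 m : fser K (ordF 3) := fser_of (subS_in (substF_summable (push01_ordF (zpow_LL lphi phi1 m)))).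

Let X1D m n : X1 (m + n) = X1 m * X1 n.
Proof.
apply: val_inj; rewrite /= zpowD // push_mul // (subS_mul (F := clsF zvars)) //.
  by apply: subst02_summable; apply: push01_cls; exact: zpow_LL.
by apply: subst02_summable; apply: push01_cls; exact: zpow_LL.
Qed.

Let X2D m n : X2 (m + n) = X2 m * X2 n.
Proof.
apply: val_inj; rewrite /= zpowD // push_mul // (subS_mul (F := ordF 3)) //.
  by apply: substF_summable; apply: push01_ordF; exact: zpow_LL.
by apply: substF_summable; apply: push01_ordF; exact: zpow_LL.
Qed.

Let X10 : X1 0 = 1.
Proof. by apply: val_inj; rewrite /= push_sone // subS_phk_sone. Qed.
Let X20 : X2 0 = 1.
Proof. by apply: val_inj; rewrite /= push_sone // subS_fgk_sone. Qed.
Let X11 : X1 1 = X2 1.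
Proof. by apply: val_inj; rewrite /= mulS1r; exact: associate_push. Qed.

(* phi(phi(x, y), z)^m = phi(x, F(z, y))^m *)
Lemma associate_push_zpow m :
  subS subst02 (push i0 i1 (zpow phi m)) = subS substF (push i0 i1 (zpow phi m)).
Proof.
suff : X1 m = X2 m by move=> /(congr1 (@fser_val _ _ _)).
(* Both sides are powers in one commutative ring, so agreement for m = 1 forces agreement of the
   inverses. *)
have inv : X1 (-1) = X2 (-1).
  have h1 : X1 (-1) * X1 1 = 1 by rewrite -X1D addNr.
  have h2 : X2 1 * X2 (-1) = 1 by rewrite -X2D subrr.
  by rewrite -[LHS]mulr1 -h2 mulrA -X11 h1 mul1r.
elim/int_ind_shift: m => [|m IH|m IH]; first by rewrite X10 X20.
  by rewrite X1D X2D IH X11.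
by rewrite -(addrK 1 m) X1D X2D IH inv.
Qed.

Let T01 e := subS subst02 (subst01 e).
Let T12 e := subS subst01 (subst12 e).
Let TF e := subS substF (T12 e).

Let cls_set1 (e : Z) : cls pred0 [set e].
Proof.
apply/cls0P; have [N hN] := finite_lb (fun i => e i) (@finite_finset _ [set: 'I_3]).
by exists N => _ -> i; exact: hN.
Qed.

Let sub_T01 (e : Z) : summable (clsF zvars) subst02 (kim subst01 [set e]).
Proof. by apply: subst02_summable; have [] := subst01_summable0 (cls_set1 e). Qed.

Let sub_T12 (e : Z) : summable (clsF zvars) subst01 (kim subst12 [set e]).
Proof. by apply: subst01_summable; have [] := subst12_summable0 (cls_set1 e). Qed.

Let T01_mul : multiplicative_kernel T01.
Proof.
apply: (mult_comp (F'' := clsF zvars)) => // e.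
by apply: summable_sub (sub_T01 e); exact: supp_kim.
Qed.

Let T12_mul : multiplicative_kernel T12.
Proof.
apply: (mult_comp (F'' := clsF zvars)) => // e.
by apply: summable_sub (sub_T12 e); exact: supp_kim.
Qed.

Let T12_summable A : cls pred0 A -> summable (clsF zvars) T12 A.
Proof.
move=> cA; have s12 := subst12_summable0 cA.
by have [] := summable_comp s12 (subst01_summable s12.1).
Qed.

Let TF_mul : multiplicative_kernel TF.
Proof.
apply: (mult_comp (F'' := ordF 3)) => // e; apply: substF_summable; apply: zvars_ordF.
apply: (sf_sub (s := clsF zvars)) (T12_summable (cls_set1 e)).1; exact: supp_kim.
Qed.

Let axis_sum (e : Z) : e = axis i0 (e i0) + axis i1 (e i1) + axis i2 (e i2).
Proof.
apply/ffunP => i; rewrite !addzE !ffunE.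
case: i => -[|[|[|]]] // lt; rewrite -!(inj_eq val_inj) /= ?addr0 ?add0r; congr (e _); exact: val_inj.
Qed.

(** Both kernels are multiplicative, so powers of single variables suffice. The variable x_1 is the
    associate identity; x_2 goes to phi(x, y) and x_3 to x on both routes. *)
Lemma kernel_identity e : T01 e = TF e.
Proof.
have a0 m : T01 (axis i0 m) = TF (axis i0 m).
  rewrite /T01 /TF /T12 /subst01 /subst12 lift_phk_axis_s // associate_push_zpow.
  rewrite [X in subS (lift2 i0 i1 _) X]lift_phk_mono ?ffunE // subS_mono fuse_axis_off //.
  by rewrite lift_phk_axis_s.
have a1 m : T01 (axis i1 m) = TF (axis i1 m).
  rewrite /T01 /TF /T12 /subst01 /subst12 lift_phk_mono ?ffunE // subS_mono fuse_axis_t //.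
  rewrite /subst02 lift_phk_axis_s //.
  rewrite [X in subS (lift2 i0 i1 _) X]lift_phk_axis_s // lift_phk_push_t //.
  by rewrite /substF lift_fgk_push_t.
have a2 m : T01 (axis i2 m) = TF (axis i2 m).
  rewrite /T01 /TF /T12 /subst01 /subst12 lift_phk_mono ?ffunE // subS_mono fuse_axis_off //.
  rewrite /subst02 lift_phk_mono ?ffunE // fuse_axis_t //.
  rewrite [X in subS (lift2 i0 i1 _) X]lift_phk_mono ?ffunE // subS_mono fuse_axis_t //.
  rewrite lift_phk_mono ?ffunE // fuse_axis_t // subS_mono.
  by rewrite /substF lift_fgk_mono ?ffunE.
by rewrite (axis_sum e) !T01_mul !TF_mul a0 a1 a2.
Qed.

Lemma subst_identity (V : lmodType K) (X : Z -> V) : cls pred0 (supp X) ->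
  subK subst02 (subK subst01 X) = subK substF (subK subst01 (subK subst12 X)).
Proof.
move=> cX; have s01 := subst01_summable0 cX; have s12 := subst12_summable0 cX.
rewrite (subK_comp s01 (subst02_summable s01.1)) (subK_comp s12 (subst01_summable s12.1)).
have sT := T12_summable cX.
rewrite (subK_comp sT (substF_summable (zvars_ordF sT.1))).
by congr (subK _ X); apply/funext => e; exact: kernel_identity.
Qed.

End Associate.

Section MonoFacts.
Variables (K : fieldType) (G : zmodType).

Lemma mono_mul (v v' : G) : mulS (mono K v) (mono K v') = mono K (v + v').
Proof.
apply/funext => g; rewrite mulSE (fsum1 v); first by rewrite /mono eqxx mul1r subr_eq [v + _]addrC.
by move=> e /eqP/negbTE ev; rewrite /mono ev mul0r.
Qed.

Lemma mulS_mono (v : G) (q : G -> K) g : mulS (mono K v) q g = q (g - v).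
Proof.
rewrite mulSE (fsum1 v); first by rewrite /mono eqxx mul1r.
by move=> e /eqP/negbTE ev; rewrite /mono ev mul0r.
Qed.

End MonoFacts.

Lemma mono_cls (K : fieldType) (I : finType) (D : {pred I}) (v : {ffun I -> int}) : cls D (supp (mono K v)).
Proof.
have [N hN] := finite_lb (fun i => v i) (@finite_finset _ [set: I]).
have mE g : mono K v g <> 0 -> g = v by rewrite /mono; case: eqP.
split; first by exists N => e /mE -> i _; exact: hN.
by move=> z; exists N => e /mE -> _ i _; exact: hN.
Qed.

Lemma push_mono_t (K : fieldType) (I : finType) (s t : I) (k : int) : s != t ->
  push s t (mono K (0, k)) = mono K (axis t k).
Proof.
move=> st; apply/funext => g; rewrite /push /mono.
have [->|ne] := eqVneq g (axis t k).
  rewrite ifT; last by apply/agree0P => i _ it; rewrite ffunE (negbTE it).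
  by rewrite /coords !ffunE eqxx (negbTE st) eqxx.
case: ifP => // /agree0P ag; case: eqP => // -[e1 e2]; case/eqP: ne.
apply/ffunP => i; rewrite ffunE; case: (eqVneq i t) => [->//|it].
by case: (eqVneq i s) => [->//|is_]; exact: ag.
Qed.

Lemma lift_fgk_axis_s (K : fieldType) (I : finType) (s t : I) (f : int * int -> K) m : s != t ->
  lift2 s t (fgk f) (axis s m) = push s t (zpow f m).
Proof.
move=> st; apply/funext => g; rewrite /lift2 /push (_ : agree s t (axis s m) g = agree s t 0 g).
  case: ifP => // _; rewrite /fgk /coords /axis !ffunE eqxx eq_sym (negbTE st).
  by rewrite (_ : (g s, g t) - (0, 0) = (g s - 0, g t - 0)) // !subr0.
by apply/agreeP/agree0P => h k k1 k2; rewrite h // ffunE (negbTE k1).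
Qed.

Section Slabs.
Variables (I : finType) (s t o : I).
Hypotheses (st : s != t) (so : s != o) (to : t != o).

Lemma cls_slab (K : fieldType) (V : lmodType K) (h : {ffun I -> int} -> V) :
  cls (pred1 o) (supp h) ->
  (exists N, forall g, h g <> 0 -> N <= g o) /\ forall k, laurent2 (fun x => h (slab s t k x)).
Proof.
move=> [[N hN] hz]; split.
  by exists N => g nz; apply: (hN g) => //; rewrite inE.
move=> k; have [M hM] := hz [ffun => k]; exists M => i j ij; apply: contrapT => nz.
have hle u : u != o -> M <= slab s t k (i, j) u.
  move=> uo; apply: (hM _ nz); rewrite ?inE // => v; rewrite inE => /eqP ->.
  by rewrite slab_o // ffunE.
have := hle s so; have := hle t to; rewrite /slab upd_t // upd_s //=.
by move: ij; lia.
Qed.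

End Slabs.

Lemma ps_pairs3 (K : fieldType) (p : int * int -> K) (pp : pseries2 p) :
  ps_pairs 3 pp = ps_push i0 i1 pp * ps_push i0 i2 pp * ps_push i1 i2 pp.
Proof.
rewrite /ps_pairs (bigD1 (i0, i1)) //= (bigD1 (i0, i2)) //= (big_pred1 (i1, i2)) ?mulrA //.
move=> [i j] /=; rewrite !xpair_eqE -!(inj_eq val_inj) /=.
by case: i j => [[|[|[|?]]] ?] [[|[|[|?]]] ?].
Qed.

Lemma cls_ps (K : fieldType) (I : finType) (x : PS K I) : cls pred0 (supp x).
Proof. by apply: nonneg_cls0; exact: ps_nonneg. Qed.

(** * The image of the product of the multipliers *)

Section ScalarOrder.
Variables (K : fieldType) (F phi : int * int -> K).
Hypotheses (char0 : [pchar K] =i pred0) (FF : formal_group F) (Fphi : associate F phi).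
Let lphi := associate_laurent Fphi.
Let phi1 := associate_unip Fphi.
Let lF := formal_group_laurent FF.
Let F1 := formal_group_unip FF.

Local Notation Z := {ffun 'I_3 -> int}.
Local Notation S01 := (subst01 phi).
Local Notation S02 := (subst02 phi).
Local Notation S12 := (subst12 phi).
Local Notation SF := (substF F).

Variable p : int * int -> K.
Hypotheses (pp : pseries2 p) (sp : subst_phi_scalar phi p <> 0).

Let P : PS K 'I_3 := ps_pairs 3 pp.

Let tau (x : Z -> K) : Z -> K := subS S02 (subS S01 x).

Let tauM (x y : Z -> K) : cls pred0 (supp x) -> cls pred0 (supp y) ->
  tau (mulS x y) = mulS (tau x) (tau y).
Proof.
move=> cx cy; have s1 := subst01_summable0 Fphi cx; have s2 := subst01_summable0 Fphi cy.
have c1 : cls (pred1 i1) (supp (subS S01 x)) by exact: (subS_in s1).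
have c2 : cls (pred1 i1) (supp (subS S01 y)) by exact: (subS_in s2).
have m01 : multiplicative_kernel S01 by apply: lift2_mul => //; exact: phk_mul.
have m02 : multiplicative_kernel S02 by apply: lift2_mul => //; exact: phk_mul.
rewrite /tau (subS_mul m01 s1 s2).
exact: (subS_mul m02 (subst02_summable Fphi c1) (subst02_summable Fphi c2)).
Qed.

Let f := subst_phi_scalar phi p.

Lemma scalar_order : exists k : nat, exists u v : int * int -> K,
  [/\ laurent_pseries (V := K^o) u, laurent_pseries (V := K^o) v, mulS u v = @sone K _ &
      f = mulS (mono K (0, k%:Z)) u].
Proof.
have Lf := subst_scalar_LL lphi phi1 pp.
have [k [u [v [lu lv uv fu [i fik]]]]] := LL_decomp Lf sp.
have k0 : 0 <= k.
  by rewrite leNgt; apply/negP => k0; apply: fik; exact: (subst_phi_nonneg lphi phi1 (V := K^o)).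
exists (absz k), u, v; split=> //; apply/funext => -[a b]; rewrite mulS_mono gez0_abs //.
by rewrite (_ : (a, b) - (0, k) = (a - 0, b - k)) // subr0; exact: fu.
Qed.

(** For given exponents of z and y only finitely many powers F(z, y)^m with m >= 0 contribute. Hence
    u(x, F(z, y)) is a series in z and y jointly and belongs to both iterated spaces. *)
Lemma substF_cls u : laurent_pseries (V := K^o) u -> cls zvars (supp (subS SF (push i0 i1 u))).
Proof.
move=> lu; have [kappa hk] := zpow_supp lF F1.
have nz g : subS SF (push i0 i1 u) g <> 0 -> exists m : int,
    [/\ 0 <= m, u (g i0, m) <> 0, 0 <= g i1, 0 <= g i2 & m <= g i1 + kappa (g i2)].
  rewrite substF_push01 // => /fsum_neq0[m nzm]; exists m.
  have [h1 h2] : u (g i0, m) <> 0 /\ zpow F m (g i1, g i2) <> 0.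
    by split=> z; apply: nzm; rewrite z ?mul0r ?mulr0.
  have m0 : 0 <= m by rewrite leNgt; apply/negP => m0; apply: h1; exact: lu.1.
  have [g2 h3] := hk _ _ _ h2.
  have g1 : 0 <= g i1.
    rewrite leNgt; apply/negP => g1; apply: h2; case: m {nzm h1 h3} m0 => // n _.
    by apply: (pseries2_npow n (formal_group_pseries FF)); rewrite g1.
  by split=> //; rewrite -lerBlDr.
split.
  exists 0 => g /nz[m [_ _ h1 h2 _]] i; rewrite !inE => /orP[] /eqP -> //.
move=> z; have [N hN] := choice lu.2.
have [L hL] := finite_lb N (finite_interval 0 (z i1 + kappa (z i2))).
exists L => g /nz[m [m0 um _ _ mk]] gz i; rewrite !inE negb_or => /andP[n1 n2].
have -> : i = i0.
  by apply: val_inj; move: n1 n2; case: i => -[|[|[|]]].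
apply: (@le_trans _ _ (N m)).
  by apply: hL; split=> //; rewrite -(gz i1) ?inE // -(gz i2) ?inE.
by rewrite leNgt; apply/negP => lt; apply: um; exact: hN.
Qed.

Let R := fser K (clsF zvars).

(* p(phi(x, z), x) = z^k u with u invertible; in the product over the three pairs the factor
   z^k of the pair (0, 2) becomes F(z, y)^k, and the other factors are invertible. *)
Lemma scalar_product_order : exists k : nat, exists D : Z -> K,
  cls zvars (supp D) /\ mulS D (tau P) = push i1 i2 (npow F k).
Proof.
have [k [u [v [lu lv uv fE]]]] := scalar_order.
have Lu := laurent_pseries_LL lu; have Lv := laurent_pseries_LL lv.
have cU2 w : LL (supp w) -> cls zvars (supp (push i0 i2 w : Z -> K)) by move=> Lw; apply: push_cls.
(* [mk i n] is the monomial x_i^n, and [U1], [U2], [U3] are the images of the invertible factor for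
   the pairs (0, 1), (0, 2), (1, 2). *)
pose mk i (n : int) : R := fser_of (F := clsF zvars) (mono_cls K zvars (axis i n)).
have mkM i n : mk i (- n) * mk i n = 1.
  apply: val_inj; rewrite /= mono_mul; apply/funext => g; rewrite /mono /sone; congr (nat_of_bool (g == _))%:R.
  by apply/ffunP => j; rewrite addzE !ffunE; case: eqP => _; rewrite ?addNr ?addr0.
pose U1 w (lw : laurent_pseries (V := K^o) w) : R := fser_of (F := clsF zvars)
  (subS_in (subst02_summable Fphi (push01_cls (laurent_pseries_LL lw)))).
pose U2 w (lw : laurent_pseries (V := K^o) w) : R := fser_of (F := clsF zvars) (substF_cls lw).
pose U3 w (lw : laurent_pseries (V := K^o) w) : R := fser_of (F := clsF zvars)
  (cU2 w (laurent_pseries_LL lw)).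
have m02 : multiplicative_kernel S02 by apply: lift2_mul => //; exact: phk_mul.
have mF : multiplicative_kernel SF by apply: lift2_mul => //; exact: fgk_mul.
have UV1 : U1 _ lv * U1 _ lu = 1.
  apply: val_inj; apply: etrans (esym (subS_mul m02 (subst02_summable Fphi (push01_cls Lv))
    (subst02_summable Fphi (push01_cls Lu)))) _.
  by rewrite -push_mul // mulSC uv push_sone // subS_phk_sone.
have UV2 : U2 _ lv * U2 _ lu = 1.
  apply: val_inj; apply: etrans (esym (subS_mul mF (substF_summable FF (push01_ordF Lv))
    (substF_summable FF (push01_ordF Lu)))) _.
  by rewrite -push_mul // mulSC uv push_sone // subS_fgk_sone.
have UV3 : U3 _ lv * U3 _ lu = 1.
  by apply: val_inj; rewrite /= -push_mul // mulSC uv push_sone.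
have cFk : cls zvars (supp (push i1 i2 (npow F k) : Z -> K)).
  by apply: nonneg_cls; apply: push_nonneg; apply: pseries2_npow; exact: formal_group_pseries FF.
pose Fk : R := fser_of (F := clsF zvars) cFk.
have t1 : tau (push i0 i1 p) = fser_val (mk i1 k%:Z * U1 _ lu).
  rewrite /tau [subS S01 _]lift2_push // -/f -/(f) (_ : subS (phk phi) p = f) // fE push_mul //.
  have cm : cls (pred1 i1) (supp (push i0 i1 (mono K (0, k%:Z)))) by rewrite push_mono_t //; exact: mono_cls.
  rewrite (subS_mul m02 (subst02_summable Fphi cm) (subst02_summable Fphi (push01_cls Lu))).
  rewrite push_mono_t // subS_mono; congr mulS.
  by rewrite /subst02 lift_phk_mono ?ffunE // fuse_axis_off.
have t3 : tau (push i1 i2 p) = fser_val (mk i2 k%:Z * U3 _ lu).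
  rewrite /tau /subst01 lift_phk_push_t // [subS S02 _]lift2_push // (_ : subS (phk phi) p = f) //.
  by rewrite fE push_mul // push_mono_t.
(* For the pair (0, 2) the other route is simpler: it gives p(phi(x, F(z, y)), x), which is F(z,
   y)^k u(x, F(z, y)). *)
have t2 : tau (push i0 i2 p) = fser_val (Fk * U2 _ lu).
  have c02 : cls pred0 (supp (push i0 i2 p : Z -> K)) by apply: nonneg_cls0; exact: push_nonneg.
  have e := subst_identity char0 FF Fphi (V := K^o) c02.
  rewrite /tau [LHS]e -/(subS S12 (push i0 i2 p)) -/(subS S01 (subS S12 _)) -/(subS SF _).
  rewrite /subst12 lift_phk_push_t' // [subS S01 _]lift2_push // (_ : subS (phk phi) p = f) // fE push_mul //.
  have cm : ordF 3 (supp (push i0 i1 (mono K (0, k%:Z)))).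
    by apply: zvars_ordF; rewrite push_mono_t //; exact: mono_cls.
  rewrite (subS_mul mF (substF_summable FF cm) (substF_summable FF (push01_ordF Lu))).
  by rewrite push_mono_t // subS_mono /substF lift_fgk_axis_s.
have valM3 (x y z : R) (g1 g2 g3 : Z -> K) : g1 = fser_val x -> g2 = fser_val y ->
    g3 = fser_val z -> mulS (mulS g1 g2) g3 = fser_val (x * y * z) by move=> -> -> ->.
have cp (i j : 'I_3) : cls pred0 (supp (push i j p)) by exact: (cls_ps (ps_push i j pp)).
have tP : tau P = fser_val ((mk i1 k%:Z * U1 _ lu) * (Fk * U2 _ lu) * (mk i2 k%:Z * U3 _ lu)).
  have PE : (P : Z -> K) = mulS (mulS (push i0 i1 p) (push i0 i2 p)) (push i1 i2 p) by rewrite /P ps_pairs3.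
  have c12 := cls_ps (ps_push i0 i1 pp * ps_push i0 i2 pp).
  rewrite PE; apply: etrans (tauM c12 (cp _ _)) _.
  by rewrite (tauM (cp _ _) (cp _ _)); exact: valM3.
(* [D] inverts every factor except F(z, y)^k, whose inverse would be expanded differently for the
   two orders of z and y. *)
pose D : R := mk i1 (- k%:Z) * U1 _ lv * U2 _ lv * (mk i2 (- k%:Z) * U3 _ lv).
exists k, (fser_val D); split; first exact: (fser_in D).
rewrite tP -fser_valM.
have -> : D * ((mk i1 k%:Z * U1 _ lu) * (Fk * U2 _ lu) * (mk i2 k%:Z * U3 _ lu)) =
    (mk i1 (- k%:Z) * mk i1 k%:Z) * (U1 _ lv * U1 _ lu) * (U2 _ lv * U2 _ lu) *
    (mk i2 (- k%:Z) * mk i2 k%:Z) * (U3 _ lv * U3 _ lu) * Fk.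
  by rewrite /D; ring.
by rewrite !mkM UV1 UV2 UV3 !mul1r.
Qed.

End ScalarOrder.

Section Sandwich3.
Variables (K : fieldType) (W : lmodType K) (a : calE W) (w : W) (Y : W -> int * int -> W).

Lemma sandwich_right g :
  sandwich i0 i1 [::] [:: a] w Y g = Y (a w (g i2)) (g i0, g i1).
Proof.
have -> : g i2 = ext g (2%N + 0)%N by rewrite -(ext_ord g i2).
by [].
Qed.

Lemma sandwich_left g :
  sandwich i1 i2 [:: a] [::] w Y g = a (Y w (g i1, g i2)) (g i0).
Proof. by have -> : g i0 = ext g 0%N by rewrite -(ext_ord g i0). Qed.

End Sandwich3.

Section WeakAssociativity.
Variables (K : fieldType) (W : lmodType K) (F phi : int * int -> K).
Hypotheses (char0 : [pchar K] =i pred0) (FF : formal_group F) (Fphi : associate F phi).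
Let lphi := associate_laurent Fphi.
Let phi1 := associate_unip Fphi.
Let lF := formal_group_laurent FF.
Let F1 := formal_group_unip FF.

Local Notation Z := {ffun 'I_3 -> int}.
Local Notation S01 := (subst01 phi).
Local Notation S02 := (subst02 phi).
Local Notation S12 := (subst12 phi).
Local Notation SF := (substF F).

Variable p : int * int -> K.
Hypotheses (pp : pseries2 p) (sp : subst_phi_scalar phi p <> 0).

Let P : PS K 'I_3 := ps_pairs 3 pp.
Let tau (x : Z -> K) : Z -> K := subS S02 (subS S01 x).

Lemma YE_zero (a b : calE W) q w : compatible_with phi a b q ->
  (forall x, comp2 a b w x = 0) -> forall x, YE phi a b w x = 0.
Proof.
move=> cq z x; have [pq sq _] := cq.
suff -> : YE phi a b w = 0 by [].
apply: (smul_cancel (subst_scalar_LL lphi phi1 pq) sq (YE_LL lphi phi1 cq w)); first exact: supp0.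
rewrite (YE_E lphi phi1 cq) (_ : comp2 a b w = 0); last by apply/funext.
by rewrite !smul0r subst_phiE subK0.
Qed.

Variables (a b c : calE W) (e_ f_ : int -> calE W).
Hypotheses (cab : compatible_with phi a b p) (cbc : compatible_with phi b c p)
  (eE : forall j w i, e_ j w i = YE phi a b w (i, j))
  (fE : forall j w i, f_ j w i = YE phi b c w (i, j))
  (ce : forall j, exists q, compatible_with phi (e_ j) c q)
  (cf : forall j, exists q, compatible_with phi a (f_ j) q)
  (hl : forall w, laurentr (smul (prod_pairs p) (fun e : Z => compL [:: a; b; c] w (ext e)))).

Section Vector.
Variable w : W.

Let X : Z -> W := smul P (fun e : Z => compL [:: a; b; c] w (ext e)).

Let clsX : cls pred0 (supp X).
Proof. by have := hl w; rewrite laurentr_cls (prod_pairsE _ pp). Qed.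

(** The series Y(Y(a, z)b, y)c applied to w, followed by Y(a, z)Y(b, y)c before z is replaced by
    F(z, y). *)
Let right_family : Z -> W := YE_family i0 i2 i1 phi e_ (fun _ => c) w.
Let left_family : Z -> W := YE_family i0 i1 i2 phi (fun _ => a) f_ w.

Let right_product : subK S02 (subK S01 X) = smul (tau P) right_family.
Proof.
have P1 : (P : Z -> K) = mulS (ps_push i0 i2 pp * ps_push i1 i2 pp : PS K 'I_3) (push i0 i1 p).
  by rewrite /P ps_pairs3 -mulrA mulrC.
have XE : subK S01 X = smul (subS S01 P) (comp_family i0 i2 i1 e_ (fun _ => c) w).
  have wE : (fun e : Z => compL [:: a; b; c] w (ext e)) = sandwich i0 i1 [::] [:: c] w (comp2 a b).
    by apply/funext => e; exact: (sandwich_compL (l1 := [::])).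
  have := subst_word' w (s := i0) (t := i1) (l1 := [::]) (l2 := [:: c]) erefl erefl erefl lphi phi1 cab
    (ps_push i0 i2 pp * ps_push i1 i2 pp).
  rewrite -P1 -wE => ->.
  suff -> : sandwich i0 i1 [::] [:: c] w (YE phi a b) = comp_family i0 i2 i1 e_ (fun _ => c) w by [].
  by apply/funext => g; rewrite sandwich_right -eE.
have s1 := subst01_summable0 Fphi (cls_ps P).
have c1 : cls (pred1 i1) (supp (subS S01 P)) by exact: (subS_in s1).
have c2 : cls (pred1 i1) (supp (subK S01 X)) by exact: (subK_in (subst01_summable0 Fphi clsX)).
have [[N muN] mu_slab] := @cls_slab _ i0 i2 i1 isT isT isT K K^o _ c1.
have [_ prod_slab] := @cls_slab _ i0 i2 i1 isT isT isT K W _ c2.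
have [M hM] := YE_bound lphi phi1 cab.
have e0 j : j < M -> forall x, comp2 (e_ j) c w x = 0.
  by move=> jM x; rewrite /comp2 eE hM.
rewrite XE in prod_slab *.
apply: (@phase_two _ _ i0 i2 i1 isT isT isT _ _ _ lphi phi1 e_ (fun _ => c) w _ M N) => //.
- by move=> [[|[|[|]]] ?].
- by move=> j x nz; rewrite leNgt; apply: contra_notN nz => /e0.
- move=> j x nz; rewrite leNgt; apply: contra_notN nz => /e0 z.
  by have [q cq] := ce j; exact: YE_zero cq z x.
Qed.

Let left_product : subK S01 (subK S12 X) = smul (subS S01 (subS S12 P)) left_family.
Proof.
have P1 : (P : Z -> K) = mulS (ps_push i0 i1 pp * ps_push i0 i2 pp : PS K 'I_3) (push i1 i2 p).
  by rewrite /P ps_pairs3.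
have XE : subK S12 X = smul (subS S12 P) (comp_family i0 i1 i2 (fun _ => a) f_ w).
  have wE : (fun e : Z => compL [:: a; b; c] w (ext e)) = sandwich i1 i2 [:: a] [::] w (comp2 b c).
    by apply/funext => e; exact: (sandwich_compL (l1 := [:: a])).
  have := subst_word' w (s := i1) (t := i2) (l1 := [:: a]) (l2 := [::]) erefl erefl erefl lphi phi1 cbc
    (ps_push i0 i1 pp * ps_push i0 i2 pp).
  rewrite -P1 -wE => ->.
  suff -> : sandwich i1 i2 [:: a] [::] w (YE phi b c) = comp_family i0 i1 i2 (fun _ => a) f_ w by [].
  by apply/funext => g; rewrite sandwich_left -fE.
have s1 := subst12_summable0 Fphi (cls_ps P).
have c1 : cls (pred1 i2) (supp (subS S12 P)) by exact: (subS_in s1).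
have c2 : cls (pred1 i2) (supp (subK S12 X)) by exact: (subK_in (subst12_summable0 Fphi clsX)).
have [[N muN] mu_slab] := @cls_slab _ i0 i1 i2 isT isT isT K K^o _ c1.
have [_ prod_slab] := @cls_slab _ i0 i1 i2 isT isT isT K W _ c2.
have [M hM] := YE_bound lphi phi1 cbc.
have f0 j : j < M -> forall x, comp2 a (f_ j) w x = 0.
  by move=> jM x; rewrite /comp2 fE hM // calE0.
rewrite XE in prod_slab *.
apply: (@phase_two _ _ i0 i1 i2 isT isT isT _ _ _ lphi phi1 (fun _ => a) f_ w _ M N) => //.
- by move=> [[|[|[|]]] ?].
- by move=> j x nz; rewrite leNgt; apply: contra_notN nz => /f0.
- move=> j x nz; rewrite leNgt; apply: contra_notN nz => /f0 z.
  by have [q cq] := cf j; exact: YE_zero cq z x.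
Qed.

Let left_ordF : ordF 3 (supp left_family).
Proof.
apply: lexb_lexF => i g; have [M hM] := YE_bound lphi phi1 cbc.
have f0 j : YE phi a (f_ j) w <> 0 -> M <= j.
  move=> nz; rewrite leNgt; apply: contra_notN nz => jM; have [q cq] := cf j; apply/funext => x.
  by apply: (YE_zero cq) => y; rewrite /comp2 fE hM // calE0.
have LY j : LL (supp (YE phi a (f_ j) w)) by have [q cq] := cf j; exact: YE_LL cq w.
have nzf (e : Z) : supp left_family e -> YE phi a (f_ (e i2)) w (e i0, e i1) <> 0 by [].
move: i => [[|[|[|?]]] lt]; [| | |by move: lt].
- have [_ /(_ (g i1))[N hN]] := LY (g i2); exists N => e /nzf nz eg.
  have -> : Ordinal lt = i0 by apply: val_inj.
  by apply: hN; move: nz; rewrite (eg i1) // (eg i2) //.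
- have [[N hN] _] := LY (g i2); exists N => e /nzf nz eg.
  have -> : Ordinal lt = i1 by apply: val_inj.
  by move: nz; rewrite (eg i2) // => /hN.
- exists M => e /nzf nz _; have -> : Ordinal lt = i2 by apply: val_inj.
  by apply: f0 => z; apply: nz; rewrite z.
Qed.

(** In Y(Y(a, z)b, y)c the outer variable is z, so i1 gets the highest rank; the natural order of
    the indices, used for the other side, puts y outermost. *)
Let rho2 (i : 'I_3) : nat := if i == i1 then 2%N else if i == i2 then 1%N else 0%N.
Let rho2_inj : injective rho2.
Proof. by move=> [[|[|[|?]]] ?] [[|[|[|?]]] ?] //= _; apply: val_inj. Qed.

Let right_lexF : lexF rho2_inj (supp right_family).
Proof.
apply: lexb_lexF => i g; have [M hM] := YE_bound lphi phi1 cab.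
have e0 j : YE phi (e_ j) c w <> 0 -> M <= j.
  move=> nz; rewrite leNgt; apply: contra_notN nz => jM; have [q cq] := ce j; apply/funext => x.
  by apply: (YE_zero cq) => y; rewrite /comp2 eE hM.
have LY j : LL (supp (YE phi (e_ j) c w)) by have [q cq] := ce j; exact: YE_LL cq w.
have nzf (e : Z) : supp right_family e -> YE phi (e_ (e i1)) c w (e i0, e i2) <> 0 by [].
move: i => [[|[|[|?]]] lt]; [| | |by move: lt].
- have [_ /(_ (g i2))[N hN]] := LY (g i1); exists N => e /nzf nz eg.
  have -> : Ordinal lt = i0 by apply: val_inj.
  by apply: hN; move: nz; rewrite (eg i1) // (eg i2) //.
- exists M => e /nzf nz _; have -> : Ordinal lt = i1 by apply: val_inj.
  by apply: e0 => z; apply: nz; rewrite z.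
- have [[N hN] _] := LY (g i1); exists N => e /nzf nz eg.
  have -> : Ordinal lt = i2 by apply: val_inj.
  by move: nz; rewrite (eg i1) // => /hN.
Qed.

(** The two sides agree after multiplication by [tau P]. Multiplying further by D requires
    associativity of the product in two different spaces; D and [tau P] lie in [cls zvars], hence in
    both. *)
Lemma weak_associativity_product k (D : Z -> K) : cls zvars (supp D) ->
  mulS D (tau P) = push i1 i2 (npow F k) ->
  smul (push i1 i2 (npow F k)) (subK SF left_family) = smul (push i1 i2 (npow F k)) right_family.
Proof.
move=> cD DP; have idX := subst_identity char0 FF Fphi clsX.
have idP := subst_identity char0 FF Fphi (V := K^o) (cls_ps P).
have s12 := subst12_summable0 Fphi (cls_ps P).
have c12 : cls (pred1 i2) (supp (subS S12 P)) by exact: (subS_in s12).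
have c012 : cls zvars (supp (subS S01 (subS S12 P))) by exact: (subS_in (subst01_summable Fphi c12)).
have c01 : cls (pred1 i1) (supp (subS S01 P)) by exact: (subS_in (subst01_summable0 Fphi (cls_ps P))).
have ctau : cls zvars (supp (tau P)) by exact: (subS_in (subst02_summable Fphi c01)).
have mF : multiplicative_kernel SF by apply: lift2_mul => //; exact: fgk_mul.
have sL := substF_summable FF left_ordF.
have tauE : subS SF (subS S01 (subS S12 P)) = tau P by apply: esym; exact: idP.
have eL : smul (tau P) (subK SF left_family) = smul (tau P) right_family.
  rewrite -right_product idX left_product.
  rewrite (subK_mul mF (substF_summable FF (zvars_ordF c012)) sL).
  by rewrite tauE.
have z2 (A : set Z) : cls zvars A -> lexF rho2_inj A by exact: zvars_lexF.
rewrite -DP (smulA (F := ordF 3) (zvars_ordF cD) (zvars_ordF ctau) (subK_in sL)) eL.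
by rewrite (smulA (F := lexF rho2_inj) (z2 _ cD) (z2 _ ctau) right_lexF).
Qed.

End Vector.

Lemma weak_associativity : exists l : nat, forall w i,
  smul (npow F l) (subst_F F (fun mn : int * int => YE phi a (f_ mn.2) w (i, mn.1))) =
  smul (npow F l) (fun mn : int * int => YE phi (e_ mn.1) c w (i, mn.2)).
Proof.
have [k [D [cD DP]]] := scalar_product_order char0 FF Fphi pp sp; exists k => w i; apply/funext => x.
have e := congr1 (fun h : Z -> W => h (upd i1 i2 [ffun => i] x)) (weak_associativity_product w cD DP).
have iu y y' : upd i1 i2 (upd i1 i2 [ffun => i] y) y' i0 = i by rewrite !upd_off // ffunE.
rewrite /= !smul_push // coords_upd // in e.
have EL : (fun y => subK SF (YE_family i0 i1 i2 phi (fun _ => a) f_ w) (upd i1 i2 (upd i1 i2 [ffun => i] x) y)) =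
    subst_F F (fun mn : int * int => YE phi a (f_ mn.2) w (i, mn.1)).
  apply/funext => y; rewrite subK_lift2 // coords_upd //.
  suff -> : (fun y' => YE_family i0 i1 i2 phi (fun _ => a) f_ w
      (upd i1 i2 (upd i1 i2 (upd i1 i2 [ffun => i] x) y) y')) =
      (fun mn : int * int => YE phi a (f_ mn.2) w (i, mn.1)) by [].
  apply/funext => -[m n]; rewrite /YE_family /coords upd_t // upd_s //.
  by rewrite upd_off // iu.
have ER : (fun y => YE_family i0 i2 i1 phi e_ (fun _ => c) w (upd i1 i2 (upd i1 i2 [ffun => i] x) y)) =
    (fun mn : int * int => YE phi (e_ mn.1) c w (i, mn.2)).
  by apply/funext => -[m n]; rewrite /YE_family /coords upd_t // upd_s // iu.
by rewrite -EL -ER.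
Qed.

End WeakAssociativity.

(** * The nonlocal vertex algebra and its module *)

Section VertexOperatorFacts.
Variables (K : fieldType) (W : lmodType K) (phi : int * int -> K).
Hypotheses (lphi : laurent_pseries (V := K^o) phi) (phi1 : forall i, phi (i, 0) = (i == 1)%:R).
Implicit Types a b : calE W.

Lemma laurent2_comb (V : lmodType K) k (h h' : int * int -> V) :
  laurent2 h -> laurent2 h' -> laurent2 (k *: h + h').
Proof.
move=> [N hN] [M hM]; exists (Num.min N M) => i j; rewrite !lt_min.
by case/orP => /andP[lN lM]; rewrite addfE scalefE hN ?hM ?scaler0 ?addr0 ?lN ?lM ?orbT.
Qed.

Lemma suppZ (G : zmodType) (V : lmodType K) (F : sfam G) k (h : G -> V) : F (supp h) -> F (supp (k *: h)).
Proof. by apply: sf_sub => x /= nh h0; apply: nh; rewrite scalefE h0 scaler0. Qed.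

(** The product of the two multipliers works for both pairs, hence for the combination, and the
    defining equations for this one multiplier are linear. *)
Lemma YE_comb k a b a1 b1 a2 b2 p1 p2 :
  compatible_with phi a1 b1 p1 -> compatible_with phi a2 b2 p2 ->
  (forall w, comp2 a b w = k *: comp2 a1 b1 w + comp2 a2 b2 w) ->
  forall w, YE phi a b w = k *: YE phi a1 b1 w + YE phi a2 b2 w.
Proof.
move=> c1 c2 abE w; have [pp1 sp1 _] := c1; have [pp2 sp2 _] := c2.
pose p := mulS p1 p2.
have C2 : compatible_with phi a2 b2 p by apply: compatible_mul.
have C1 : compatible_with phi a1 b1 p by rewrite /p mulSC; apply: compatible_mul.
have [pp sp l1] := C1; have [_ _ l2] := C2.
have Lp : LL (supp (p : int * int -> K)) by exact: laurent2_LL (pseries2_laurent2 pp).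
have pE v : smul p (comp2 a b v) = k *: smul p (comp2 a1 b1 v) + smul p (comp2 a2 b2 v).
  rewrite abE (smulDr (F := LL)) ?smulZr //; last exact: comp2_LL.
  by apply: suppZ; exact: comp2_LL.
have C : compatible_with phi a b p.
  by split=> // v; rewrite pE; exact: laurent2_comb.
have LS := subst_scalar_LL lphi phi1 pp.
have L1 := YE_LL lphi phi1 C1 w; have L2 := YE_LL lphi phi1 C2 w.
apply: (smul_cancel LS sp (YE_LL lphi phi1 C w)); first by apply: suppD => //; exact: suppZ.
rewrite (YE_E lphi phi1 C) pE (smulDr (F := LL) LS) //; last exact: suppZ.
rewrite smulZr (YE_E lphi phi1 C1) (YE_E lphi phi1 C2) !subst_phiE.
rewrite (subKD (F := LL)) ?subKZ //; apply: laurent2_summable => //.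
by move: (l1 w) => [N hN]; exists N => i j ij; rewrite scalefE hN ?scaler0.
Qed.

Lemma subst_scalar_sone : subst_phi_scalar phi (@sone K _) = @sone K _.
Proof.
apply/funext => -[i j]; rewrite /subst_phi_scalar /subst_phi (fsum1 (0, 0)) => [|y y0].
  by rewrite /= /sone eqxx (_ : (i, j) - (0, 0) = (i - 0, j - 0)) // !subr0 [LHS]mulr1.
by rewrite /sone; case: eqP => [//|_]; rewrite scaler0.
Qed.

(** Pairs with p = 1 as a multiplier; this covers those in which one factor is 1_W. *)
Lemma YE_sone a b : (forall w, laurent2 (comp2 a b w)) ->
  compatible_with phi a b (@sone K _) /\ forall w, YE phi a b w = subst_phi phi (comp2 a b w).
Proof.
move=> lab; have C : compatible_with phi a b (@sone K _).
  split=> [i j ij||w]; last by rewrite smul1.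
  - by rewrite /sone; case: eqP ij => // -[-> ->].
  - rewrite subst_scalar_sone => /(congr1 (fun f => f 0)) /eqP.
    by rewrite /sone eqxx oner_eq0.
split=> // w; have := YE_E lphi phi1 C w.
by rewrite subst_scalar_sone !smul1.
Qed.

Lemma comp2_id_l b w m n : comp2 (id_calE W) b w (m, n) = if m == 0 then b w n else 0.
Proof. by []. Qed.

Lemma comp2_id_r a w m n : comp2 a (id_calE W) w (m, n) = if n == 0 then a w m else 0.
Proof. by rewrite /comp2 /= /id_fun; case: eqP => // _; exact: calE0. Qed.

Lemma YE_id_l b w i j : YE phi (id_calE W) b w (i, j) = if j == 0 then b w i else 0.
Proof.
have [|_ ->] := @YE_sone (id_calE W) b.
  move=> v; have [N hN] := calE_bound b v; exists (Num.min N 0) => m n.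
  rewrite comp2_id_l !lt_min => /orP[/andP[_ m0]|/andP[nN _]]; case: eqP => //.
    by move=> z; rewrite z in m0.
  by move=> _; exact: hN.
rewrite /subst_phi (fsum1 (0, i)) => [|[m n] mn].
  rewrite comp2_id_l eqxx zpow_0 /sone (_ : (i, j) - (i, 0) = (i - i, j - 0)) // subrr subr0.
  by rewrite xpair_eqE eqxx /=; case: eqP => _; rewrite ?scale1r ?scale0r.
rewrite comp2_id_l; case: eqP => [m0|_]; last by rewrite scaler0.
rewrite m0 zpow_0 /sone (_ : (i, j) - (n, 0) = (i - n, j - 0)) // xpair_eqE subr_eq0.
by case: eqP => [e|_]; rewrite ?scale0r //; case: mn; rewrite m0 e.
Qed.

Let id_r a : forall w, YE phi a (id_calE W) w = subst_phi phi (comp2 a (id_calE W) w).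
Proof.
have [|_ //] := @YE_sone a (id_calE W).
move=> v; have [N hN] := calE_bound a v; exists (Num.min N 0) => m n.
rewrite comp2_id_r !lt_min => /orP[/andP[mN _]|/andP[_ n0]]; case: eqP => //.
  by move=> _; exact: hN.
by move=> z; rewrite z in n0.
Qed.

Lemma YE_id_r_neg a w i j : j < 0 -> YE phi a (id_calE W) w (i, j) = 0.
Proof. by move=> j0; rewrite id_r subst_phi_nonneg. Qed.

Lemma YE_id_r0 a w i : YE phi a (id_calE W) w (i, 0) = a w i.
Proof.
rewrite id_r /subst_phi (fsum1 (i, 0)) => [|[m n] mn].
  rewrite comp2_id_r eqxx (_ : (i, 0) - (0, 0) = (i - 0, 0 - 0)) // !subr0 zpow_row0 //.
  by rewrite eqxx scale1r.
rewrite comp2_id_r; case: eqP => [n0|_]; last by rewrite scaler0.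
rewrite n0 (_ : (i, 0) - (0, 0) = (i - 0, 0 - 0)) // !subr0 zpow_row0 //.
by case: eqP => [e|_]; rewrite ?scale0r //; case: mn; rewrite n0 e.
Qed.

End VertexOperatorFacts.

Section Evaluation.
Variables (K : fieldType) (V W : lmodType K) (L : V -> W).
Hypothesis lL : linear L.

(* Y(Y(u, x_0)v, x_2)w lies in V((x_2))((x_0)), where LL does not apply: the two exponents
   play exchanged roles. *)
Lemma smul_linear_right_finite (f : int * int -> K) (h : int * int -> V) M x : pseries2 f ->
  (forall i j, i < M -> h (i, j) = 0) -> (forall i, exists N : int, forall j, j < N -> h (i, j) = 0) ->
  L (smul f h x) = smul f (L \o h) x.
Proof.
case: x => x y pf hM hN; have L0 : L 0 = 0 by have := lL (-1) 0 0; rewrite scaler0 addr0 scaleN1r addNr.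
have LD : {morph L : u v / u + v} by move=> u v; have := lL 1 u v; rewrite !scale1r.
rewrite /smul fsum_morph //; last first.
  have [N Nh] := choice hN.
  have [B hB] := finite_lb (fun i => N (x - i)) (finite_interval 0 (x - M)).
  apply: sub_finite_set (finite_setX (finite_interval 0 (x - M)) (finite_interval 0 (y - B))).
  move=> [i j] /= nz.
  have [f0 h0] : f (i, j) <> 0 /\ h (x - i, y - j) <> 0.
    split=> z; apply: nz; first by rewrite z scale0r.
    by apply: etrans (scaler0 V (f (i, j))); congr (_ *: _).
  have : ~~ ((i < 0) || (j < 0)) by apply: contra_notN f0; exact: pf.
  rewrite negb_or -!leNgt => /andP[i0 j0].
  have iM : i <= x - M by rewrite leNgt; apply: contra_notN h0 => lt; apply: hM; lia.
  have jN : N (x - i) <= y - j by rewrite leNgt; apply: contra_notN h0; exact: Nh.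
  have Bj : B <= N (x - i) := hB i (conj i0 iM).
  by split; split=> //=; move: Bj jN; set n := N _; lia.
by apply: eq_fsum => e; have := lL (f e) (h ((x, y) - e)) 0; rewrite !addr0 L0 addr0.
Qed.

End Evaluation.

Section CalECombination.
Variables (K : fieldType) (W : lmodType K).
Implicit Types a b c : calE W.

Lemma calE_comb k a b w i : (k *: a + b) w i = k *: a w i + b w i.
Proof. by []. Qed.

Lemma comp2_comb_l k a b c w : comp2 (k *: a + b) c w = k *: comp2 a c w + comp2 b c w.
Proof. by []. Qed.

Lemma comp2_comb_r k a b c w : comp2 a (k *: b + c) w = k *: comp2 a b w + comp2 a c w.
Proof. by apply/funext => x; rewrite addfE scalefE -calE_linear. Qed.

End CalECombination.

Section Adjoint.
Variables (K : fieldType) (W : lmodType K) (F phi : int * int -> K).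
Hypotheses (char0 : [pchar K] =i pred0) (FF : formal_group F) (Fphi : associate F phi).
Let lphi := associate_laurent Fphi.
Let phi1 := associate_unip Fphi.
Variable S : submodClosed (calE W).
Hypotheses (cS : YE_closed phi S) (qS : quasi_compatible phi [set` S]) (idS : id_calE W \in S).
Local Notation V := (subspace S).

Let pairS (a b : V) : exists p, compatible_with phi (\val a) (\val b) p.
Proof. by apply: (quasi_compatible_pair qS); exact: valP. Qed.

Lemma vertex_coef (a b : V) : exists c : int -> V,
  forall j w i, \val (c j) w i = YE phi (\val a) (\val b) w (i, j).
Proof.
have h j : exists c : V, \val c = nth_product phi (\val a) (\val b) (- j - 1) :> (W -> int -> W).
  by have [c cV cE] := cS (valP a) (valP b) (- j - 1); exists (Subspace cV).
have [c hc] := choice h.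
by exists c => j w i; rewrite hc /nth_product opprD !opprK addrK.
Qed.

Definition vertex_fun (a b : V) : int -> V := projT1 (cid (vertex_coef a b)).

Lemma vertex_funE a b j w i : \val (vertex_fun a b j) w i = YE phi (\val a) (\val b) w (i, j).
Proof. exact: (projT2 (cid (vertex_coef a b))). Qed.

Lemma val_ext (a b : V) : (forall w i, \val a w i = \val b w i) -> a = b.
Proof. by move=> ab; do 2!apply: val_inj; apply/funext => w; apply/funext => i; exact: ab. Qed.

Lemma val_comb k (a b : V) : \val (k *: a + b) = k *: \val a + \val b.
Proof. by []. Qed.

Lemma eval_linear w i : linear (fun a : V => \val a w i).
Proof.
move=> k a b; rewrite val_comb; exact: calE_comb.
Qed.

Lemma eval0 w i : \val (0 : V) w i = 0.
Proof.
by have := eval_linear w i (-1) 0 0; rewrite scaler0 addr0 scaleN1r addNr.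
Qed.

Lemma vertex_fun_hom a : vertex_fun a \in @hom_laurent K V.
Proof.
apply/asboolP; split=> [k b c|b].
  apply/funext => j; apply: val_ext => w i; rewrite vertex_funE.
  have [p1 c1] := pairS a b; have [p2 c2] := pairS a c.
  rewrite (YE_comb lphi phi1 (k := k) c1 c2) ; last first.
    by move=> v; rewrite val_comb comp2_comb_r.
  apply: etrans (esym (eval_linear w i k (vertex_fun a b j) (vertex_fun a c j))).
  by rewrite !vertex_funE.
have [p c1] := pairS a b; have [M hM] := YE_bound lphi phi1 c1; exists M => j jM.
by apply: val_ext => w i; rewrite vertex_funE hM // eval0.
Qed.

Definition vertex (a : V) : calE V := CalE (vertex_fun_hom a).

Lemma vertexE a b j w i : \val (vertex a b j) w i = YE phi (\val a) (\val b) w (i, j).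
Proof. exact: vertex_funE. Qed.

Definition vacuum : V := Subspace idS.

Lemma vertex_linear : linear vertex.
Proof.
move=> k a b; apply: val_inj; apply/funext => c; apply/funext => j; apply: val_ext => w i.
rewrite vertexE; have [p1 c1] := pairS a c; have [p2 c2] := pairS b c.
rewrite (YE_comb lphi phi1 (k := k) c1 c2) ; last first.
  by move=> v; rewrite val_comb comp2_comb_l.
apply: etrans (esym (eval_linear w i k (vertex a c j) (vertex b c j))).
by rewrite !vertexE.
Qed.

Lemma vertex0 : vertex 0 = 0.
Proof. by have := vertex_linear (-1) 0 0; rewrite scaler0 addr0 scaleN1r addNr. Qed.

Lemma vertex_weak_associativity (u v w : V) : exists l : nat,
  smul (npow F l) (subst_F F (comp2 (vertex u) (vertex v) w)) =
  smul (npow F l) (fun ij : int * int => vertex (vertex u v ij.1) w ij.2).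
Proof.
have [p1 c1] := pairS u v; have [p2 c2] := pairS v w.
have [p0 [pp0 _ sp0 h0]] : qcl phi 3 [:: \val u; \val v; \val w].
  apply: (quasi_compatible_qcl (l := [:: \val u; \val v; \val w]) qS) => x.
  by rewrite !inE => /or3P[] /eqP ->; exact: valP.
have [pp1 sp1 _] := c1; have [pp2 sp2 _] := c2.
(* One multiplier for the pairs (u, v) and (v, w) and for the word u, v, w. *)
pose p := mulS (mulS p1 p2) p0.
have pp12 := pseries2_mul pp1 pp2; have pp01 := pseries2_mul pp0 pp1.
have pp02 := pseries2_mul pp0 pp2.
have pp : pseries2 p := pseries2_mul pp12 pp0.
have sp12 := subst_scalar_mul lphi phi1 pp1 pp2 sp1 sp2.
have sp : subst_phi_scalar phi p <> 0 := subst_scalar_mul lphi phi1 pp12 pp0 sp12 sp0.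
have L_ (q : int * int -> K) : pseries2 q -> LL (supp q).
  by move=> pq; exact: laurent2_LL (pseries2_laurent2 pq).
have cvw : compatible_with phi (\val v) (\val w) p.
  have -> : p = mulS (mulS p0 p1) p2 by rewrite /p mulSC (mulSA (F := LL)) //; exact: L_.
  exact: (compatible_mul lphi phi1 c2 pp01 (subst_scalar_mul lphi phi1 pp0 pp1 sp0 sp1)).
have cuv : compatible_with phi (\val u) (\val v) p.
  have -> : p = mulS (mulS p0 p2) p1.
    by rewrite /p mulSC [mulS p1 p2]mulSC (mulSA (F := LL)) //; exact: L_.
  exact: (compatible_mul lphi phi1 c1 pp02 (subst_scalar_mul lphi phi1 pp0 pp2 sp0 sp2)).
have hl := qcl_mul (l := [:: \val u; \val v; \val w]) erefl (pseries2_mul pp1 pp2) pp0 h0.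
have [l hw] := weak_associativity char0 FF Fphi pp sp cuv cvw
  (e_ := fun j => \val (vertex u v j)) (f_ := fun j => \val (vertex v w j))
  (fun j x i => vertexE u v j x i) (fun j x i => vertexE v w j x i)
  (fun j => pairS _ _) (fun j => pairS _ _) hl.
have pF := formal_group_pseries FF; have pFl := pseries2_npow l pF.
exists l; apply/funext => x; apply: val_ext => y i.
have eL := eval_linear y i; have Lc := comp2_LL (vertex u) (vertex v) w.
have sF := fgk_summable (formal_group_laurent FF) (formal_group_unip FF) Lc.
have := congr1 (fun h => h x) (hw y i); rewrite /=.
have -> : (fun mn : int * int => YE phi (\val u) (\val (vertex v w mn.2)) y (i, mn.1)) =
    (fun a : V => \val a y i) \o comp2 (vertex u) (vertex v) w.
  by apply/funext => -[m n]; rewrite /= vertexE.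
have -> : (fun mn : int * int => YE phi (\val (vertex u v mn.1)) (\val w) y (i, mn.2)) =
    (fun a : V => \val a y i) \o (fun ij => vertex (vertex u v ij.1) w ij.2).
  by apply/funext => -[m n]; rewrite /= vertexE.
have [M hM] := calE_bound (vertex u) v.
(* Evaluation at (y, i) is pulled out of the sums, on each side within the space in which that side
   has finite sums. *)
rewrite -(smul_linear_right_finite eL (M := M)) //; last 2 first.
- by move=> m n mM; rewrite -[LHS]/(vertex (vertex u v m) w n) hM // vertex0.
- by move=> m; have [N hN] := calE_bound (vertex (vertex u v m)) w; exists N => n; exact: hN.
move=> <-.
rewrite (smul_linear (F := LL) x eL); [|exact: L_|exact: (subK_in sF)].
congr (smul _ _ x); apply/funext => z; exact: (subK_linear z eL sF).
Qed.

Lemma adjoint_structure : exists (Y : V -> calE V) (vac : V),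
  [/\ forall (a b : V) (n : int),
        \val (Y a b (- n - 1)) = nth_product phi (\val a) (\val b) n :> (W -> int -> W),
      \val vac = id_calE W,
      nonlocal_vertex_algebra F Y vac &
      coordinated_quasi_module phi Y vac (fun a : V => \val a)].
Proof.
exists vertex, vacuum; split=> //.
- by move=> a b n; apply/funext => w; apply/funext => i; rewrite vertexE.
- split.
  + exact: vertex_linear.
  + move=> v n; apply: val_ext => w i; rewrite vertexE YE_id_l //.
    by case: eqP => _.
  + by move=> v n n0; apply: val_ext => w i; rewrite vertexE YE_id_r_neg.
  + by move=> v; apply: val_ext => w i; rewrite vertexE YE_id_r0.
  + exact: vertex_weak_associativity.
- split=> //.
  move=> u v; have [q cq] := pairS u v; have [pq sq lq] := cq; exists q; split=> // w.
  rewrite -(YE_E lphi phi1 cq).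
  suff -> : (fun ij : int * int => \val (vertex u v ij.2) w ij.1) = YE phi (\val u) (\val v) w by [].
  by apply/funext => -[i j]; rewrite vertexE.
Qed.

End Adjoint.

Theorem theorem4p8 (R : realType) (F phi : int * int -> R[i])
    (W : lmodType R[i]) (U : set (calE W)) :
  formal_group F -> associate F phi -> quasi_compatible phi U ->
  [/\ exists S : submodClosed (calE W), closed_subspace_over phi U S,
      exists S : submodClosed (calE W), generated_subspace phi U S &
      forall S : submodClosed (calE W), generated_subspace phi U S ->
      exists (Y : subspace S -> calE (subspace S)) (vac : subspace S),
        [/\ forall (a b : subspace S) (n : int),
              \val (Y a b (- n - 1)) = nth_product phi (\val a) (\val b) n
                :> (W -> int -> W),
            \val vac = id_calE W,
            nonlocal_vertex_algebra F Y vac &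
            coordinated_quasi_module phi Y vac
              (fun a : subspace S => \val a)]].
Proof.
move=> FF Fphi qcU.
have lphi := associate_laurent Fphi; have phi1 := associate_unip Fphi.
have G := gen_generated lphi phi1 qcU.
split=> [||S [[cS qS _ idS] _]].
- by have [cG _] := G; eexists; exact: cG.
- by eexists; exact: G.
- exact: (adjoint_structure (pchar_num _) FF Fphi cS qS idS).
Qed.
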